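(* Let $m,n\ge 1$ be integers. For a real $m\times n$ matrix $A \in M_{m\times n}(\mathbb{R})$, $b>0$ and $T>1$, let $$N(A,b,T) := \#\left\{(\mathbf{p},\mathbf{q}) \in \mathbb{Z}^m\times\mathbb{Z}^n : \|A\mathbf{q} - \mathbf{p}\| \le b\|\mathbf{q}\|^{-n/m},\ 1 \le \|\mathbf{q}\| < T\right\}.$$ Then for each $b>0$ and for almost every $A \in M_{m\times n}(\mathbb{R})$ (with respect to Lebesgue measure), $$\lim_{T\to\infty} \frac{N(A,b,T)}{b^m B_m C_n \log T} = 1.$$
   Context: $\|\cdot\|$ denotes the Euclidean norm (on $\mathbb{R}^m$ and on $\mathbb{R}^n$). $B_k$ denotes the volume of the Euclidean unit ball in $\mathbb{R}^k$, and $C_k$ denotes the surface area of the unit sphere $\mathbb{S}^{k-1}\subset\mathbb{R}^k$ (e.g. $C_1=2$, $C_2=2\pi$, $C_3=4\pi$). *)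

(* Defs.v *)
From HB Require Import structures.
From mathcomp Require Import all_boot all_order all_algebra finmap.
From mathcomp Require Import all_classical all_reals all_analysis.

Set Implicit Arguments.
Unset Strict Implicit.
Unset Printing Implicit Defensive.

Import Order.TTheory GRing.Theory Num.Theory.
Import numFieldNormedType.Exports.

Local Open Scope classical_set_scope.
Local Open Scope ring_scope.

Section measurable_matrix.
Context {d : measure_display} {T : measurableType d} {m n : nat}.

(* The product sigma-algebra: the smallest one making all the entries
   measurable. *)
Definition mx_entry_cylinders : set (set 'M[T]_(m, n)) :=
  [set X | exists ij : 'I_m * 'I_n, exists2 B : set T, measurable B &
     X = [set A : 'M[T]_(m, n) | B (A ij.1 ij.2)]].

Let mx_measurable0 : <<s mx_entry_cylinders >> set0.
Proof. exact: sigma_algebra0. Qed.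

Let mx_measurableC X :
  <<s mx_entry_cylinders >> X -> <<s mx_entry_cylinders >> (~` X).
Proof. exact: sigma_algebraC. Qed.

Let mx_measurable_bigcup (F : (set 'M[T]_(m, n))^nat) :
  (forall i, <<s mx_entry_cylinders >> (F i)) ->
  <<s mx_entry_cylinders >> (\bigcup_i (F i)).
Proof. exact: sigma_algebra_bigcup. Qed.

HB.instance Definition _ := @isMeasurable.Build (measure_tuple_display d)
  'M[T]_(m, n) <<s mx_entry_cylinders >>
  mx_measurable0 mx_measurableC mx_measurable_bigcup.

End measurable_matrix.

Section pushforward_iso.
Context d1 d2 (T1 : measurableType d1) (T2 : measurableType d2) (R : realType).
Variable mu : {sigma_finite_measure set T1 -> \bar R}.
Variables (f : T1 -> T2) (g : T2 -> T1).

Definition pushforward_iso of measurable_fun setT f & measurable_fun setT g &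
  cancel f g : set T2 -> \bar R := pushforward mu f.

Hypotheses (mf : measurable_fun setT f) (mg : measurable_fun setT g).
Hypothesis fK : cancel f g.
Local Notation nu := (pushforward_iso mf mg fK).

Let nu_measure : {measure set T2 -> \bar R} :=
  measure_function_pushforward__canonical__measure_function_Measure mu mf.

Let nu0 : nu set0 = 0%E. Proof. exact: (measure0 nu_measure). Qed.

Let nu_ge0 X : (0 <= nu X)%E. Proof. exact: (measure_ge0 nu_measure). Qed.

Let nu_sigma_additive : semi_sigma_additive nu.
Proof. exact: (@measure_semi_sigma_additive _ _ _ nu_measure). Qed.

HB.instance Definition _ := isMeasure.Build _ _ _ nu
  nu0 nu_ge0 nu_sigma_additive.

Let nu_sigma_finite : sigma_finite setT nu.
Proof.
have [F FT mF] := sigma_finiteT mu.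
exists (fun i => g @^-1` F i).
  by rewrite -preimage_bigcup -FT preimage_setT.
move=> i; have [mFi Foo] := mF i; split.
  by rewrite -[X in measurable X]setTI; exact: mg.
rewrite /pushforward_iso /pushforward.
by rewrite (_ : f @^-1` _ = F i) //; apply/seteqP; split=> x /=; rewrite fK.
Qed.

HB.instance Definition _ := Measure_isSigmaFinite.Build _ _ _ nu nu_sigma_finite.

End pushforward_iso.

(* The library declares m1 \x m2 sigma-finite, but canonical inference only
   finds that instance for probabilities, whence this copy. *)
Section sigma_finite_prod.
Context d1 d2 (T1 : measurableType d1) (T2 : measurableType d2) (R : realType).
Variable m1 : {sigma_finite_measure set T1 -> \bar R}.
Variable m2 : {sigma_finite_measure set T2 -> \bar R}.

Definition sigma_finite_prod : set (T1 * T2) -> \bar R := (m1 \x m2)%E.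

HB.instance Definition _ := Measure.copy sigma_finite_prod (m1 \x m2)%E.

Let sigma_finite_prod_sigma_finite : sigma_finite setT sigma_finite_prod.
Proof.
have /sigma_finiteP[F [TF ndF Foo]] := sigma_finiteT m1.
have /sigma_finiteP[G [TG ndG Goo]] := sigma_finiteT m2.
exists (fun n => F n `*` G n).
  rewrite -setXTT TF TG predeqE => -[x y]; split.
    move=> [/= [n _ Fnx] [k _ Gky]]; exists (maxn n k) => //; split.
    - by move: x Fnx; exact/subsetPset/ndF/leq_maxl.
    - by move: y Gky; exact/subsetPset/ndG/leq_maxr.
  by move=> [n _ []/= ? ?]; split; exists n.
move=> k; have [? ?] := Foo k; have [? ?] := Goo k.
split; first exact: measurableX.
rewrite /sigma_finite_prod product_measure1E//.
by rewrite lte_mul_pinfty// ge0_fin_numE.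
Qed.

HB.instance Definition _ := Measure_isSigmaFinite.Build _ _ _
  sigma_finite_prod sigma_finite_prod_sigma_finite.

End sigma_finite_prod.

Section lebesgue_tuple.
Context (R : realType).
Local Notation RR := (measurableTypeR R).

Definition tuple_of_prod k (x : RR * k.-tuple RR) : k.+1.-tuple RR :=
  [tuple of x.1 :: x.2].

Definition prod_of_tuple k (t : k.+1.-tuple RR) : RR * k.-tuple RR :=
  (thead t, [tuple of behead t]).

Lemma measurable_tuple_of_prod k : measurable_fun setT (@tuple_of_prod k).
Proof. by apply: measurable_cons. Qed.

Lemma measurable_prod_of_tuple k : measurable_fun setT (@prod_of_tuple k).
Proof.
apply/measurable_fun_pair; first exact: (measurable_tnth ord0).
exact: measurable_behead.
Qed.

Lemma tuple_of_prodK k : cancel (@tuple_of_prod k) (@prod_of_tuple k).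
Proof. by case=> x t; congr pair; exact/val_inj. Qed.

(* Fubini-style recursion on the identification R^(k+1) = R * R^k, starting
   from the unit mass on the point R^0. *)
Fixpoint lebesgue_tuple k : {sigma_finite_measure set (k.-tuple RR) -> \bar R} :=
  match k with
  | 0 => dirac [tuple]
  | k'.+1 => pushforward_iso (sigma_finite_prod lebesgue_measure (lebesgue_tuple k'))
     (@measurable_tuple_of_prod k') (@measurable_prod_of_tuple k')
     (@tuple_of_prodK k')
  end.

End lebesgue_tuple.

Section lebesgue_mx.
Context (R : realType) (m n : nat).
Local Notation RR := (measurableTypeR R).

Definition mx_of_tuple (t : (m * n).-tuple RR) : 'M[RR]_(m, n) :=
  \matrix_(i, j) tnth t (mxvec_index i j).

Definition tuple_of_mx (A : 'M[RR]_(m, n)) : (m * n).-tuple RR :=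
  [tuple (mxvec A) 0 k | k < m * n].

Lemma measurable_mx_of_tuple : measurable_fun setT mx_of_tuple.
Proof.
apply: (@measurability _ _ _ _ _ _ (mx_entry_cylinders (T := RR))) => //.
move=> _ [_ [[i j] [B mB ->]] <-]; rewrite setTI.
rewrite [X in measurable X](_ : _ = (fun t => tnth t (mxvec_index i j)) @^-1` B).
  by rewrite -[X in measurable X]setTI; exact: measurable_tnth.
by apply/seteqP; split=> t /=; rewrite mxE.
Qed.

Lemma measurable_tuple_of_mx : measurable_fun setT tuple_of_mx.
Proof.
apply/measurable_fun_tnthP => k.
case/mxvec_indexP: k => i j _ B mB.
rewrite setTI; apply: sub_sigma_algebra; exists (i, j), B => //.
by apply/seteqP; split=> A /=; rewrite tnth_mktuple mxvecE.
Qed.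

Lemma mx_of_tupleK : cancel mx_of_tuple tuple_of_mx.
Proof.
move=> t; apply: eq_from_tnth => k; rewrite tnth_mktuple.
by case/mxvec_indexP: k => i j; rewrite mxvecE mxE.
Qed.

Definition lebesgue_mx : {sigma_finite_measure set 'M[RR]_(m, n) -> \bar R} :=
  pushforward_iso (lebesgue_tuple R (m * n))
    measurable_mx_of_tuple measurable_tuple_of_mx mx_of_tupleK.

End lebesgue_mx.

Section euclidean.
Context (R : realType).

(* The library norm `|x| on matrices is the sup norm. *)
Definition enorm k (x : 'cV[R]_k) : R := Num.sqrt (\sum_i x i 0 ^+ 2).

Definition volume k (X : set 'cV[R]_k) : R := fine (lebesgue_mx R k 1 X).

Definition unit_ball_volume k : R := volume [set x : 'cV[R]_k | enorm x <= 1].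

(* Area of a hypersurface S of R^k as its Minkowski content: the limit, as e
   tends to 0, of the volume of the e-neighbourhood of S divided by its
   thickness 2e. For k = 1 and S finite this is the number of points of S. *)
Definition surface_area k (S : set 'cV[R]_k) : R :=
  lim ((fun e : R =>
    volume [set x | exists2 y, S y & enorm (x - y) <= e] / (2 * e)) @ 0^'+).

Definition unit_sphere_area k : R :=
  surface_area [set x : 'cV[R]_k | enorm x = 1].

End euclidean.

Section counting.
Context (R : realType).

Definition int_cV k (z : 'cV[int]_k) : 'cV[R]_k := map_mx intr z.

Definition approximations m n (A : 'M[R]_(m, n)) (b T : R) :
    set ('cV[int]_m * 'cV[int]_n) :=
  [set pq | let p := int_cV pq.1 in let q := int_cV pq.2 in
    enorm (A *m q - p) <= b * enorm q `^ (- (n%:R / m%:R)) /\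
    1 <= enorm q < T].

(* fset_set sends infinite sets to the empty one; finite_approximations below
   shows that this case does not occur. *)
Definition count_approximations m n (A : 'M[R]_(m, n)) (b T : R) : nat :=
  #|` fset_set (approximations A b T)|.

Lemma le_entry_enorm k (x : 'cV[R]_k) i : `|x i 0| <= enorm x.
Proof.
rewrite -sqrtr_sqr ler_wsqrtr// (bigD1 i)//= lerDl.
by apply: sumr_ge0 => j _; exact: sqr_ge0.
Qed.

Lemma finite_int_cV_ball k (x : 'cV[R]_k) (r : R) :
  finite_set [set z : 'cV[int]_k | enorm (x - int_cV z) <= r].
Proof.
pose c := `|r| + \sum_i `|x i 0|.
have c_ge0 : 0 <= c by rewrite addr_ge0// sumr_ge0.
pose K := Num.bound c.
pose h (y : 'cV['I_(K + K).+1]_k) : 'cV[int]_k :=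
  map_mx (fun j : 'I_(K + K).+1 => (j : nat)%:Z - K%:Z) y.
apply: (@sub_finite_set _ _ (h @` setT)); last first.
  exact/finite_image/finite_finset.
move=> z /= zr.
have zK i : `|z i 0| <= K%:Z.
  rewrite -(ler_int R) intr_norm.
  apply: le_trans (ltW (archi_boundP c_ge0)).
  have := le_trans (le_entry_enorm (x - int_cV z) i) zr.
  rewrite !mxE distrC => zxr.
  rewrite -[X in `|X|](subrK (x i 0)) (le_trans (ler_normD _ _))// lerD//.
    exact: le_trans zxr (ler_norm r).
  by rewrite (bigD1 i)//= lerDl sumr_ge0.
exists (map_mx (fun t : int => inord `|(t + K%:Z)%R|%N) z) => //.
apply/matrixP => i j; rewrite !mxE (ord1 j).
have := zK i; rewrite ler_norml => /andP[Kz zK'].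
have zK0 : 0 <= z i 0 + K%:Z by rewrite -lerBlDr sub0r.
rewrite inordK; first by rewrite gez0_abs// addrK.
by rewrite ltnS -lez_nat gez0_abs// PoszD lerD2r.
Qed.

Lemma finite_approximations m n (A : 'M[R]_(m, n)) (b T : R) :
  finite_set (approximations A b T).
Proof.
pose Q := [set q : 'cV[int]_n | enorm (0 - int_cV q) <= T].
pose P (q : 'cV[int]_n) := [set p : 'cV[int]_m |
  enorm (A *m int_cV q - int_cV p) <=
  b * enorm (int_cV q) `^ (- (n%:R / m%:R))].
apply: (@sub_finite_set _ _ (\bigcup_(q in Q) (P q `*` [set q]))).
  move=> [p q] /= [Apq /andP[_ qT]]; exists q => //.
  rewrite /Q /= sub0r (_ : enorm _ = enorm (int_cV q)) ?ltW//.
  by congr Num.sqrt; apply: eq_bigr => i _; rewrite mxE sqrrN.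
apply: bigcup_finite; first exact: finite_int_cV_ball.
by move=> q _; apply: finite_setX => //; exact: finite_int_cV_ball.
Qed.

End counting.

(* Main.v *)
Require Import Defs.
From HB Require Import structures.
From mathcomp Require Import all_boot all_order all_algebra finmap.
From mathcomp Require Import ring lra zify.
From mathcomp Require Import all_classical all_reals all_analysis measurable_realfun.

Import Order.TTheory GRing.Theory Num.Theory.
Import numFieldNormedType.Exports.

Local Open Scope classical_set_scope.
Local Open Scope ring_scope.

(* Second moment method.  With r_q = b |q|^(-n/m), the function
   A |-> #{p : |Aq - p| <= r_q} is periodic under integral translations and has
   mean b^m B_m |q|^-n over the unit cube; summing over 1 <= |q| < T gives
   M(T) ~ b^m B_m C_n log T.  The counts attached to q and q' are uncorrelated
   unless q and q' are parallel: a translation A -> A + S with Sq = 0 shifts Aq'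
   arbitrarily.  For parallel q = a w, q' = a' w with a, a' coprime, a pair
   (p, p') contributes through v = a p' - a' p.  The terms with v <> 0 amount to
   counting nonzero lattice points in a ball of radius about a' r_q, which
   exceeds the product of the means by little.  The terms with v = 0 are
   multiples of one approximation; for m = n = 1 they make the variance of order
   (log T)^2, so only pairs (p, q) without common divisor larger than D are kept,
   the others having mean O(M(T) / D).  Along T = 2^(j^4), with D = j^2, the
   normalized second moment and the discarded mass are O(j^-2), hence summable,
   and monotonicity in T fills the gaps between consecutive values of T. *)

Set Implicit Arguments.
Unset Strict Implicit.
Unset Printing Implicit Defensive.

(** * Lebesgue measure on matrices *)

(** Parallel pairs [q = a w], [q' = a' w] need a second cutoff, on the norm of [w]. The excess over
    the product of the means, summed over [a], [a'] and all [w], is only bounded by a multiple of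
    [S K * ln K], which has the order of the squared mean. So the exact excess is used for
    [nrm w < W] alone, with total [S W * ln K]. For [nrm w >= W] the transverse term is bounded by a
    constant times the product of the means; that product carries [nrm w ^- n] twice, and one copy
    is traded for [W^-1], with total [S K * (ln K) ^ 2 / W]. With [W = j^6], [D = j^2] and [ln K] of
    order [j^4], the errors [S K * D], [S W * ln K] and [S K * (ln K) ^ 2 / W] are at most of order
    [j^6], against [j^8] for the squared mean. The exponent 4 makes this ratio summable, while the
    logarithms of consecutive scales still have ratio tending to 1. Integrals are taken over the
    unit cube, and periodicity carries the exceptional null set to the whole space. Sums over
    lattice points take values in [\bar R], so that they can be exchanged with integrals before any
    finiteness is known. *)

Section affine.
Variable R : realType.
Local Notation RR := (measurableTypeR R).
Local Notation leb := (@lebesgue_measure R).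

Lemma measurable_affine (c s : R) :
  measurable_fun [set: RR] ((fun x => c * x + s) : RR -> RR).
Proof.
by apply: measurable_funD => //; exact: measurable_funM.
Qed.

(** The pushforward scaled by [c] agrees with Lebesgue measure on half-open intervals, hence
    everywhere by uniqueness. *)
Lemma lebesgue_measure_affine (c s : R) (X : set RR) : 0 < c -> measurable X ->
  leb ((fun x => c * x + s) @^-1` X) = (c^-1%:E * leb X)%E.
Proof.
move=> c0 mX.
have c0' : 0 <= c by exact: ltW.
have mf := @measurable_affine c s.
pose pf : {measure set RR -> \bar R} :=
  measure_function_pushforward__canonical__measure_function_Measure leb mf.
pose nu : {measure set RR -> \bar R} := mscale (NngNum c0') pf.
have E : leb X = nu X.
  apply: lebesgue_measure_unique => // _ [[a b]] _ <- /=.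
  rewrite /nu /mscale /= /pushforward /=.
  rewrite (_ : _ @^-1` _ = `](a - s) / c, (b - s) / c]%classic); last first.
    apply/seteqP; split => x /=; rewrite !in_itv /= ltr_pdivrMr // ler_pdivlMr //;
    by rewrite ltrBlDr lerBrDr [c * x]mulrC.
  rewrite !lebesgue_measure_itv /= !lte_fin ltr_pM2r ?invr_gt0// ltrD2r.
  case: ifPn => ab; last by rewrite mule0.
  rewrite -EFinB -EFinB -EFinM; congr EFin.
  field; lra.
rewrite E /nu /mscale /= /pushforward muleA -EFinM mulVf ?mul1e//; lra.
Qed.

Lemma ge0_integral_affine (c s : R) (f : RR -> \bar R) : 0 < c ->
  measurable_fun setT f -> (forall x, 0 <= f x)%E ->
  (\int[leb]_x f (c * x + s)%R = c^-1%:E * \int[leb]_x f x)%E.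
Proof.
move=> c0 mf f0.
have c0' : 0 <= c^-1 by rewrite invr_ge0 ltW.
have m1 := @measurable_affine c s.
have := ge0_integral_pushforward m1 leb measurableT mf (fun y _ => f0 y).
rewrite preimage_setT => <-.
have -> : (c^-1)%:E = ((NngNum c0')%:num)%:E :> \bar R by [].
rewrite -ge0_integral_mscale //.
apply: eq_measure_integral => A mA _.
by rewrite /mscale /= /pushforward lebesgue_measure_affine.
Qed.

Definition affine_tuple k (c : R) (s : k.-tuple RR) (t : k.-tuple RR) : k.-tuple RR :=
  [tuple c * tnth t i + tnth s i | i < k].

(** Induction on [k], peeling off the first coordinate: the section at [x] of the preimage is the
    preimage, under the affine map of the remaining coordinates, of the section at [c * x + s0]. *)
Lemma lebesgue_tuple_affine k (c : R) (s : k.-tuple RR) (X : set (k.-tuple RR)) :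
  0 < c -> measurable X ->
  lebesgue_tuple R k (affine_tuple c s @^-1` X) =
    ((c ^- k)%:E * lebesgue_tuple R k X)%E.
Proof.
move=> c0; elim: k s X => [|k IH] s X mX.
  rewrite /= !diracE expr0 invr1 mul1e; congr ((_ : bool)%:R%:E).
  rewrite (_ : _ @^-1` _ = X)//; apply/seteqP; split => t /=;
  by rewrite (tuple0 t) (tuple0 (affine_tuple _ _ _)).
pose s0 := thead s; pose s1 : k.-tuple RR := [tuple of behead s].
have Es : s = [tuple of s0 :: s1] by exact: tuple_eta.
have mX' : measurable (@tuple_of_prod R k @^-1` X).
  by rewrite -[X in measurable X]setTI; exact: measurable_tuple_of_prod.
pose phi x := lebesgue_tuple R k (xsection (@tuple_of_prod R k @^-1` X) x).
have mphi : measurable_fun setT phi by exact: measurable_fun_xsection.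
(* The recursive definition and the product measure both unfold to this integral of the measures of
   sections. *)
have -> : lebesgue_tuple R k.+1 X = (\int[leb]_x phi x)%E by [].
have -> : lebesgue_tuple R k.+1 (affine_tuple c s @^-1` X) =
   (\int[leb]_x ((c ^- k)%:E * phi (c * x + s0)%R))%E.
  apply: eq_integral => x _ /=.
  rewrite /phi -(IH s1); last exact: measurable_xsection.
  congr (lebesgue_tuple R k _); rewrite /xsection; apply/seteqP; split => t /=;
   rewrite !inE /= (_ : affine_tuple c s (tuple_of_prod (x, t)) =
      tuple_of_prod (c * x + s0, affine_tuple c s1 t)) //;
  (apply: eq_from_tnth => i; rewrite tnth_mktuple; case: (unliftP ord0 i) => [j|] ->;
   [by rewrite Es !tnthS tnth_mktuple | by rewrite Es !tnth0]).
rewrite ge0_integralZl //; last 2 first.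
- apply: measurableT_comp => //; exact: measurable_affine.
- by rewrite lee_fin invr_ge0 exprn_ge0 // ltW.
rewrite ge0_integral_affine // muleA -EFinM; congr (_ * _)%E.
by rewrite exprS invfM mulrC.
Qed.

End affine.

Section matrices.
Variable R : realType.
Local Notation RR := (measurableTypeR R).

Lemma measurable_mx_entry d (T : measurableType d) m n (i : 'I_m) (j : 'I_n) :
  measurable_fun setT (fun A : 'M[T]_(m, n) => A i j).
Proof.
move=> _ B mB; rewrite setTI; apply: sub_sigma_algebra.
by exists (i, j), B.
Qed.

Lemma measurable_fun_mx d0 (T0 : measurableType d0) d (T : measurableType d) m n
    (f : T0 -> 'M[T]_(m, n)) :
  (forall i j, measurable_fun setT (fun x => f x i j)) -> measurable_fun setT f.
Proof.
move=> mf; apply: (@measurability _ _ _ _ _ _ (mx_entry_cylinders (T := T))) => //.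
move=> _ [_ [[i j] [B mB ->]] <-]; exact: mf.
Qed.

Lemma lebesgue_mx_affine m n (c : R) (S : 'M[RR]_(m, n)) (X : set 'M[RR]_(m, n)) :
  0 < c -> measurable X ->
  lebesgue_mx R m n ((fun A => c *: A + S) @^-1` X) =
    ((c ^- (m * n))%:E * lebesgue_mx R m n X)%E.
Proof.
move=> c0 mX; rewrite /= /pushforward_iso /pushforward.
rewrite -(@lebesgue_tuple_affine _ _ _ (tuple_of_mx S)) //.
  congr (lebesgue_tuple _ _ _); apply/seteqP; split => t /=;
  rewrite (_ : mx_of_tuple (affine_tuple c (tuple_of_mx S) t) = c *: mx_of_tuple t + S) //;
  by apply/matrixP => i j; rewrite !mxE !tnth_mktuple mxvecE.
rewrite -[X in measurable X]setTI; exact: measurable_mx_of_tuple.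
Qed.

Lemma measurable_mx_affine m n (c : R) (S : 'M[RR]_(m, n)) :
  measurable_fun setT ((fun A => c *: A + S) : 'M[RR]_(m, n) -> 'M[RR]_(m, n)).
Proof.
apply: measurable_fun_mx => i j.
rewrite (_ : (fun _ => _) = (fun A : 'M[RR]_(m, n) => c * A i j + S i j)); last first.
  by apply/funext => A; rewrite !mxE.
by apply: measurable_funD => //; apply: measurable_funM => //; exact: measurable_mx_entry.
Qed.

Lemma ge0_integral_mx_affine m n (c : R) (S : 'M[RR]_(m, n)) (f : 'M[RR]_(m, n) -> \bar R) :
  0 < c -> measurable_fun setT f -> (forall x, 0 <= f x)%E ->
  (\int[lebesgue_mx R m n]_A f (c *: A + S)%R =
    (c ^- (m * n))%:E * \int[lebesgue_mx R m n]_A f A)%E.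
Proof.
move=> c0 mf f0.
have c0' : 0 <= c ^- (m * n) by rewrite invr_ge0 exprn_ge0 // ltW.
have m1 := @measurable_mx_affine m n c S.
have := ge0_integral_pushforward m1 (lebesgue_mx R m n) measurableT mf (fun y _ => f0 y).
rewrite preimage_setT => <-.
have -> : (c ^- (m * n))%:E = ((NngNum c0')%:num)%:E :> \bar R by [].
rewrite -ge0_integral_mscale //.
apply: eq_measure_integral => A mA _.
exact: (lebesgue_mx_affine S c0 mA).
Qed.

(** Half-open, so that the integral translates partition the space. *)
Definition unit_cube m n : set 'M[RR]_(m, n) :=
  [set A | forall i j, 0 <= A i j < 1].

Lemma measurable_unit_cube m n : measurable (@unit_cube m n).
Proof.
rewrite (_ : @unit_cube m n = \bigcap_(ij in [set: 'I_m * 'I_n])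
   ((fun A : 'M[RR]_(m, n) => A ij.1 ij.2) @^-1` `[0, 1[%classic)).
  apply: fin_bigcap_measurable => // -[i j] _.
  by rewrite -[X in measurable X]setTI; exact: measurable_mx_entry.
apply/seteqP; split => A /=.
  by move=> h [i j] _ /=; rewrite in_itv /= h.
by move=> h i j; have := h (i, j) Logic.I; rewrite /= in_itv.
Qed.

Lemma lebesgue_tuple_cube k :
  lebesgue_tuple R k [set t | forall i, 0 <= tnth t i < 1] = 1%E.
Proof.
elim: k => [|k IH].
  by rewrite /= diracE mem_set //= => -[].
rewrite /= /pushforward_iso /pushforward /=.
rewrite (_ : _ @^-1` _ = `[0, 1[%classic `*` [set t | forall i, 0 <= tnth t i < 1]).
  rewrite /sigma_finite_prod product_measure1E //; last first.
    rewrite (_ : mkset _ = \bigcap_(i in [set: 'I_k])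
      ((fun t : k.-tuple RR => tnth t i) @^-1` `[0, 1[%classic)).
      apply: fin_bigcap_measurable => // i _.
      by rewrite -[X in measurable X]setTI; exact: measurable_tnth.
    apply/seteqP; split => A /=.
      by move=> h i _ /=; rewrite in_itv /= h.
    by move=> h i; have := h i Logic.I; rewrite /= in_itv.
  rewrite IH /= lebesgue_measure_itv /= lte_fin ltr01 -EFinB subr0.
  by rewrite mul1e.
apply/seteqP; split => -[x t] /=.
  move=> h; split; first by have := h ord0; rewrite tnth0 in_itv.
  by move=> i; have := h (lift ord0 i); rewrite tnthS.
move=> [h0 h1] i; case: (unliftP ord0 i) => [j|] ->; first by rewrite tnthS h1.
by rewrite tnth0; rewrite in_itv in h0.
Qed.

Lemma lebesgue_mx_unit_cube m n : lebesgue_mx R m n (@unit_cube m n) = 1%E.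
Proof.
rewrite -(lebesgue_tuple_cube (m * n)) /= /pushforward_iso /pushforward.
congr (lebesgue_tuple _ _ _); apply/seteqP; split => t /=.
  by move=> h k; case/mxvec_indexP: k => i j; have := h i j; rewrite mxE.
by move=> h i j; rewrite mxE.
Qed.

End matrices.

(** * Periodic functions and equidistribution *)

Section esum.
Variable R : realType.

Lemma esum_only (J : choiceType) (j0 : J) (a : J -> \bar R) :
  (0 <= a j0)%E -> (forall j, j != j0 -> a j = 0%E) ->
  \esum_(j in [set: J]) a j = a j0.
Proof.
move=> a0 az; rewrite -(esum_set1 a0) [RHS]esum_mkcond.
apply: eq_esum => j _; case: ifPn; first by rewrite inE.
by move=> /negP; rewrite inE => /eqP; exact: az.
Qed.

Lemma reindex_esumT (J K : choiceType) (e : J -> K) (e' : K -> J) (a : K -> \bar R) :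
  cancel e e' -> cancel e' e ->
  \esum_(k in [set: K]) a k = \esum_(j in [set: J]) a (e j).
Proof.
move=> eK e'K; apply: reindex_esum; split => //.
- by move=> x y _ _ /(can_inj eK).
- by move=> y _; exists (e' y).
Qed.

(** Indices that code no element contribute 0. This transfers measurability and term-by-term
    integration from series to unordered sums. *)
Lemma esum_nneseries (J : countType) (a : J -> \bar R) : (forall j, 0 <= a j)%E ->
  (\esum_(j in [set: J]) a j = \sum_(i <oo) oapp a 0 (@pickle_inv J i))%E.
Proof.
move=> a0; rewrite nneseries_esumT; last by move=> i; case: pickle_inv.
transitivity (\esum_(i in range (@choice.pickle J)) oapp a 0%E (@pickle_inv J i)).
  rewrite esum_image; last by move=> x y _ _; exact: (pcan_inj choice.pickleK).
  by apply: eq_esum => j _; rewrite pickleK_inv.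
rewrite esum_mkcond; apply: eq_esum => i _; case: ifPn => //.
move=> /negP; rewrite inE => iJ; case E : pickle_inv => [j|] //=.
by case: iJ; exists j => //; have := @pickle_invK J i; rewrite /ocancel E.
Qed.

Section integral.
Context d (T : measurableType d) (mu : {measure set T -> \bar R}).
Variables (J : countType) (f : J -> T -> \bar R).
Hypothesis mf : forall j, measurable_fun setT (f j).
Hypothesis f0 : forall j x, (0 <= f j x)%E.

Lemma measurable_esum : measurable_fun setT (fun x => \esum_(j in [set: J]) f j x).
Proof.
under eq_fun do rewrite esum_nneseries//.
apply: ge0_emeasurable_sum => //.
- by move=> i x _ _; case: pickle_inv => //=.
- by move=> i _; case: pickle_inv => //=.
Qed.

Lemma ge0_integral_esum (D : set T) : measurable D ->
  (\int[mu]_(x in D) (\esum_(j in [set: J]) f j x) =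
   \esum_(j in [set: J]) \int[mu]_(x in D) f j x)%E.
Proof.
move=> mD; under eq_integral do rewrite esum_nneseries//.
rewrite integral_nneseries //; last 2 first.
- by move=> i; case: pickle_inv => //= j; exact: measurable_funTS.
- by move=> i x _; case: pickle_inv => //=.
rewrite esum_nneseries; last by move=> j; exact: integral_ge0.
apply: eq_eseriesr => i _; case: pickle_inv => //=.
by rewrite integral0.
Qed.

End integral.
End esum.

Section periodic.
Variable R : realType.
Local Notation RR := (measurableTypeR R).
Local Notation mu m n := (lebesgue_mx R m n).
Local Notation C m n := (@unit_cube R m n).

(** Exactly one integral translate of the cube contains [x], the one given by the entrywise
    floor. *)
Lemma sum_unit_cube m n (x : 'M[RR]_(m, n)) (c : \bar R) : (0 <= c)%E ->
  \esum_(z in [set: 'M[int]_(m, n)]) (c * (\1_(C m n) (x - map_mx intr z))%:E)%E = c.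
Proof.
move=> c0; pose z0 : 'M[int]_(m, n) := map_mx (@Num.floor R) x.
have z0C : (C m n) (x - map_mx intr z0).
  move=> i j; rewrite !mxE subr_ge0 ltrBlDr addrC; have := floor_itv (x i j).
  by rewrite intrD addrC.
rewrite (esum_only (j0 := z0)) ?indicE ?mem_set ?mule1 //= => z /negP zz0.
rewrite indicE memNset ?mule0 // => zC; apply: zz0; apply/eqP/matrixP => i j.
have := zC i j; rewrite !mxE subr_ge0 ltrBlDr => /andP[h1 h2].
by apply/esym/floor_def; rewrite h1 /= intrD addrC.
Qed.

Lemma measurable_mx_shift m n (S : 'M[RR]_(m, n)) :
  measurable_fun setT ((fun A => A + S) : 'M[RR]_(m, n) -> 'M[RR]_(m, n)).
Proof.
rewrite (_ : (fun _ => _) = (fun A => 1 *: A + S)); first exact: measurable_mx_affine.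
by apply/funext => A; rewrite scale1r.
Qed.

Lemma ge0_integral_mx_shift m n (S : 'M[RR]_(m, n)) (f : 'M[RR]_(m, n) -> \bar R) :
  measurable_fun setT f -> (forall x, 0 <= f x)%E ->
  (\int[mu m n]_A f (A + S)%R = \int[mu m n]_A f A)%E.
Proof.
move=> mf f0; have := ge0_integral_mx_affine S (@ltr01 R) mf f0.
rewrite expr1n invr1 mul1e => <-; apply: eq_integral => A _.
by rewrite scale1r.
Qed.

Lemma integral_cubeE m n (f : 'M[RR]_(m, n) -> \bar R) :
  (\int[mu m n]_(A in C m n) f A = \int[mu m n]_A (f A * (\1_(C m n) A)%:E))%E.
Proof. by rewrite integral_mkcond epatch_indic. Qed.

Lemma measurable_indic_cube m n :
  measurable_fun setT (fun A : 'M[RR]_(m, n) => (\1_(C m n) A)%:E : \bar R).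
Proof.
apply/measurable_EFinP; apply: measurable_indic; exact: measurable_unit_cube.
Qed.

(** Translating each term by [z] moves the shift from [g] to the indicator of the cube, and the
    shifted indicators sum to 1. *)
Lemma integral_unfold m n (g : 'M[RR]_(m, n) -> \bar R) :
  measurable_fun setT g -> (forall x, 0 <= g x)%E ->
  (\int[mu m n]_(A in C m n) (\esum_(z in [set: 'M[int]_(m, n)]) g (A + map_mx intr z)%R) =
   \int[mu m n]_A g A)%E.
Proof.
move=> mg g0.
have mgz (z : 'M[int]_(m, n)) : measurable_fun setT (fun A : 'M[RR]_(m, n) => g (A + map_mx intr z)).
  exact: (measurableT_comp mg (measurable_mx_shift _)).
rewrite ge0_integral_esum //; last exact: measurable_unit_cube.
have h0 (z : 'M[int]_(m, n)) (A : 'M[RR]_(m, n)) :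
  (0 <= (\1_(C m n) (A - map_mx intr z))%:E :> \bar R)%E by rewrite lee_fin.
have mh (z : 'M[int]_(m, n)) : measurable_fun setT
    (fun A : 'M[RR]_(m, n) => (\1_(C m n) (A - map_mx intr z))%:E : \bar R).
  exact: (measurableT_comp (@measurable_indic_cube m n) (measurable_mx_shift _)).
transitivity (\esum_(z in [set: 'M[int]_(m, n)])
    (\int[mu m n]_A (g A * (\1_(C m n) (A - map_mx intr z))%:E))%E).
  apply: eq_esum => z _; rewrite integral_cubeE.
  rewrite -(ge0_integral_mx_shift (map_mx intr z)
     (f := fun A => (g A * (\1_(C m n) (A - map_mx intr z))%:E)%E)) //.
  - by apply: eq_integral => A _; rewrite addrK.
  - exact: emeasurable_funM.
  - by move=> A; exact: mule_ge0.
rewrite -ge0_integral_esum //; last 2 first.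
- by move=> z; exact: emeasurable_funM.
- by move=> z A; exact: mule_ge0.
apply: eq_integral => A _.
exact: sum_unit_cube.
Qed.

Definition mx_periodic m n (f : 'M[RR]_(m, n) -> \bar R) :=
  forall A (z : 'M[int]_(m, n)), f (A + map_mx intr z) = f A.

(** A translate of the cube is again a fundamental domain: after unfolding, [f] factors out by
    periodicity and the shifted indicators sum to 1. *)
Lemma integral_cube_shift m n (S : 'M[RR]_(m, n)) (f : 'M[RR]_(m, n) -> \bar R) :
  measurable_fun setT f -> (forall x, 0 <= f x)%E -> mx_periodic f ->
  (\int[mu m n]_(A in C m n) f (A + S)%R = \int[mu m n]_(A in C m n) f A)%E.
Proof.
move=> mf f0 pf.
have mh : measurable_fun setT
    (fun A : 'M[RR]_(m, n) => (\1_(C m n) (A - S))%:E : \bar R).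
  exact: (measurableT_comp (@measurable_indic_cube m n) (measurable_mx_shift _)).
have h0 (A : 'M[RR]_(m, n)) : (0 <= (\1_(C m n) A)%:E :> \bar R)%E by rewrite lee_fin.
transitivity (\int[mu m n]_A (f A * (\1_(C m n) (A - S))%:E))%E.
  rewrite integral_cubeE -(ge0_integral_mx_shift S
     (f := fun A => (f A * (\1_(C m n) (A - S))%:E)%E)) //.
  - by apply: eq_integral => A _; rewrite addrK.
  - exact: emeasurable_funM.
  - by move=> A; exact: mule_ge0.
rewrite -integral_unfold; last 2 first.
- exact: emeasurable_funM.
- by move=> A; exact: mule_ge0.
apply: eq_integral => A _.
rewrite -[RHS](sum_unit_cube (A - S)) //.
rewrite (reindex_esumT (e := -%R) (e' := -%R)); [|exact: opprK|exact: opprK].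
apply: eq_esum => z _; congr (_ * (\1_(C m n) _)%:E)%E; first by rewrite pf.
by rewrite raddfN /= addrAC.
Qed.

Lemma tonelli_cube m n k l (H : 'M[RR]_(m, n) * 'M[RR]_(k, l) -> \bar R) :
  measurable_fun setT H -> (forall x, 0 <= H x)%E ->
  (\int[mu m n]_(A in C m n) \int[mu k l]_(B in C k l) H (A, B) =
   \int[mu k l]_(B in C k l) \int[mu m n]_(A in C m n) H (A, B))%E.
Proof.
move=> mH H0.
have h0 a b (A : 'M[RR]_(a, b)) : (0 <= (\1_(C a b) A)%:E :> \bar R)%E by rewrite lee_fin.
pose H' (x : 'M[RR]_(m, n) * 'M[RR]_(k, l)) : \bar R :=
  (H x * ((\1_(C m n) x.1)%:E * (\1_(C k l) x.2)%:E))%E.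
have mH' : measurable_fun setT H'.
  apply: emeasurable_funM => //; apply: emeasurable_funM.
  - exact: (measurableT_comp (@measurable_indic_cube m n) measurable_fst).
  - exact: (measurableT_comp (@measurable_indic_cube k l) measurable_snd).
have := @fubini_tonelli _ _ _ _ _ (mu m n) (mu k l) H' mH'.
have H'0 x : (0 <= H' x)%E by rewrite !mule_ge0.
move=> /(_ H'0) E.
rewrite !integral_cubeE; transitivity (\int[mu m n]_A \int[mu k l]_B H' (A, B))%E.
  apply: eq_integral => A _; rewrite integral_cubeE -ge0_integralZr//; last 2 first.
  - apply: emeasurable_funM; last exact: measurable_indic_cube.
    exact: (measurableT_comp mH (pair1_measurable A)).
  - by move=> B _; exact: mule_ge0.
  by apply: eq_integral => B _; rewrite /H' /= -muleA [((\1_(C k l) B)%:E * _)%E]muleC.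
rewrite E; apply/esym; apply: eq_integral => B _; rewrite integral_cubeE -ge0_integralZr//; last 2 first.
- apply: emeasurable_funM; last exact: measurable_indic_cube.
  exact: (measurableT_comp mH (pair2_measurable B)).
- by move=> A _; exact: mule_ge0.
by apply: eq_integral => A _; rewrite /H' /= -muleA.
Qed.

Lemma integral_cube_cst m n (c : \bar R) : (\int[mu m n]_(A in C m n) c = c)%E.
Proof.
rewrite integral_cst; last exact: measurable_unit_cube.
by rewrite [X in (_ * X)%E](lebesgue_mx_unit_cube R m n) mule1.
Qed.

Lemma measurable_mulmx_cst m n (v : 'cV[R]_n) :
  measurable_fun setT ((fun A => A *m v) : 'M[RR]_(m, n) -> 'cV[RR]_m).
Proof.
apply: measurable_fun_mx => i j.
rewrite (_ : (fun _ => _) = (fun A : 'M[RR]_(m, n) => \sum_(k < n) (A i k : R) * v k j)); last first.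
  by apply/funext => A; rewrite !mxE.
apply: measurable_sum => k; apply: measurable_funM => //; exact: measurable_mx_entry.
Qed.

Lemma measurable_mx_add d (T : measurableType d) m n (f g : T -> 'M[RR]_(m, n)) :
  measurable_fun setT f -> measurable_fun setT g ->
  measurable_fun setT ((fun x => f x + g x) : T -> 'M[RR]_(m, n)).
Proof.
move=> mf mg; apply: measurable_fun_mx => i j.
rewrite (_ : (fun _ => _) = (fun x => (f x i j : R) + g x i j)); last first.
  by apply/funext => x; rewrite !mxE.
apply: measurable_funD.
- exact: (measurableT_comp (measurable_mx_entry i j) mf).
- exact: (measurableT_comp (measurable_mx_entry i j) mg).
Qed.

Lemma periodic_mulmx m n (F : 'cV[RR]_m -> \bar R) (q : 'cV[int]_n) :
  mx_periodic F -> mx_periodic (fun A : 'M[RR]_(m, n) => F (A *m int_cV R q)).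
Proof.
by move=> pF A z; rewrite mulmxDl /int_cV -map_mxM pF.
Qed.

(* Average over translations by t of the second argument. *)
Lemma equidistribution m n (F G : 'cV[RR]_m -> \bar R) (q q' : 'cV[int]_n) :
  measurable_fun setT F -> measurable_fun setT G ->
  (forall x, 0 <= F x)%E -> (forall x, 0 <= G x)%E ->
  mx_periodic F -> mx_periodic G ->
  (forall t : 'cV[R]_m, exists S : 'M[R]_(m, n),
     S *m int_cV R q = 0 /\ S *m int_cV R q' = t) ->
  (\int[mu m n]_(A in C m n) (F (A *m int_cV R q)%R * G (A *m int_cV R q')%R) =
   (\int[mu m n]_(A in C m n) F (A *m int_cV R q)%R) * \int[mu m 1]_(x in C m 1) G x)%E.
Proof.
move=> mF mG F0 G0 pF pG surj.
have mFq := measurableT_comp mF (@measurable_mulmx_cst m n (int_cV R q)).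
have mGq := measurableT_comp mG (@measurable_mulmx_cst m n (int_cV R q')).
have step (t : 'cV[RR]_m) :
  (\int[mu m n]_(A in C m n) (F (A *m int_cV R q)%R * G (A *m int_cV R q')%R) =
   \int[mu m n]_(A in C m n) (F (A *m int_cV R q)%R * G (A *m int_cV R q' + t)%R))%E.
  have [S [S0 S1]] := surj t.
  rewrite -(integral_cube_shift S (f := fun A => (F (A *m int_cV R q)%R * G (A *m int_cV R q')%R)%E)).
  - by apply: eq_integral => A _; rewrite !mulmxDl S0 S1 addr0.
  - exact: (emeasurable_funM mFq mGq).
  - by move=> A; exact: mule_ge0.
  - move=> A z; have := periodic_mulmx q pF A z; have := periodic_mulmx q' pG A z.
    by rewrite /= => -> ->.
rewrite -(integral_cube_cst m 1 (\int[mu m n]_(A in C m n) (F (A *m int_cV R q)%R * G (A *m int_cV R q')%R))%E).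
under eq_integral => t _ do rewrite (step t).
pose H (x : 'cV[RR]_m * 'M[RR]_(m, n)) : \bar R :=
  (F (x.2 *m int_cV R q)%R * G (x.2 *m int_cV R q' + x.1)%R)%E.
have mH : measurable_fun setT H.
  apply: emeasurable_funM; first exact: (measurableT_comp mFq measurable_snd).
  apply: (measurableT_comp mG); apply: measurable_mx_add; last exact: measurable_fst.
  exact: (measurableT_comp (@measurable_mulmx_cst m n (int_cV R q')) measurable_snd).
have H0 x : (0 <= H x)%E by exact: mule_ge0.
rewrite (tonelli_cube mH H0) -ge0_integralZr //; last 3 first.
- exact: measurable_unit_cube.
- exact: measurable_funTS.
- exact: integral_ge0.
apply: eq_integral => A _; rewrite /H /= ge0_integralZl //; last 2 first.
- exact: measurable_unit_cube.
- apply: measurable_funTS; apply: (measurableT_comp mG); exact: measurable_mx_add.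
congr (_ * _)%E; rewrite -(integral_cube_shift (A *m int_cV R q') mG G0 pG).
by apply: eq_integral => x _; rewrite addrC.
Qed.

End periodic.

(** * Euclidean balls and spheres *)

Section enorm.
Variable R : realType.
Local Notation RR := (measurableTypeR R).

Lemma enorm_ge0 k (x : 'cV[R]_k) : 0 <= enorm x.
Proof. exact: sqrtr_ge0. Qed.

Lemma sqr_enorm k (x : 'cV[R]_k) : enorm x ^+ 2 = \sum_i x i 0 ^+ 2.
Proof. by rewrite sqr_sqrtr // sumr_ge0 // => i _; exact: sqr_ge0. Qed.

Lemma enormZ k c (x : 'cV[R]_k) : enorm (c *: x) = `|c| * enorm x.
Proof.
rewrite -sqrtr_sqr -sqrtrM ?sqr_ge0 //; congr Num.sqrt.
by rewrite mulr_sumr; apply: eq_bigr => i _; rewrite mxE exprMn.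
Qed.

Lemma enormN k (x : 'cV[R]_k) : enorm (- x) = enorm x.
Proof. by rewrite -scaleN1r enormZ normrN1 mul1r. Qed.

Lemma enorm0 k : enorm (0 : 'cV[R]_k) = 0.
Proof. by rewrite -(scale0r 0) enormZ normr0 mul0r. Qed.

(** Lagrange's identity: twice the defect is the sum of the squares of all 2 by 2 minors of
    [(x, y)]. *)
Lemma cauchy_schwarz_cV k (x y : 'cV[R]_k) :
  \sum_i x i 0 * y i 0 <= enorm x * enorm y.
Proof.
have [xy0|xy0] := ltP (\sum_i x i 0 * y i 0) 0.
  by rewrite (le_trans (ltW xy0)) // mulr_ge0 // enorm_ge0.
rewrite -(@ler_pXn2r _ 2) ?nnegrE ?mulr_ge0 ?enorm_ge0 //.
rewrite exprMn !sqr_enorm -subr_ge0.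
rewrite -(@pmulr_rge0 _ 2) //.
have -> : 2 * ((\sum_i x i 0 ^+ 2) * (\sum_i y i 0 ^+ 2) - (\sum_i x i 0 * y i 0) ^+ 2) =
   \sum_i \sum_j (x i 0 * y j 0 - x j 0 * y i 0) ^+ 2.
  transitivity (\sum_i \sum_j (x i 0 ^+ 2 * y j 0 ^+ 2) + \sum_i \sum_j (x j 0 ^+ 2 * y i 0 ^+ 2)
     - 2 * \sum_i \sum_j ((x i 0 * y i 0) * (x j 0 * y j 0))).
    have -> : \sum_i \sum_j x j 0 ^+ 2 * y i 0 ^+ 2 = \sum_i \sum_j (x i 0 ^+ 2 * y j 0 ^+ 2).
      by rewrite exchange_big.
    by rewrite expr2 !big_distrlr /=; ring.
  rewrite mulr_sumr -big_split -sumrB; apply: eq_bigr => i _ /=.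
  rewrite mulr_sumr -big_split -sumrB; apply: eq_bigr => j _ /=; ring.
by apply: sumr_ge0 => i _; apply: sumr_ge0 => j _; exact: sqr_ge0.
Qed.

Lemma enorm_triangle k (x y : 'cV[R]_k) : enorm (x + y) <= enorm x + enorm y.
Proof.
rewrite -(@ler_pXn2r _ 2) ?nnegrE ?addr_ge0 ?enorm_ge0 //.
have := cauchy_schwarz_cV x y.
have -> : enorm (x + y) ^+ 2 = enorm x ^+ 2 + enorm y ^+ 2 + 2 * \sum_i x i 0 * y i 0.
  rewrite !sqr_enorm mulr_sumr -!big_split; apply: eq_bigr => i _ /=.
  by rewrite !mxE; ring.
nra.
Qed.

Lemma enorm_bound k (c : R) (x : 'cV[R]_k) : (forall i, `|x i 0| <= c) ->
  enorm x <= k%:R * c.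
Proof.
case: k x => [|k] x xc.
  by rewrite mul0r /enorm big_ord0 sqrtr0.
have c0 : 0 <= c by exact: le_trans (xc ord0).
rewrite -(@ler_pXn2r _ 2) ?nnegrE ?mulr_ge0 ?enorm_ge0 // sqr_enorm.
apply: (@le_trans _ _ (\sum_(i < k.+1) c ^+ 2)).
  by apply: ler_sum => i _; rewrite -real_normK ?num_real // lerXn2r ?nnegrE.
rewrite sumr_const card_ord exprMn -[leLHS]mulr_natl ler_wpM2r ?sqr_ge0 //.
by rewrite ler_eXnr // ler1n.
Qed.

Lemma enorm_unit_cube k (x : 'cV[RR]_k) : @unit_cube R k 1 x -> enorm x <= k%:R.
Proof.
move=> xC; rewrite -[leRHS]mulr1; apply: enorm_bound => i.
by have /andP[x0 x1] := xC i 0; rewrite ger0_norm // ltW.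
Qed.

Lemma measurable_enorm k :
  measurable_fun setT (fun x : 'cV[RR]_k => enorm x : R).
Proof.
apply: (@measurableT_comp _ _ _ _ _ _ (@Num.sqrt R)).
  apply: continuous_measurable_fun; exact: sqrt_continuous.
apply: measurable_sum => i; apply: measurable_funX; exact: measurable_mx_entry.
Qed.

Definition eball k (r : R) : set 'cV[RR]_k := [set x | enorm x <= r].
Arguments eball k r : clear implicits.

Definition open_eball k (r : R) : set 'cV[RR]_k := [set x | enorm x < r].
Arguments open_eball : clear implicits.

Lemma measurable_eball k r : measurable (eball k r).
Proof.
rewrite (_ : eball k r = (fun x : 'cV[RR]_k => enorm x : R) @^-1` `]-oo, r]%classic).
  by rewrite -[X in measurable X]setTI; exact: measurable_enorm.
by apply/seteqP; split => x; rewrite /eball /= in_itv.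
Qed.

Lemma measurable_open_eball k (r : R) : measurable (open_eball k r).
Proof.
rewrite (_ : open_eball k r = (fun x : 'cV[RR]_k => enorm x : R) @^-1` `]-oo, r[%classic).
  by rewrite -[X in measurable X]setTI; exact: measurable_enorm.
by apply/seteqP; split => x; rewrite /open_eball /= in_itv.
Qed.

Lemma lebesgue_mx_scale k (c : R) (X : set 'cV[RR]_k) : 0 < c -> measurable X ->
  lebesgue_mx R k 1 ((fun x => c^-1 *: x) @^-1` X) = ((c ^+ k)%:E * lebesgue_mx R k 1 X)%E.
Proof.
move=> c0 mX; have c0' : 0 < c^-1 by rewrite invr_gt0.
have := lebesgue_mx_affine 0 c0' mX; rewrite muln1 exprVn invrK => <-.
by congr (lebesgue_mx _ _ _ _); apply/seteqP; split => x /=; rewrite addr0.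
Qed.

Lemma lebesgue_unit_ball_lty k : (lebesgue_mx R k 1 (eball k 1) < +oo)%E.
Proof.
(* The ball lies in the cube with sides [[-3/2, 3/2[], an affine preimage of the unit cube. *)
apply: (@le_lt_trans _ _ (lebesgue_mx R k 1
   ((fun x => 3^-1 *: x + const_mx 2^-1) @^-1` (@unit_cube R k 1)))).
  apply: le_measure; rewrite ?inE.
  - exact: measurable_eball.
  - rewrite -[X in measurable X]setTI; apply: measurable_mx_affine => //.
    exact: measurable_unit_cube.
  - move=> x /= x1 i j; rewrite ord1 !mxE.
    by have := le_trans (le_entry_enorm x i) x1; rewrite ler_norml => /andP[]; lra.
rewrite lebesgue_mx_affine //; last exact: measurable_unit_cube.
by rewrite lebesgue_mx_unit_cube mule1 ltry.
Qed.

Lemma lebesgue_unit_ballE k :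
  lebesgue_mx R k 1 (eball k 1) = (unit_ball_volume R k)%:E.
Proof.
rewrite /unit_ball_volume /volume fineK //.
by rewrite ge0_fin_numE ?measure_ge0 // lebesgue_unit_ball_lty.
Qed.

Lemma unit_ball_volume_gt0 k : 0 < unit_ball_volume R k.
Proof.
rewrite -lte_fin -lebesgue_unit_ballE.
have k0 : (0 : R) < k.+1%:R by rewrite ltr0n.
(* A cube of side [1 / (k + 1)] at the origin lies in the ball; [k + 1] instead of [k] covers
   dimension 0. *)
apply: (@lt_le_trans _ _ (lebesgue_mx R k 1
   ((fun x => (k.+1%:R^-1)^-1 *: x) @^-1` (@unit_cube R k 1)))).
  rewrite lebesgue_mx_scale ?invr_gt0 //; last exact: measurable_unit_cube.
  by rewrite lebesgue_mx_unit_cube mule1 lte_fin exprn_gt0 // invr_gt0.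
apply: le_measure; rewrite ?inE.
- rewrite (_ : (fun _ => _) = (fun x : 'cV[RR]_k => (k.+1%:R^-1)^-1 *: x + 0)).
    rewrite -[X in measurable X]setTI; apply: measurable_mx_affine => //.
    exact: measurable_unit_cube.
  by apply/funext => x; rewrite addr0.
- exact: measurable_eball.
move=> x /= xC; rewrite invrK in xC; apply: (@le_trans _ _ (k%:R * k.+1%:R^-1)).
  apply: enorm_bound => i; have := xC i 0; rewrite !mxE => /andP[x0 x1].
  have xi0 : 0 <= x i 0 by move: x0; rewrite pmulr_rge0.
  by rewrite ger0_norm // -[leRHS]mul1r ler_pdivlMr // mulrC ltW.
by rewrite ler_pdivrMr // mul1r ler_nat.
Qed.

Lemma lebesgue_eball k r : 0 < r ->
  lebesgue_mx R k 1 (eball k r) = (r ^+ k * unit_ball_volume R k)%:E.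
Proof.
move=> r0; rewrite EFinM -lebesgue_unit_ballE -lebesgue_mx_scale //; last first.
  exact: measurable_eball.
congr (lebesgue_mx _ _ _ _); apply/seteqP; split => x; rewrite /eball /= enormZ;
by rewrite gtr0_norm ?invr_gt0 // ler_pdivrMl // mulr1.
Qed.

Lemma bernoulli_ge k (d : R) : d <= 1 -> 1 - k%:R * d <= (1 - d) ^+ k.
Proof.
move=> d1; elim: k => [|k IH]; first by rewrite expr0 mul0r subr0.
have h1 := mulr_ge0 (ler0n R k) (sqr_ge0 d).
have h2 : (1 - d) * (1 - k%:R * d) <= (1 - d) * (1 - d) ^+ k.
  by rewrite ler_wpM2l // subr_ge0.
by rewrite exprS -natr1; apply: le_trans h2; rewrite -subr_ge0; apply: le_trans h1 _;
  rewrite le_eqVlt; apply/orP; left; apply/eqP; ring.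
Qed.

(** The open unit ball contains the closed balls of radius [1 - d], whose volumes tend to that of
    the closed unit ball by Bernoulli's inequality. *)
Lemma lebesgue_open_eball k r : 0 < r ->
  lebesgue_mx R k 1 (open_eball k r) = (r ^+ k * unit_ball_volume R k)%:E.
Proof.
move=> r0.
have -> : lebesgue_mx R k 1 (open_eball k r) =
   ((r ^+ k)%:E * lebesgue_mx R k 1 (open_eball k 1))%E.
  rewrite -lebesgue_mx_scale //; last exact: measurable_open_eball.
  congr (lebesgue_mx _ _ _ _); apply/seteqP; split => x; rewrite /open_eball /= enormZ;
  by rewrite gtr0_norm ?invr_gt0 // ltr_pdivrMl // mulr1.
rewrite EFinM; congr (_ * _)%E.
apply/eqP; rewrite eq_le; apply/andP; split.
  rewrite -lebesgue_unit_ballE; apply: le_measure; rewrite ?inE.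
  - exact: measurable_open_eball.
  - exact: measurable_eball.
  - by move=> x /= /ltW.
apply/lee_addgt0Pr => e e0.
pose V := unit_ball_volume R k; have V0 : 0 < V := unit_ball_volume_gt0 k.
have kV1 : 0 <= k%:R * V by rewrite mulr_ge0 // ltW.
have kV0 : 0 < k%:R * V + e + 1 by lra.
(* This denominator ensures both [d < 1] and [k * V * d <= e]. *)
pose d := e / (k%:R * V + e + 1).
have d0 : 0 < d by rewrite divr_gt0.
have d1 : d < 1 by rewrite ltr_pdivrMr // mul1r; lra.
have dE : k%:R * V * d <= e.
  rewrite /d mulrA ler_pdivrMr //; nra.
apply: (@le_trans _ _ (lebesgue_mx R k 1 (eball k (1 - d)) + e%:E)%E).
  rewrite lebesgue_eball ?subr_gt0 // -EFinD lee_fin -/V.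
  have := bernoulli_ge k (ltW d1).
  move=> h; have : (1 - k%:R * d) * V <= (1 - d) ^+ k * V by rewrite ler_wpM2r // ltW.
  nra.
rewrite leeD2r //; apply: le_measure; rewrite ?inE.
- exact: measurable_eball.
- exact: measurable_open_eball.
- by move=> x /= xd; apply: le_lt_trans xd _; rewrite ltrBlDr ltrDl.
Qed.


(** The radial projection of [x] lies on the sphere at distance [|enorm x - 1|] from [x]; it exists
    because [e < 1] keeps [x] away from 0. *)
Lemma unit_sphere_nbhsE k (e : R) : (0 < k)%N -> 0 < e -> e < 1 ->
  [set x : 'cV[R]_k | exists2 y, enorm y = 1 & enorm (x - y) <= e] =
  eball k (1 + e) `\` (open_eball k (1 - e)).
Proof.
move=> k0 e0 e1; apply/seteqP; split => x /=.
  move=> [y y1 xy]; split.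
    rewrite /eball /= -(subrK y x) (le_trans (enorm_triangle _ _)) // y1; lra.
  apply/negP; rewrite -leNgt lerBlDr -y1 -(subrK x y) (le_trans (enorm_triangle _ _)) //.
  by rewrite addrC lerD2l -enormN opprB.
move=> [x1 /negP]; rewrite -leNgt => x2.
have x0 : 0 < enorm x by apply: lt_le_trans x2; lra.
exists ((enorm x)^-1 *: x).
  by rewrite enormZ ger0_norm ?invr_ge0 ?enorm_ge0 // mulVf // gt_eqF.
rewrite -[X in X - _]scale1r -scalerBl enormZ.
have -> : 1 - (enorm x)^-1 = (enorm x - 1) / enorm x by field; rewrite gt_eqF.
rewrite normrM normfV (ger0_norm (ltW x0)) -mulrA mulVf ?gt_eqF // mulr1.
move: x1; rewrite /eball /= => x1; rewrite ler_norml; lra.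
Qed.

(** The neighbourhood is a shell of volume [V * ((1 + e) ^+ k - (1 - e) ^+ k)]. Factoring this
    difference of powers cancels [2 * e], and the quotient becomes a polynomial in [e] whose value
    at 0 is [k * V]. *)
Lemma unit_sphere_areaE k : (0 < k)%N ->
  unit_sphere_area R k = k%:R * unit_ball_volume R k.
Proof.
move=> k0; rewrite /unit_sphere_area /surface_area; apply: cvg_lim => //.
pose V := unit_ball_volume R k.
pose g (e : R) := V * \sum_(i < k) (1 + e) ^+ (k.-1 - i) * (1 - e) ^+ i.
have g0 : g 0 = k%:R * V.
  rewrite /g mulrC; congr (_ * _); rewrite -[in RHS](card_ord k) -sumr_const.
  by apply: eq_bigr => i _; rewrite addr0 subr0 !expr1n mulr1.
rewrite -/V -g0; apply: (@cvg_trans _ (g @ 0^'+)); last first.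
  apply: cvg_at_right_filter; rewrite /g.
  apply: cvgM; first exact: cvg_cst.
  apply: cvg_big => //=; first exact: add_continuous.
  move=> i _; apply: cvgM; apply: (@continuous_cvg _ _ _ _ _ _ (fun x : R => x ^+ _)).
  - exact: exprn_continuous.
  - by apply: cvgD; [exact: cvg_cst|exact: cvg_id].
  - exact: exprn_continuous.
  - by apply: cvgB; [exact: cvg_cst|exact: cvg_id].
apply: near_eq_cvg; near=> e.
have e0 : 0 < e by [].
have e1 : e < 1 by [].
rewrite unit_sphere_nbhsE // /volume measureD; last 3 first.
- exact: measurable_eball.
- exact: measurable_open_eball.
- by rewrite [X in (X < _)%E](lebesgue_eball _ (addr_gt0 ltr01 e0)) ltry.
rewrite setIidr; last first.
  by move=> x /=; rewrite /eball /= => xe; apply: (le_trans (ltW xe)); lra.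
have e2 : 0 < 1 - e by rewrite subr_gt0.
rewrite [X in fine (X - _)%E](lebesgue_eball _ (addr_gt0 ltr01 e0)).
rewrite [X in fine (_ - X)%E](lebesgue_open_eball _ e2) -EFinB /= -mulrBl subrXX -/V /g.
rewrite (_ : 1 + e - (1 - e) = 2 * e); last by ring.
by field; rewrite gt_eqF.
Unshelve. all: by end_near.
Qed.

End enorm.
Arguments eball {R} k r.
Arguments open_eball {R} k r.

(** * Lattice points in balls *)

Section lattice_count.
Variable R : realType.
Local Notation RR := (measurableTypeR R).
Local Notation mu m n := (lebesgue_mx R m n).
Local Notation C m n := (@unit_cube R m n).

Definition ball_ind k (r : R) (x : 'cV[RR]_k) : \bar R := (\1_(eball k r) x)%:E.

Lemma ball_ind_ge0 k r (x : 'cV[RR]_k) : (0 <= ball_ind r x)%E.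
Proof. by rewrite lee_fin. Qed.

Lemma ball_indE k r (x : 'cV[RR]_k) : ball_ind r x = ((enorm x <= r)%R%:R)%:E.
Proof.
rewrite /ball_ind indicE; case: leP => xr; first by rewrite mem_set.
by rewrite memNset // /eball /= => h; move: (le_lt_trans h xr); rewrite ltxx.
Qed.

Lemma ball_ind_le k (r s : R) (x y : 'cV[RR]_k) :
  (enorm x <= r -> enorm y <= s) -> (ball_ind r x <= ball_ind s y)%E.
Proof.
move=> xy; rewrite !ball_indE lee_fin ler_nat.
by case: leP => // /xy ->.
Qed.

Lemma measurable_ball_ind k r : measurable_fun setT (@ball_ind k r).
Proof.
apply/measurable_EFinP; apply: measurable_indic; exact: measurable_eball.
Qed.

Lemma integral_ball_ind k r : 0 < r ->
  (\int[mu k 1]_x ball_ind r x = (r ^+ k * unit_ball_volume R k)%:E)%E.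
Proof.
move=> r0; rewrite integral_indic //; last exact: measurable_eball.
by rewrite setIT; exact: lebesgue_eball.
Qed.

Lemma integral_ball_ind_lattice k r (c : 'cV[RR]_k) : 0 < r ->
  (\int[mu k 1]_(x in C k 1) (\esum_(v in [set: 'cV[int]_k]) ball_ind r (x + c + int_cV R v)%R)
   = (r ^+ k * unit_ball_volume R k)%:E)%E.
Proof.
move=> r0; rewrite -integral_ball_ind // -(ge0_integral_mx_shift c) //; last 2 first.
- exact: measurable_ball_ind.
- exact: ball_ind_ge0.
rewrite -integral_unfold; last 2 first.
- exact: (measurableT_comp (@measurable_ball_ind k r) (measurable_mx_shift _)).
- by move=> x; exact: ball_ind_ge0.
by apply: eq_integral => x _; apply: eq_esum => v _; rewrite addrAC.
Qed.

Lemma measurable_ball_ind_lattice k r (c : 'cV[RR]_k) : measurable_fun setT (fun x : 'cV[RR]_k =>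
   \esum_(v in [set: 'cV[int]_k]) ball_ind r (x + c + int_cV R v)%R).
Proof.
apply: measurable_esum => [v|v x]; last exact: ball_ind_ge0.
rewrite (_ : (fun _ => _) = ball_ind r \o (fun x => x + (c + int_cV R v))).
  exact: (measurableT_comp (@measurable_ball_ind k r) (measurable_mx_shift _)).
by apply/funext => x /=; rewrite addrA.
Qed.

(** Average over translations by [x] in the unit cube: a translation moves points by at most [k], so
    the count for radius [r] is below the translated count for [r + k], whose mean is the volume of
    the ball. The lower bound below is the same argument with the radii exchanged. *)
Lemma lattice_count_le k (r : R) (c : 'cV[RR]_k) : 0 < r + k%:R ->
  (\esum_(v in [set: 'cV[int]_k]) ball_ind r (c + int_cV R v)
     <= ((r + k%:R) ^+ k * unit_ball_volume R k)%:E)%E.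
Proof.
move=> rk; rewrite -(integral_ball_ind_lattice c rk) -[leLHS](integral_cube_cst k 1).
apply: ge0_le_integral.
- exact: measurable_unit_cube.
- by move=> x _; apply: esum_ge0 => v _; exact: ball_ind_ge0.
- exact: measurable_cst.
- apply: measurable_funTS; exact: measurable_ball_ind_lattice.
move=> x xC; apply: le_esum => v _; apply: ball_ind_le => h.
rewrite -addrA (le_trans (enorm_triangle _ _)) // [leRHS]addrC lerD //.
exact: enorm_unit_cube.
Qed.

Lemma lattice_count_ge k (r : R) (c : 'cV[RR]_k) : 0 < r ->
  ((r ^+ k * unit_ball_volume R k)%:E <=
   \esum_(v in [set: 'cV[int]_k]) ball_ind (r + k%:R) (c + int_cV R v))%E.
Proof.
move=> r0; rewrite -(integral_ball_ind_lattice c r0) -[leRHS](integral_cube_cst k 1).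
apply: ge0_le_integral.
- exact: measurable_unit_cube.
- by move=> x _; apply: esum_ge0 => v _; exact: ball_ind_ge0.
- apply: measurable_funTS; exact: measurable_ball_ind_lattice.
- exact: measurable_cst.
move=> x xC; apply: le_esum => v _; apply: ball_ind_le => h.
rewrite (_ : c + _ = (x + c + int_cV R v) - x); last by rewrite addrAC [x + c]addrC addrK.
rewrite (le_trans (enorm_triangle _ _)) // lerD // enormN.
exact: enorm_unit_cube.
Qed.

Lemma esum_indic_card (T : choiceType) (A : set T) : finite_set A ->
  \esum_(t in [set: T]) (\1_A t)%:E = (#|` fset_set A|%:R)%:E :> \bar R.
Proof.
move=> fA; transitivity (\esum_(t in A) (1%E : \bar R)).
  rewrite [RHS]esum_mkcond; apply: eq_esum => t _.
  by rewrite indicE; case: (t \in A).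
by rewrite esum_fset // fsbig_finite //= sumEFin big_const_seq count_predT iter_addr_0.
Qed.

Lemma finite_lattice_ball k (r : R) :
  finite_set [set q : 'cV[int]_k | enorm (int_cV R q) <= r].
Proof.
apply: sub_finite_set (finite_int_cV_ball 0 r) => q /=.
by rewrite sub0r enormN.
Qed.

Lemma cV_neq0 k (q : 'cV[int]_k) : q != 0 -> exists i, q i 0 != 0.
Proof.
move=> q0; apply/existsP; apply: contra_neqT q0 => /existsPn h.
by apply/matrixP => i j; rewrite ord1 !mxE; apply/eqP; have := h i; rewrite negbK.
Qed.

Lemma enorm_int_ge1 k (q : 'cV[int]_k) : q != 0 -> 1 <= enorm (int_cV R q).
Proof.
move=> /cV_neq0[i qi].
apply: le_trans (le_entry_enorm _ i); rewrite mxE -intr_norm.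
by rewrite (_ : 1 = 1%:~R) // ler_int -gtz0_ge1 normr_gt0.
Qed.

Definition punctured_ball k (r : R) : set 'cV[int]_k :=
  [set q | 1 <= enorm (int_cV R q) < r].
Arguments punctured_ball k r : clear implicits.

Lemma finite_punctured_ball k r : finite_set (punctured_ball k r).
Proof.
by apply: sub_finite_set (@finite_lattice_ball k r) => q /= /andP[_ /ltW].
Qed.

Lemma in_punctured_ball k r q :
  (q \in fset_set (punctured_ball k r)) = (1 <= enorm (int_cV R q) < r).
Proof.
rewrite in_fset_set; last exact: finite_punctured_ball.
by apply/idP/idP; rewrite inE.
Qed.

Lemma punctured_ball_neq0 k r (q : 'cV[int]_k) :
  q \in fset_set (punctured_ball k r) -> q != 0.
Proof.
rewrite in_punctured_ball => /andP[q1 _]; apply: contraTneq q1 => ->.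
by rewrite /int_cV map_mx0 enorm0 -ltNge.
Qed.

Lemma card_punctured_ball_le k r : 0 < r ->
  #|` fset_set (punctured_ball k r)|%:R <= (r + k%:R) ^+ k * unit_ball_volume R k.
Proof.
move=> r0; rewrite -lee_fin -esum_indic_card; last exact: finite_punctured_ball.
apply: le_trans (@lattice_count_le k r 0 _); last by rewrite ltr_wpDr.
apply: le_esum => q _; rewrite ball_indE add0r indicE lee_fin ler_nat.
by case: (boolP (q \in _)) => //; rewrite inE => /= /andP[_ /ltW ->].
Qed.

(** The [- 1] accounts for the origin, and the [+ 1] in the radius turns a closed ball into an open
    one. *)
Lemma card_punctured_ball_ge k r : 0 < r ->
  r ^+ k * unit_ball_volume R k - 1 <= #|` fset_set (punctured_ball k (r + k%:R + 1))|%:R.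
Proof.
move=> r0; rewrite lerBlDr -lee_fin EFinD -esum_indic_card; last exact: finite_punctured_ball.
apply: le_trans (@lattice_count_ge k r 0 r0) _.
have <- : \esum_(q in [set: 'cV[int]_k]) (\1_[set (0 : 'cV[int]_k)] q)%:E = 1%E :> \bar R.
  rewrite (esum_only (j0 := 0)) ?indicE ?mem_set //= => q /eqP q0.
  by rewrite indicE memNset.
rewrite -esumD //; apply: le_esum => q _; rewrite ball_indE add0r -EFinD lee_fin !indicE -natrD ler_nat.
case: leP => //= qr; have [->|q0] := eqVneq q 0; first by rewrite [in X in (_ + X)%N]mem_set ?addn1.
rewrite mem_set // /punctured_ball /= enorm_int_ge1 //=.
by apply: le_lt_trans qr _; rewrite ltrDl.
Qed.

End lattice_count.
Arguments punctured_ball {R} k r.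

(** * Growth of the sum of [|q|^-n] over nonzero integral vectors *)

Section real_sequences.
Variable R : realType.

(** From some index on, the increments of [u - l * v] are at most [e / 2] times those of [v]; these
    bounds are telescoped and divided by [v k]. *)
Lemma stolz_cesaro (u v : R^nat) (l : R) :
  (forall k, (0 < k)%N -> v k < v k.+1) -> v @ \oo --> +oo ->
  (u k.+1 - u k) / (v k.+1 - v k) @[k --> \oo] --> l ->
  u k / v k @[k --> \oo] --> l.
Proof.
move=> incv vy du; apply/cvgrPdist_le => e e0.
have e2 : 0 < e / 2 by rewrite divr_gt0.
move/cvgrPdist_le: du => /(_ _ e2) [N _ HN].
(* The successor ensures positive indices, where [v] is known to increase: [ln] takes the value 0 at
   both 0 and 1. *)
pose N1 := N.+1.
have step k : (N1 <= k)%N ->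
    `|(u k - l * v k) - (u N1 - l * v N1)| <= e / 2 * (v k - v N1).
  move=> /subnK <-; elim: (k - N1)%N => [|i IH]; first by rewrite !subrr normr0 mulr0.
  rewrite addSn; set j := (i + N1)%N in IH *.
  have dv : 0 < v j.+1 - v j by rewrite subr_gt0 incv // /j /N1 addnS.
  have /= := HN j; rewrite /j /N1 => /(_ (leq_trans (leqnSn _) (leq_addl _ _))).
  rewrite -/N1 -/j -(ler_pM2r dv) -[X in _ * X](gtr0_norm dv) -normrM.
  rewrite (_ : (l - _) * _ = - (u j.+1 - u j - l * (v j.+1 - v j))); last first.
    by field; rewrite gt_eqF.
  rewrite normrN => h.
  have -> : u j.+1 - l * v j.+1 - (u N1 - l * v N1) =
     (u j - l * v j - (u N1 - l * v N1)) + (u j.+1 - u j - l * (v j.+1 - v j)) by ring.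
  apply: le_trans (ler_normD _ _) _.
  have -> : e / 2 * (v j.+1 - v N1) = e / 2 * (v j - v N1) + e / 2 * (v j.+1 - v j) by ring.
  exact: lerD.
pose c := `|u N1 - l * v N1|.
move/cvgryPge: vy => vy.
near=> k.
have kN : (N1 <= k)%N by near: k; exact: nbhs_infty_ge.
(* Past this threshold the other [e / 2] absorbs the contribution of the first [N1] terms. *)
have vc : (c + e / 2 * `|v N1|) / (e / 2) <= v k by near: k; exact: vy.
have v1 : 1 <= v k by near: k; exact: vy.
have v0 : 0 < v k by apply: lt_le_trans v1.
have -> : l - u k / v k = - ((u k - l * v k) / v k) by field; rewrite gt_eqF.
rewrite normrN normrM normfV (gtr0_norm v0) ler_pdivrMr //.
move: vc; rewrite ler_pdivrMr // => vc.
have := step k kN; rewrite -/c => h.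
have := ler_normD (u k - l * v k - (u N1 - l * v N1)) (u N1 - l * v N1).
rewrite subrK -/c => h2; apply: (le_trans h2).
have h3 : - `|v N1| <= v N1 by rewrite lerNl -normrN ler_norm.
nra.
Unshelve. all: by end_near.
Qed.

Lemma cvg_ln_nat : ln (n%:R : R) @[n --> \oo] --> +oo.
Proof.
apply/cvgryPge => A; near=> n.
rewrite -[A]expRK ler_ln ?posrE ?expR_gt0 //; last first.
  by rewrite ltr0n; near: n; exact: nbhs_infty_gt.
by near: n; exact: nbhs_infty_ger.
Unshelve. all: by end_near.
Qed.

(** Both sides are [ln (1 + x) <= x], at [x = - 1 / (K + 1)] and at [x = 1 / K]. *)
Lemma ln_succ_bounds (K : nat) : (0 < K)%N ->
  (K.+1%:R^-1 : R) <= ln (K.+1%:R : R) - ln (K%:R : R) <= K%:R^-1.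
Proof.
move=> K0; have k0 : (0 : R) < K%:R by rewrite ltr0n.
have k1 : (0 : R) < K.+1%:R by rewrite ltr0n.
apply/andP; split.
  rewrite -lerN2 opprB -ln_div ?posrE //.
  rewrite (_ : K%:R / K.+1%:R = 1 + - K.+1%:R^-1); last first.
    by rewrite -natr1; field; rewrite natr1 gt_eqF.
  by apply: le_ln1Dx; rewrite ltrN2 invf_lt1 // ltr1n.
rewrite -ln_div ?posrE //.
rewrite (_ : K.+1%:R / K%:R = 1 + K%:R^-1); last first.
  by rewrite -natr1; field; rewrite gt_eqF.
by apply: le_ln1Dx; apply: lt_trans (_ : 0 < _) => //; rewrite ?invr_gt0 // ltrN10.
Qed.

(** With [a = 1 / K] and [b = 1 / (K + 1)] one has [a - b = a * b], and each term of the
    factorization of [a ^+ n - b ^+ n] lies between [b ^+ n.-1] and [a ^+ n.-1]. *)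
Lemma sub_invX_bounds (n K : nat) : (0 < n)%N -> (0 < K)%N ->
  n%:R * (K%:R^-1 * K.+1%:R ^- n) <= (K%:R ^- n - K.+1%:R ^- n : R)
    <= n%:R * (K%:R ^- n * K.+1%:R^-1).
Proof.
case: n => // n _ K0; rewrite -!exprVn.
have k0 : (0 : R) < K%:R by rewrite ltr0n.
have k1 : (0 : R) < K.+1%:R by rewrite ltr0n.
set a := K%:R^-1; set b := K.+1%:R^-1.
have a0 : 0 < a by rewrite invr_gt0.
have b0 : 0 < b by rewrite invr_gt0.
have ba : b <= a by rewrite lef_pV2 ?posrE // ler_nat.
rewrite subrXX.
have -> : a - b = a * b.
  by rewrite /a /b -natr1; field; rewrite natr1 !gt_eqF.
have hn (c : R) : n.+1%:R * c = \sum_(i < n.+1) c by rewrite sumr_const card_ord mulr_natl.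
have -> : n.+1%:R * (a * b ^+ n.+1) = a * b * \sum_(i < n.+1) b ^+ n.
  by rewrite -hn exprS; ring.
have -> : n.+1%:R * (a ^+ n.+1 * b) = a * b * \sum_(i < n.+1) a ^+ n.
  by rewrite -hn exprS; ring.
apply/andP; split; rewrite ler_wpM2l ?mulr_ge0 ?(ltW a0) ?(ltW b0) //;
  apply: ler_sum => i _; have iE : (n = n.+1.-1 - i + i)%N by rewrite subnK // -ltnS.
  rewrite [in leLHS]iE exprD ler_wpM2r ?exprn_ge0 ?(ltW b0) //.
  by rewrite lerXn2r ?nnegrE // ltW.
rewrite [in leRHS]iE exprD ler_wpM2l ?exprn_ge0 ?(ltW a0) //.
by rewrite lerXn2r ?nnegrE // ltW.
Qed.

End real_sequences.

Section sum_inv_enorm.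
Variables (R : realType) (n : nat).
Hypothesis n0 : (0 < n)%N.
Local Notation nrm q := (enorm (int_cV R q)).
Local Notation Q K := (fset_set (@punctured_ball R n K%:R)).
Local Notation B := (unit_ball_volume R n).

Definition sum_inv_enorm (K : nat) : R := \sum_(q <- Q K) nrm q ^- n.

Lemma sum_punctured_ball_lt (V : nmodType) (r s : R) (F : 'cV[int]_n -> V) : r <= s ->
  \sum_(q <- fset_set (punctured_ball n s) | nrm q < r) F q =
  \sum_(q <- fset_set (punctured_ball n r)) F q.
Proof.
move=> rs; rewrite -big_filter; apply: perm_big; apply: uniq_perm.
- exact/filter_uniq/fset_uniq.
- exact: fset_uniq.
move=> q; rewrite mem_filter !in_punctured_ball.
by case: ltP => qr; rewrite ?andbF ?andbT //= (lt_le_trans qr rs) andbT.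
Qed.

Let M K : R := #|` Q K|%:R.
(** Discrete summation by parts: with the boundary value [K ^- n] subtracted, vectors of norm in
    [[K, K + 1[] enter [x K.+1] with a weight between 0 and [d K], so the increments of [x] are
    governed by the cardinals [M] alone. *)
Let x K : R := \sum_(q <- Q K) (nrm q ^- n - K%:R ^- n).
Let d K : R := K%:R ^- n - K.+1%:R ^- n.

Let sum_cst K (c : R) : \sum_(q <- Q K) c = M K * c.
Proof. by rewrite big_const_seq count_predT iter_addr_0 mulr_natl. Qed.

Let x_succ K : (0 < K)%N -> M K * d K <= x K.+1 - x K <= M K.+1 * d K.
Proof.
move=> K0; have k0 : (0 : R) < K%:R by rewrite ltr0n.
have KK : K%:R <= K.+1%:R :> R by rewrite ler_nat.
have E : x K.+1 - x K = M K * d K +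
    \sum_(q <- Q K.+1 | ~~ (nrm q < K%:R)) (nrm q ^- n - K.+1%:R ^- n).
  rewrite /x (bigID (fun q => nrm q < K%:R)) /= sum_punctured_ball_lt //.
  rewrite -sum_cst addrAC -sumrB; congr (_ + _); apply: eq_bigr => q _.
  by rewrite /d; ring.
have ME : M K.+1 * d K = M K * d K + \sum_(q <- Q K.+1 | ~~ (nrm q < K%:R)) d K.
  by rewrite -!sum_cst (bigID (fun q => nrm q < K%:R)) /= sum_punctured_ball_lt.
rewrite ME E lerDl lerD2l; apply/andP; split.
  rewrite big_seq_cond sumr_ge0 // => q; rewrite in_punctured_ball => /andP[/andP[q1 qK] _].
  rewrite subr_ge0 lef_pV2 ?posrE ?exprn_gt0 ?(lt_le_trans _ q1) //.
  by rewrite lerXn2r ?nnegrE ?enorm_ge0 ?ler0n // ltW.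
rewrite big_seq_cond [leRHS]big_seq_cond; apply: ler_sum => q.
rewrite in_punctured_ball -leNgt => /andP[/andP[q1 qK] Kq].
rewrite /d lerD2r lef_pV2 ?posrE ?exprn_gt0 ?(lt_le_trans _ q1) //.
by rewrite lerXn2r ?nnegrE ?enorm_ge0 ?ler0n.
Qed.

Let M_le K : (0 < K)%N -> M K <= (K%:R + n%:R) ^+ n * B.
Proof. by move=> K0; apply: card_punctured_ball_le; rewrite ltr0n. Qed.

Let cvg_shift (c : R) (k : nat) :
  ((j%:R + c) / (j + k)%:R) ^+ n @[j --> \oo] --> (1 : R).
Proof.
rewrite -[X in _ --> X](expr1n R n).
apply: (@continuous_cvg _ _ _ _ _ _ (fun y : R => y ^+ n)); first exact: exprn_continuous.
apply: (@cvg_trans _ ((fun j => 1 + (c - k%:R) * ((j + k)%:R)^-1) @ \oo)); last first.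
  suff : 1 + (c - k%:R) * ((j + k)%:R)^-1 @[j --> \oo] --> 1 + (c - k%:R) * 0 by rewrite mulr0 addr0.
  apply: cvgD; first exact: cvg_cst.
  apply: cvgM; first exact: cvg_cst.
  apply/gtr0_cvgV0; first by near=> j; rewrite ltr0n addn_gt0; apply/orP; left; near: j; exact: nbhs_infty_gt.
  apply/cvgryPge => A; near=> j; rewrite natrD ler_wpDr //.
  near: j; exact: nbhs_infty_ger.
apply: near_eq_cvg; near=> j; rewrite natrD.
have j0 : (0 : R) < j%:R by rewrite ltr0n; near: j; exact: nbhs_infty_gt.
by field; rewrite gt_eqF // ltr_wpDr.
Unshelve. all: by end_near.
Qed.

(** Stolz-Cesaro against [ln K]: as [M K] is about [B * K ^+ n] and [d K] about [n * K ^- n.+1], the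
    increments of [x] are about [n * B / K], and those of [ln] about [1 / K]. *)
Lemma sum_inv_enorm_cvg :
  sum_inv_enorm K / ln K%:R @[K --> \oo] --> n%:R * B.
Proof.
have B0 : 0 < B := unit_ball_volume_gt0 R n.
have lnK0 : (ln (K%:R : R))^-1 @[K --> \oo] --> (0 : R).
  apply/gtr0_cvgV0; last exact: cvg_ln_nat.
  by near=> j; rewrite ln_gt0 // ltr1n; near: j; exact: nbhs_infty_gt.
have xlim : x K / ln K%:R @[K --> \oo] --> n%:R * B.
  apply: (@stolz_cesaro _ _ (fun K => ln (K%:R : R))).
  - move=> k k0; have /andP[+ _] := @ln_succ_bounds R k k0.
    by move=> h; rewrite -subr_gt0 (lt_le_trans _ h) // invr_gt0 ltr0n.
  - exact: cvg_ln_nat.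
  (* Both bounds come from the lattice counts: the shift [n + 1] is the loss [n] in the radius plus,
     above, the step from [K] to [K + 1] and, below, the passage to an open ball. *)
  apply: (@squeeze_cvgr _ _ _ _
      (fun K : nat => n%:R * (((K%:R + (- (n%:R + 1))) / (K + 1)%:R) ^+ n * B - (K.+1%:R^-1) ^+ n))
      (fun K : nat => n%:R * (((K%:R + (n%:R + 1)) / (K + 0)%:R) ^+ n * B))); last 2 first.
  - rewrite (_ : n%:R * B = n%:R * (1 * B - 0 ^+ n)); last first.
      by rewrite mul1r expr0n gtn_eqF // subr0.
    apply: cvgM; first exact: cvg_cst.
    apply: cvgB; first by apply: cvgM; [exact: cvg_shift|exact: cvg_cst].
    apply: (@continuous_cvg _ _ _ _ _ _ (fun y : R => y ^+ n)); first exact: exprn_continuous.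
    exact: cvg_harmonic.
  - rewrite (_ : n%:R * B = n%:R * (1 * B)); last by rewrite mul1r.
    apply: cvgM; first exact: cvg_cst.
    by apply: cvgM; [exact: cvg_shift|exact: cvg_cst].
  near=> K.
  have K0 : (0 < K)%N by near: K; exact: nbhs_infty_gt.
  have Kn : (n + 1 < K)%N by near: K; exact: nbhs_infty_gt.
  have k0 : (0 : R) < K%:R by rewrite ltr0n.
  have /andP[l1 l2] := @ln_succ_bounds R K K0.
  have /andP[d1 d2] := @sub_invX_bounds R n K n0 K0.
  have /andP[x1 x2] := x_succ K0.
  have l0 : 0 < ln K.+1%:R - ln K%:R :> R by rewrite (lt_le_trans _ l1) // invr_gt0 ltr0n.
  have M0 k : 0 <= M k by rewrite ler0n.
  have kn : (0 : R) < K%:R - (n%:R + 1) by rewrite subr_gt0 natr1 ltr_nat -addn1.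
  apply/andP; split.
    rewrite ler_pdivlMr //; apply: le_trans x1.
    apply: (@le_trans _ _ (M K * (n%:R * (K%:R^-1 * K.+1%:R ^- n)))); last by rewrite ler_wpM2l.
    apply: (@le_trans _ _ (n%:R * (M K / K.+1%:R ^+ n) * K%:R^-1)); last first.
      by rewrite le_eqVlt; apply/orP; left; apply/eqP; ring.
    apply: (@le_trans _ _ (n%:R * (M K / K.+1%:R ^+ n) * (ln K.+1%:R - ln K%:R))); last first.
      by rewrite ler_wpM2l // mulr_ge0 // divr_ge0 // exprn_ge0.
    rewrite ler_wpM2r ?(ltW l0) //.
    rewrite ler_wpM2l // ler_pdivlMr ?exprn_gt0 // addn1 mulrBl.
    rewrite -exprMn mulVf ?pnatr_eq0 // expr1n mulrAC -exprMn divfK ?pnatr_eq0 //.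
    have := @card_punctured_ball_ge R n _ kn.
    by rewrite (_ : _ - _ + _ + _ = K%:R) //; ring.
  rewrite ler_pdivrMr //; apply: (le_trans x2).
  apply: (@le_trans _ _ (M K.+1 * (n%:R * (K%:R ^- n * K.+1%:R^-1)))); first by rewrite ler_wpM2l.
  rewrite addn0.
  apply: (@le_trans _ _ (n%:R * (M K.+1 / K%:R ^+ n) * K.+1%:R^-1)).
    by rewrite le_eqVlt; apply/orP; left; apply/eqP; ring.
  apply: ler_pM => //.
  - by rewrite mulr_ge0 // divr_ge0 // exprn_ge0.
  rewrite ler_wpM2l // ler_pdivrMr ?exprn_gt0 //.
  rewrite mulrAC -exprMn divfK ?gt_eqF //.
  apply: le_trans (M_le _) _ => //.
  by rewrite -natr1 addrAC addrA.
(* The boundary term [M K * K ^- n] is bounded, hence negligible against [ln K]. *)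
have -> : (fun K => sum_inv_enorm K / ln K%:R) =
   (fun K => x K / ln K%:R + (M K * K%:R ^- n) / ln K%:R).
  apply/funext => K; rewrite -mulrDl; congr (_ / _).
  by rewrite /x sumrB sum_cst subrK.
rewrite -[X in _ --> X]addr0; apply: cvgD => //.
apply: (@squeeze_cvgr _ _ _ _ (fun=> 0) (fun K => ((K%:R + n%:R) / (K + 0)%:R) ^+ n * B / ln K%:R)).
- near=> K; have K0 : (0 < K)%N by near: K; exact: nbhs_infty_gt.
  have k0 : (0 : R) < K%:R by rewrite ltr0n.
  have l0 : 0 <= (ln K%:R)^-1 :> R by rewrite invr_ge0 ln_ge0 // ler1n.
  apply/andP; split; first by rewrite mulr_ge0 // mulr_ge0 ?ler0n // invr_ge0 exprn_ge0.
  rewrite addn0 ler_wpM2r //.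
  rewrite ler_pdivrMr ?exprn_gt0 // mulrAC -exprMn divfK ?gt_eqF //.
  exact: M_le.
- exact: cvg_cst.
- rewrite -[X in _ --> X](mulr0 (1 * B)); apply: cvgM => //.
  by apply: cvgM; [exact: cvg_shift|exact: cvg_cst].
Unshelve. all: by end_near.
Qed.

End sum_inv_enorm.

Section bounds.
Variable R : realType.

Lemma cvg_seq_ubound (u : R^nat) (l : R) : u @ \oo --> l ->
  exists2 c, 0 < c & forall k, u k <= c.
Proof.
move=> ul; have /cvg_seq_bounded : cvgn (u : nat -> R^o) by apply/cvg_ex; exists l.
move=> [M [_ Mu]]; exists (`|M| + 1); first by rewrite ltr_wpDl.
move=> k; apply: le_trans (ler_norm _) _; apply: Mu => //.
by rewrite (le_lt_trans (ler_norm _)) // ltrDl.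
Qed.

Lemma sum_inv_enorm_le n : (0 < n)%N ->
  exists2 c : R, 0 < c & forall K, (1 < K)%N -> sum_inv_enorm R n K <= c * ln K%:R.
Proof.
move=> n0; have [c c0 h] := cvg_seq_ubound (@sum_inv_enorm_cvg R n n0).
exists c => // K K1; rewrite -ler_pdivrMr; first exact: h.
by rewrite ln_gt0 // ltr1n.
Qed.

Lemma sum_inv_enorm_ge0 n K : 0 <= sum_inv_enorm R n K.
Proof.
by apply: sumr_ge0 => q _; rewrite invr_ge0 exprn_ge0 // enorm_ge0.
Qed.

Lemma harmonic_le (K : nat) : (0 < K)%N ->
  \sum_(1 <= k < K.+1) (k%:R^-1 : R) <= 1 + ln K%:R.
Proof.
elim: K => // -[|K] IH _; first by rewrite big_nat1 invr1 ln1 addr0.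
have /andP[h _] := @ln_succ_bounds R K.+1 isT.
rewrite big_nat_recr //=; apply: le_trans (lerD (IH isT) h) _.
by rewrite -addrA subrKC.
Qed.

(* Telescoping: [k ^- 2 <= (k - 1)^-1 - k^-1]. *)
Lemma sum_inv_sqr_le (D K : nat) : (0 < D)%N ->
  \sum_(D.+1 <= k < K) (k%:R ^- 2 : R) <= D%:R^-1.
Proof.
move=> D0; have [KD|DK] := leqP K D.+1; first by rewrite big_geq.
apply: (@le_trans _ _ (\sum_(D.+1 <= k < K) ((- (k.+1.-1)%:R^-1) - (- (k.-1)%:R^-1)))).
  rewrite big_nat_cond [leRHS]big_nat_cond; apply: ler_sum => k /andP[/andP[Dk _] _].
  case: k Dk => // k; rewrite ltnS => Dk /=.
  have k0 : (0 : R) < k%:R by rewrite ltr0n (leq_trans D0).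
  have k1 : (0 : R) < k.+1%:R by rewrite ltr0n.
  rewrite opprK (_ : - _ + _ = k.+1%:R^-1 * k%:R^-1); last first.
    by rewrite -natr1; field; rewrite natr1 !gt_eqF.
  by rewrite expr2 invfM ler_wpM2l ?invr_ge0 // lef_pV2 ?posrE // ler_nat.
rewrite (@telescope_sumr _ _ _ (fun k => - (k.-1)%:R^-1)) ?(ltnW DK) //= opprK.
by rewrite addrC gerBl invr_ge0.
Qed.

End bounds.

(** * First and second moments *)

Section moments.
Variable R : realType.
Local Notation RR := (measurableTypeR R).
Local Notation mu m n := (lebesgue_mx R m n).
Local Notation C m n := (@unit_cube R m n).

Definition ball_count m (r : R) (x : 'cV[RR]_m) : \bar R :=
  \esum_(p in [set: 'cV[int]_m]) ball_ind r (x - int_cV R p).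

Lemma ball_count_ge0 m r (x : 'cV[RR]_m) : (0 <= ball_count r x)%E.
Proof. by apply: esum_ge0 => p _; exact: ball_ind_ge0. Qed.

Lemma measurable_ball_count m r : measurable_fun setT (@ball_count m r).
Proof.
apply: measurable_esum => [p|p x]; last exact: ball_ind_ge0.
exact: (measurableT_comp (@measurable_ball_ind R m r) (measurable_mx_shift _)).
Qed.

Lemma ball_count_periodic m r : mx_periodic (@ball_count m r).
Proof.
move=> x z; rewrite /ball_count (reindex_esumT (e := fun p => p + z) (e' := fun p => p - z)).
- by apply: eq_esum => p _; rewrite /int_cV map_mxD opprD addrACA subrr addr0.
- by move=> p; rewrite addrK.
- by move=> p; rewrite subrK.
Qed.

Lemma integral_ball_count m r : 0 < r ->
  (\int[mu m 1]_(x in C m 1) ball_count r x = (r ^+ m * unit_ball_volume R m)%:E)%E.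
Proof.
move=> r0; rewrite -(@integral_ball_ind R m r r0) -integral_unfold; last 2 first.
- exact: measurable_ball_ind.
- by move=> x; exact: ball_ind_ge0.
apply: eq_integral => x _; rewrite /ball_count.
rewrite (reindex_esumT (e := -%R) (e' := -%R)); [|exact: opprK|exact: opprK].
by apply: eq_esum => p _; rewrite /int_cV raddfN opprK.
Qed.

Lemma exists_mx_of_row m n (q q' : 'cV[R]_n) (l : 'rV[R]_n) :
  l *m q = 0 -> l *m q' = 1%:M ->
  forall t : 'cV[R]_m, exists S : 'M[R]_(m, n), S *m q = 0 /\ S *m q' = t.
Proof.
move=> lq lq' t; exists (t *m l); rewrite -!mulmxA lq lq' mulmx0 mulmx1; by split.
Qed.

Lemma mx11_entry (A : 'M[R]_1) : A = (A 0 0)%:M.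
Proof. by apply/matrixP => i j; rewrite !ord1 !mxE eqxx mulr1n. Qed.

Lemma exists_mx_nonzero m n (q' : 'cV[int]_n) : q' != 0 ->
  forall t : 'cV[R]_m, exists S : 'M[R]_(m, n),
    S *m int_cV R 0 = 0 /\ S *m int_cV R q' = t.
Proof.
move=> /cV_neq0[i qi].
apply: (@exists_mx_of_row _ _ _ _ ((q' i 0)%:~R^-1 *: delta_mx 0 i)).
  by rewrite /int_cV raddf0 mulmx0.
rewrite -scalemxAl -rowE [_ *: _]mx11_entry !mxE mulVf // intr_eq0 //.
Qed.

(** The row is read off the nonzero 2 by 2 minor of [(q, q')]: it vanishes on [q] by antisymmetry
    and takes the value of the minor on [q']. *)
Lemma exists_mx_nonparallel m n (q q' : 'cV[int]_n) i j : q i 0 * q' j 0 != q j 0 * q' i 0 ->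
  forall t : 'cV[R]_m, exists S : 'M[R]_(m, n),
    S *m int_cV R q = 0 /\ S *m int_cV R q' = t.
Proof.
move=> qij; pose dt : R := (q i 0)%:~R * (q' j 0)%:~R - (q j 0)%:~R * (q' i 0)%:~R.
have dt0 : dt != 0 by rewrite subr_eq0 -!intrM eqr_int.
apply: (@exists_mx_of_row _ _ _ _
  (dt^-1 *: ((q i 0)%:~R *: delta_mx 0 j - (q j 0)%:~R *: delta_mx 0 i))).
  rewrite -scalemxAl mulmxBl -!scalemxAl -!rowE [_ *: _]mx11_entry !mxE.
  by rewrite [X in _ - X]mulrC subrr mulr0 raddf0.
rewrite -scalemxAl mulmxBl -!scalemxAl -!rowE [_ *: _]mx11_entry !mxE.
by rewrite mulVf.
Qed.

(** The case of [equidistribution] where the first function is 1 and the first vector is 0. *)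
Lemma equidistribution1 m n (F : 'cV[RR]_m -> \bar R) (q : 'cV[int]_n) :
  measurable_fun setT F -> (forall x, 0 <= F x)%E -> mx_periodic F -> q != 0 ->
  (\int[mu m n]_(A in C m n) F (A *m int_cV R q)%R = \int[mu m 1]_(x in C m 1) F x)%E.
Proof.
move=> mF F0 pF q0.
have := @equidistribution R m n (cst 1%E) F 0 q (measurable_cst _) mF (fun=> lee01) F0
   (fun _ _ => erefl) pF (exists_mx_nonzero q0).
rewrite integral_cube_cst mul1e => <-.
by apply: eq_integral => A _; rewrite mul1e.
Qed.

Lemma integral_ball_count_mulmx m n r (q : 'cV[int]_n) : 0 < r -> q != 0 ->
  (\int[mu m n]_(A in C m n) ball_count r (A *m int_cV R q)%R =
   (r ^+ m * unit_ball_volume R m)%:E)%E.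
Proof.
move=> r0 q0; rewrite -integral_ball_count // equidistribution1 //.
- exact: measurable_ball_count.
- by move=> x; exact: ball_count_ge0.
- exact: ball_count_periodic.
Qed.

Lemma integral_ball_count_nonparallel m n r r' (q q' : 'cV[int]_n) i j :
  0 < r -> 0 < r' -> q i 0 * q' j 0 != q j 0 * q' i 0 ->
  (\int[mu m n]_(A in C m n)
     (ball_count r (A *m int_cV R q)%R * ball_count r' (A *m int_cV R q')%R) =
   ((r ^+ m * unit_ball_volume R m) * (r' ^+ m * unit_ball_volume R m))%:E)%E.
Proof.
move=> r0 r'0 qij.
have q0 : q != 0 by apply: contraNneq qij => ->; rewrite !mxE !mul0r.
rewrite equidistribution.
- by rewrite integral_ball_count_mulmx // integral_ball_count.
- exact: measurable_ball_count.
- exact: measurable_ball_count.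
- by move=> x; exact: ball_count_ge0.
- by move=> x; exact: ball_count_ge0.
- exact: ball_count_periodic.
- exact: ball_count_periodic.
- exact: (exists_mx_nonparallel qij).
Qed.

End moments.

(** * Close pairs of lattice points for two parallel vectors *)

Section parallel.
Variable R : realType.
Local Notation RR := (measurableTypeR R).
Local Notation mu m n := (lebesgue_mx R m n).
Local Notation C m n := (@unit_cube R m n).

Lemma integral_unfoldN m n (g : 'M[RR]_(m, n) -> \bar R) :
  measurable_fun setT g -> (forall x, 0 <= g x)%E ->
  (\int[mu m n]_(A in C m n) (\esum_(z in [set: 'M[int]_(m, n)]) g (A - map_mx intr z)%R) =
   \int[mu m n]_A g A)%E.
Proof.
move=> mg g0; rewrite -integral_unfold //; apply: eq_integral => x _.
rewrite (reindex_esumT (e := -%R) (e' := -%R)); [|exact: opprK|exact: opprK].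
by apply: eq_esum => p _; rewrite raddfN opprK.
Qed.

Lemma measurable_ball_ind_affine m r c (s : 'cV[RR]_m) :
  measurable_fun setT (fun x : 'cV[RR]_m => ball_ind r (c *: x + s)).
Proof. exact: (measurableT_comp (@measurable_ball_ind R m r) (measurable_mx_affine _ _)). Qed.

Lemma ball_indZ m r c (x : 'cV[RR]_m) : 0 < c ->
  ball_ind r (c *: x) = ball_ind (c^-1 * r) x.
Proof. by move=> c0; rewrite !ball_indE enormZ gtr0_norm // ler_pdivlMl. Qed.

Lemma ge0_esumZl (J : countType) (c : R) (f : J -> \bar R) : (forall j, 0 <= f j)%E -> 0 <= c ->
  (\esum_(j in [set: J]) (c%:E * f j) = c%:E * \esum_(j in [set: J]) f j)%E.
Proof.
move=> f0 c0; rewrite !esum_nneseries //; last by move=> j; rewrite mule_ge0.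
rewrite -nneseriesZl //; last by move=> i _; case: pickle_inv => //=.
by apply: eq_eseriesr => i _; case: pickle_inv => //=; rewrite mule0.
Qed.

(** Factor [(s + k) ^+ k - s ^+ k]; as [s >= 1 / 2], both [s] and [s + k] are at most
    [(1 + 2 * k) * s]. The coefficient 1 of [s ^+ k] is what lets the product of the means cancel in
    the variance. *)
Lemma shifted_powerX_le k (s : R) : (0 < k)%N -> 0 < s -> 1 <= 2 * s ->
  (s + k%:R) ^+ k <= s ^+ k + k%:R ^+ 2 * (1 + 2 * k%:R) ^+ k.-1 * s ^+ k.-1.
Proof.
move=> k0 s0 s1.
have ms : s + k%:R <= (1 + 2 * k%:R) * s by have := ler0n R k; nra.
have hc (c : R) : k%:R * c = \sum_(i < k) c by rewrite sumr_const card_ord mulr_natl.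
rewrite -lerBlDl subrXX.
have -> : s + k%:R - s = k%:R by ring.
rewrite expr2 -!mulrA ler_wpM2l // [leRHS](hc).
apply: ler_sum => i _; rewrite -exprMn.
have iE : (k.-1 = k.-1 - i + i)%N by rewrite subnK // -ltnS prednK.
rewrite [in leRHS]iE exprD ler_pM ?exprn_ge0 ?addr_ge0 ?(ltW s0) //.
  by rewrite lerXn2r ?nnegrE ?mulr_ge0 ?addr_ge0 ?mulr_ge0 ?(ltW s0).
rewrite lerXn2r ?nnegrE ?mulr_ge0 ?addr_ge0 ?mulr_ge0 ?(ltW s0) //.
by apply: le_trans ms; rewrite lerDl.
Qed.

Variables (m : nat) (a : int) (a' : nat) (r r' : R).
Hypotheses (a'0 : (0 < a')%N) (aa' : coprimez a a').
Hypotheses (r0 : 0 < r) (r'0 : 0 < r') (rr' : `|a|%:~R * r' <= a'%:R * r).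

(* Pairs of close lattice points [(p, p')] that are not integer multiples
   [(a p0, a' p0)] of a common point. *)
Definition transverse_count (x : 'cV[RR]_m) : \bar R :=
  \esum_(pp in [set: 'cV[int]_m * 'cV[int]_m])
     (((a *: pp.2 != a'%:Z *: pp.1)%R%:R)%:E *
     (ball_ind r (a%:~R *: x - int_cV R pp.1)%R *
      ball_ind r' (a'%:R *: x - int_cV R pp.2)%R))%E.

Lemma transverse_count_ge0 x : (0 <= transverse_count x)%E.
Proof.
by apply: esum_ge0 => p _; rewrite !mule_ge0 ?ball_ind_ge0 // lee_fin ler0n.
Qed.

Lemma measurable_transverse_count : measurable_fun setT transverse_count.
Proof.
apply: measurable_esum => [p|p x].
  apply: measurable_funeM; apply: emeasurable_funM; exact: measurable_ball_ind_affine.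
by rewrite !mule_ge0 ?ball_ind_ge0 // lee_fin ler0n.
Qed.

(** Translating [x] by [z] translates [(p, p')] by [(a z, a' z)], which preserves [a p' - a' p]. *)
Lemma transverse_count_periodic : mx_periodic transverse_count.
Proof.
move=> x z; rewrite /transverse_count.
rewrite (reindex_esumT
   (e := fun pp : 'cV[int]_m * 'cV[int]_m => (pp.1 + a *: z, pp.2 + a'%:Z *: z))
   (e' := fun pp => (pp.1 - a *: z, pp.2 - a'%:Z *: z))).
- apply: eq_esum => -[p p'] _ /=.
  congr (_ * (_ * _))%E.
  + by rewrite !scalerDr !scalerA [a * _]mulrC (inj_eq (addIr _)).
  + congr ball_ind; rewrite /int_cV map_mxD map_mxZ scalerDr.
    by rewrite opprD addrACA subrr addr0.
  + congr ball_ind; rewrite /int_cV map_mxD map_mxZ scalerDr.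
    by rewrite opprD addrACA subrr addr0.
- by move=> [p p'] /=; rewrite !addrK.
- by move=> [p p'] /=; rewrite !subrK.
Qed.

(* The change of variables [(p, p') = (a u - be v, a' u + al v)] is unimodular
   when [al a + be a' = 1]; the sum over [u] is then unfolded. *)
Lemma integral_transverse_count :
  (\int[mu m 1]_(x in C m 1) transverse_count x =
   \int[mu m 1]_x (ball_ind r' (a'%:R *: x)%R *
     \esum_(v in [set: 'cV[int]_m]) (((v != 0)%:R)%:E *
        ball_ind r (a%:~R *: x + a'%:R^-1 *: int_cV R v)%R)))%E.
Proof.
have [[al be] /= bez] := coprimezP _ _ aa'.
have a'R : a'%:R != 0 :> R by rewrite pnatr_eq0 -lt0n.
have bezR : al%:~R * a%:~R + be%:~R * a'%:R = 1 :> R.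
  by rewrite -[a'%:R]/(a'%:Z%:~R) -!intrM -intrD bez.
pose g (v : 'cV[int]_m) (y : 'cV[RR]_m) : \bar R := (((v != 0)%:R)%:E *
  (ball_ind r (a%:~R *: y + be%:~R *: int_cV R v)%R *
   ball_ind r' (a'%:R *: y - al%:~R *: int_cV R v)%R))%E.
have g0 v y : (0 <= g v y)%E by rewrite !mule_ge0 ?ball_ind_ge0 // lee_fin ler0n.
have mg v : measurable_fun setT (g v).
  by apply: measurable_funeM; apply: emeasurable_funM; exact: measurable_ball_ind_affine.
transitivity (\int[mu m 1]_(x in C m 1) (\esum_(v in [set: 'cV[int]_m])
    \esum_(u in [set: 'cV[int]_m]) g v (x - int_cV R u)%R))%E.
  apply: eq_integral => x _; rewrite esum_esum //.
  rewrite (_ : _ `*`` _ = setT); last by apply/seteqP; split => -[? ?].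
  rewrite /transverse_count (reindex_esumT
    (e := fun vu : 'cV[int]_m * 'cV[int]_m =>
       (a *: vu.2 - be *: vu.1, a'%:Z *: vu.2 + al *: vu.1))
    (e' := fun pp => (a *: pp.2 - a'%:Z *: pp.1, al *: pp.1 + be *: pp.2))).
  - apply: eq_esum => -[v u] _ /=; rewrite /g; congr (_ * (_ * _))%E.
    + rewrite -[X in _ = (X != 0)%:R%:E]scale1r -bez -subr_eq0.
      congr ((_ != 0)%:R%:E); apply/matrixP => i j; rewrite !mxE; ring.
    + congr ball_ind; rewrite /int_cV map_mxB !map_mxZ scalerBr.
      by rewrite opprB addrA addrAC.
    + congr ball_ind; rewrite /int_cV map_mxD !map_mxZ scalerBr.
      by rewrite opprD addrA.
  - move=> [v u] /=; congr pair; apply/matrixP => i j; rewrite !mxE;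
    [rewrite -[RHS]mul1r|rewrite -[RHS]mul1r]; rewrite -bez; ring.
  - move=> [p p'] /=; congr pair; apply/matrixP => i j; rewrite !mxE;
    [rewrite -[RHS]mul1r|rewrite -[RHS]mul1r]; rewrite -bez; ring.
rewrite ge0_integral_esum; last 3 first.
- move=> v; apply: measurable_esum => [u|u x] //.
  exact: (measurableT_comp (mg v) (measurable_mx_shift _)).
- by move=> v x; apply: esum_ge0.
- exact: measurable_unit_cube.
pose h (v : 'cV[int]_m) (x : 'cV[RR]_m) : \bar R :=
  (ball_ind r' (a'%:R *: x)%R * (((v != 0)%:R)%:E *
        ball_ind r (a%:~R *: x + a'%:R^-1 *: int_cV R v)%R))%E.
transitivity (\esum_(v in [set: 'cV[int]_m]) (\int[mu m 1]_x h v x)%E).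
  apply: eq_esum => v _; rewrite integral_unfoldN //.
  (* This translation centres the second ball at the origin; by Bezout the offset in the first
     becomes [v / a']. *)
  rewrite -(ge0_integral_mx_shift ((al%:~R / a'%:R) *: int_cV R v)) //.
  apply: eq_integral => x _; rewrite /g /h [RHS]muleCA [in RHS]muleC.
  rewrite [in RHS]muleC; congr (_ * _)%E; rewrite [RHS]muleC; congr (_ * _)%E.
    congr ball_ind; rewrite scalerDr scalerA -addrA -scalerDl; congr (_ + _ *: _).
    apply: (mulfI a'R); rewrite mulfV // -[RHS]bezR; field.
    by [].
  congr ball_ind; rewrite scalerDr scalerA mulrCA mulfV // mulr1.
  by rewrite addrK.
transitivity (\int[mu m 1]_x (\esum_(v in [set: 'cV[int]_m]) h v x))%E.
  rewrite (@ge0_integral_esum _ _ _ _ _ h) //.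
  - move=> v; apply: emeasurable_funM; last by apply: measurable_funeM;
      exact: measurable_ball_ind_affine.
    rewrite (_ : (fun _ => _) = (fun x : 'cV[RR]_m => ball_ind r' (a'%:R *: x + 0))).
      exact: measurable_ball_ind_affine.
    by apply/funext => x; rewrite addr0.
  - by move=> v x; rewrite !mule_ge0 ?ball_ind_ge0 // lee_fin ler0n.
apply: eq_integral => x _; rewrite /h ball_indE ge0_esumZl //.
by move=> v; rewrite mule_ge0 ?ball_ind_ge0 // lee_fin ler0n.
Qed.

Local Notation B := (unit_ball_volume R m).

(** The variable is confined to the ball of radius [r' / a'], whose volume is the first factor.
    Multiplying by [a'] turns the sum over [v] into a count of nonzero lattice points in a ball of
    radius [a' * r], with a centre of norm at most [a' * r] by [rr']. *)
Lemma integral_transverse_count_le (kappa : R) : 0 <= kappa ->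
  (forall c : 'cV[RR]_m, (enorm c <= a'%:R * r)%R ->
    \esum_(v in [set: 'cV[int]_m]) (((v != 0)%:R)%:E * ball_ind (a'%:R * r) (c + int_cV R v)%R)%E
      <= kappa%:E)%E ->
  (\int[mu m 1]_(x in C m 1) transverse_count x <= (((r' / a'%:R) ^+ m * B) * kappa)%:E)%E.
Proof.
move=> k0 hk; rewrite integral_transverse_count.
have a'R : 0 < a'%:R :> R by rewrite ltr0n.
have -> : (((r' / a'%:R) ^+ m * B) * kappa)%:E =
   (\int[mu m 1]_x (ball_ind r' (a'%:R *: x)%R * kappa%:E))%E.
  rewrite ge0_integralZr //; last 2 first.
  - rewrite (_ : (fun _ => _) = (fun x : 'cV[RR]_m => ball_ind r' (a'%:R *: x + 0))).
      exact: measurable_ball_ind_affine.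
    by apply/funext => x; rewrite addr0.
  - by move=> x _; exact: ball_ind_ge0.
  rewrite EFinM -(@integral_ball_ind R m) ?divr_gt0 //; congr (_ * _)%E.
  by apply: eq_integral => x _; rewrite ball_indZ // mulrC.
have m1 : measurable_fun setT (fun x : 'cV[RR]_m => ball_ind r' (a'%:R *: x)).
  rewrite (_ : (fun _ => _) = (fun x : 'cV[RR]_m => ball_ind r' (a'%:R *: x + 0))).
    exact: measurable_ball_ind_affine.
  by apply/funext => x; rewrite addr0.
apply: ge0_le_integral => //.
- move=> x _; rewrite mule_ge0 ?ball_ind_ge0 //; apply: esum_ge0 => v _.
  by rewrite mule_ge0 ?ball_ind_ge0 // lee_fin ler0n.
- apply: emeasurable_funM => //; apply: measurable_esum => [v|v x].
    apply: measurable_funeM; exact: measurable_ball_ind_affine.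
  by rewrite mule_ge0 ?ball_ind_ge0 // lee_fin ler0n.
- by apply: emeasurable_funM.
move=> x _; rewrite [ball_ind r' _]ball_indE; case: (leP (enorm _) r') => xr'; last by rewrite !mul0e.
rewrite !mul1e; apply: le_trans (hk (a'%:R *: (a%:~R *: x)) _); last first.
  rewrite scalerA mulrC -scalerA enormZ; apply: le_trans rr'.
  by rewrite intr_norm ler_wpM2l.
apply: le_esum => v _; rewrite lee_wpmul2l // ?lee_fin ?ler0n //.
apply: ball_ind_le => h.
have -> : a'%:R *: (a%:~R *: x) + int_cV R v = a'%:R *: (a%:~R *: x + a'%:R^-1 *: int_cV R v).
  by rewrite scalerDr; congr (_ + _); rewrite scalerA mulfV ?gt_eqF // scale1r.
by rewrite enormZ (gtr0_norm a'R) ler_wpM2l // ltW.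
Qed.

(* Two lattice points of a ball of radius less than 1/2 are equal. *)
Lemma nonzero_count_small (s : R) (c : 'cV[RR]_m) : 2 * s < 1 -> enorm c <= s ->
  (\esum_(v in [set: 'cV[int]_m]) (((v != 0)%:R)%:E * ball_ind s (c + int_cV R v)%R)%E = 0)%E.
Proof.
move=> s1 cs; apply: esum1 => v _; have [->|v0] := eqVneq v 0; first by rewrite mul0e.
rewrite mul1e ball_indE; case: leP => // h; exfalso.
have := enorm_int_ge1 R v0; rewrite -(addKr c (int_cV R v)).
move=> /le_trans/(_ (enorm_triangle _ _)); rewrite enormN; lra.
Qed.

Lemma nonzero_count_le (s : R) (c : 'cV[RR]_m) : 0 < s ->
  (\esum_(v in [set: 'cV[int]_m]) (((v != 0)%:R)%:E * ball_ind s (c + int_cV R v)%R)%E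
    <= ((s + m%:R) ^+ m * B)%:E)%E.
Proof.
move=> s0; apply: le_trans (lattice_count_le c _); last by rewrite ltr_wpDr.
apply: le_esum => v _; rewrite ball_indE -EFinM lee_fin -natrM ler_nat.
by case: (v != 0); rewrite ?mul1n ?mul0n.
Qed.

(** If [a' * r < 1 / 2] there is no nonzero [v]; otherwise the error [m] in the radius is at most
    [2 * m * (a' * r)]. *)
Lemma integral_transverse_count_le_prod :
  (\int[mu m 1]_(x in C m 1) transverse_count x <=
    (B ^+ 2 * (1 + 2 * m%:R) ^+ m * (r ^+ m * r' ^+ m))%:E)%E.
Proof.
have a'R : 0 < a'%:R :> R by rewrite ltr0n.
have B0 : 0 < B := unit_ball_volume_gt0 R m.
have [s1|s1] := ltP (2 * (a'%:R * r)) 1.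
  apply: le_trans (integral_transverse_count_le (kappa := 0) _ _) _ => //.
    by move=> c cr; rewrite nonzero_count_small.
  by rewrite mulr0 lee_fin !mulr_ge0 ?exprn_ge0 ?addr_ge0 ?mulr_ge0 // ltW.
apply: le_trans (integral_transverse_count_le (kappa := ((1 + 2 * m%:R) * (a'%:R * r)) ^+ m * B) _ _) _.
- by rewrite !(mulr_ge0, exprn_ge0, addr_ge0) // ltW.
- move=> c _; apply: le_trans (nonzero_count_le c _) _; first by rewrite mulr_gt0.
  rewrite lee_fin ler_wpM2r ?(ltW B0) // lerXn2r ?nnegrE ?addr_ge0 ?mulr_ge0 ?addr_ge0 ?mulr_ge0 ?(ltW r0) //.
  have := ler0n R m; nra.
rewrite lee_fin le_eqVlt; apply/orP; left; apply/eqP; rewrite !exprMn exprVn.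
by field; rewrite expf_neq0 // gt_eqF.
Qed.

(** Same dichotomy, but the leading term of the lattice count keeps its exact coefficient and yields
    the product of the means; the remainder gains a factor [1 / a']. *)
Lemma integral_transverse_count_le_cov : (0 < m)%N ->
  (\int[mu m 1]_(x in C m 1) transverse_count x <=
    ((r ^+ m * B) * (r' ^+ m * B) +
     B ^+ 2 * (m%:R ^+ 2 * (1 + 2 * m%:R) ^+ m.-1) * (r ^+ m.-1 * r' ^+ m / a'%:R))%:E)%E.
Proof.
move=> m0; have a'R : 0 < a'%:R :> R by rewrite ltr0n.
have B0 : 0 < B := unit_ball_volume_gt0 R m.
have [s1|s1] := ltP (2 * (a'%:R * r)) 1.
  apply: le_trans (integral_transverse_count_le (kappa := 0) _ _) _ => //.
    by move=> c cr; rewrite nonzero_count_small.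
  rewrite mulr0 lee_fin addr_ge0 ?mulr_ge0 ?invr_ge0 ?exprn_ge0 ?addr_ge0 ?mulr_ge0 //;
  by rewrite ?(ltW r0) ?(ltW r'0) ?(ltW B0).
set s := a'%:R * r in s1 *.
have s0 : 0 < s by rewrite mulr_gt0.
pose K := m%:R ^+ 2 * (1 + 2 * m%:R) ^+ m.-1 : R.
have K0 : 0 <= K by rewrite !(mulr_ge0, exprn_ge0, addr_ge0).
have sK := shifted_powerX_le m0 s0 s1.
apply: le_trans (integral_transverse_count_le (kappa := (s ^+ m + K * s ^+ m.-1) * B) _ _) _.
- by rewrite !(mulr_ge0, addr_ge0, exprn_ge0) // ltW.
- move=> c _; apply: le_trans (nonzero_count_le c s0) _.
  by rewrite lee_fin ler_wpM2r // ltW.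
rewrite lee_fin le_eqVlt; apply/orP; left; apply/eqP; rewrite -/K /s.
rewrite !exprMn exprVn -(prednK m0) /= !exprS.
by field; rewrite expf_neq0 gt_eqF.
Qed.

End parallel.

(** * Truncation to pairs without a large common divisor *)

Section truncated.
Variable R : realType.
Local Notation RR := (measurableTypeR R).
Local Notation mu m n := (lebesgue_mx R m n).
Local Notation C m n := (@unit_cube R m n).

Definition dvd_cV k (d : nat) (z : 'cV[int]_k) := [forall i, (d %| z i 0%R)%Z].

(** Unless [p] and [q] both vanish, this says that the gcd of all their entries is at most [D]. *)
Definition no_large_gcd m n (D : nat) (p : 'cV[int]_m) (q : 'cV[int]_n) : bool :=
  `[< forall d : nat, (D < d)%N -> ~~ (dvd_cV d p && dvd_cV d q) >].

Definition truncated_count m n (D : nat) (r : R) (q : 'cV[int]_n) (A : 'M[RR]_(m, n)) : \bar R :=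
  \esum_(p in [set: 'cV[int]_m])
    (((no_large_gcd D p q)%:R)%:E * ball_ind r (A *m int_cV R q - int_cV R p)%R)%E.

Lemma truncated_count_ge0 m n D r (q : 'cV[int]_n) (A : 'M[RR]_(m, n)) :
  (0 <= truncated_count D r q A)%E.
Proof. by apply: esum_ge0 => p _; rewrite mule_ge0 ?ball_ind_ge0 // lee_fin ler0n. Qed.

Lemma measurable_truncated_count m n D r (q : 'cV[int]_n) :
  measurable_fun setT (@truncated_count m n D r q).
Proof.
apply: measurable_esum => [p|p x]; last by rewrite mule_ge0 ?ball_ind_ge0 // lee_fin ler0n.
apply: measurable_funeM.
apply: (measurableT_comp (@measurable_ball_ind R m r)).
exact: (measurableT_comp (measurable_mx_shift _) (@measurable_mulmx_cst R m n (int_cV R q))).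
Qed.

Lemma truncated_count_le m n D r (q : 'cV[int]_n) (A : 'M[RR]_(m, n)) :
  (truncated_count D r q A <= ball_count r (A *m int_cV R q))%E.
Proof.
apply: le_esum => p _; rewrite -[leRHS]mul1e lee_wpmul2r ?ball_ind_ge0 //.
by rewrite lee_fin lern1 leq_b1.
Qed.

Lemma ball_count_le m r (x : 'cV[RR]_m) : 0 < r ->
  (ball_count r x <= ((r + m%:R) ^+ m * unit_ball_volume R m)%:E)%E.
Proof.
move=> r0; rewrite /ball_count (reindex_esumT (e := -%R) (e' := -%R)); [|exact: opprK|exact: opprK].
under eq_esum => p _ do rewrite /int_cV raddfN opprK.
by apply: lattice_count_le; rewrite ltr_wpDr.
Qed.

(** The bound [M] makes the second sum a real scalar, which distributes over the first sum even if
    that is infinite. *)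
Lemma esum_mul_pair (J K : countType) (f : J -> R) (g : K -> \bar R) (M : R) :
  (forall j, 0 <= f j) -> (forall k, 0 <= g k)%E ->
  (\esum_(k in [set: K]) g k <= M%:E)%E ->
  ((\esum_(j in [set: J]) (f j)%:E) * (\esum_(k in [set: K]) g k) =
   \esum_(jk in [set: J * K]) ((f jk.1)%:E * g jk.2))%E.
Proof.
move=> f0 g0 gM; have X0 : (0 <= \esum_(k in [set: K]) g k)%E by exact: esum_ge0.
have Xfin : (\esum_(k in [set: K]) g k)%E \is a fin_num.
  by rewrite ge0_fin_numE // (le_lt_trans gM) // ltry.
rewrite muleC -(fineK Xfin) -ge0_esumZl; last 2 first.
- by move=> j; rewrite lee_fin.
- exact: fine_ge0.
rewrite fineK //.
transitivity (\esum_(j in [set: J]) \esum_(k in [set: K]) ((f j)%:E * g k))%E.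
  by apply: eq_esum => j _; rewrite muleC ge0_esumZl.
rewrite esum_esum; last by move=> j k _ _; rewrite mule_ge0 // lee_fin.
by congr (esum _ _); apply/seteqP; split => -[? ?].
Qed.

(** Pairs with [a p' <> a' p] are the transverse ones. For the others, coprimality gives
    [(p, p') = (a p0, a' p0)]; then [a'] divides both [p'] and [a' w], so truncation leaves none
    unless [a' <= D], and those left correspond to points [p0] within [r' / a'] of [A w]. *)
Lemma truncated_product_le m n D r r' (w : 'cV[int]_n) (a : int) (a' : nat) (A : 'M[RR]_(m, n)) :
  (0 < a')%N -> coprimez a a' -> 0 < r -> 0 < r' ->
  (truncated_count D r (a *: w) A * truncated_count D r' (a'%:Z *: w) A <=
   transverse_count a a' r r' (A *m int_cV R w) +
   (((a' <= D)%N%:R)%:E * ball_count (r' / a'%:R) (A *m int_cV R w)%R))%E.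
Proof.
move=> a'0 aa' r0 r'0; set X := A *m int_cV R w.
have aX (c : int) : A *m int_cV R (c *: w) = c%:~R *: X.
  by rewrite /int_cV map_mxZ -scalemxAr.
have a'X : A *m int_cV R (a'%:Z *: w) = a'%:R *: X by exact: aX.
have a'R : 0 < a'%:R :> R by rewrite ltr0n.
have bi r1 (x : 'cV[RR]_m) : ball_ind r1 x = ((enorm x <= r1)%R%:R)%:E by exact: ball_indE.
pose f (p : 'cV[int]_m) : R := (no_large_gcd D p (a *: w))%:R *
   (enorm (A *m int_cV R (a *: w) - int_cV R p) <= r)%R%:R.
have -> : truncated_count D r (a *: w) A = \esum_(p in [set: 'cV[int]_m]) (f p)%:E.
  by apply: eq_esum => p _; rewrite bi -EFinM.
rewrite /truncated_count (esum_mul_pair (M := ((r' + m%:R) ^+ m * unit_ball_volume R m))); last 3 first.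
- by move=> p; rewrite mulr_ge0 ?ler0n.
- by move=> p; rewrite mule_ge0 ?ball_ind_ge0 // lee_fin ler0n.
- exact: le_trans (truncated_count_le _ _ _ _) (ball_count_le _ r'0).
(* For non-transverse pairs, only the conditions on [p'] are retained. *)
pose h (pp : 'cV[int]_m * 'cV[int]_m) : \bar R :=
  (((a *: pp.2 == a'%:Z *: pp.1) && no_large_gcd D pp.2 (a'%:Z *: w))%:R%:E *
   ball_ind r' (a'%:R *: X - int_cV R pp.2)%R)%E.
have h0 pp : (0 <= h pp)%E by rewrite mule_ge0 ?ball_ind_ge0 // lee_fin ler0n.
apply: (@le_trans _ _ (transverse_count a a' r r' X + \esum_(pp in setT) h pp)%E).
  rewrite /transverse_count -esumD //; last first.
    by move=> pp _; rewrite !mule_ge0 ?ball_ind_ge0 // lee_fin ler0n.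
  apply: le_esum => -[p p'] _; rewrite /h /f /= a'X aX !bi -!EFinM -EFinD lee_fin.
  rewrite -!natrM -natrD ler_nat.
  do 2 case: no_large_gcd; do 2 case: (enorm _ <= _)%R; case: (a *: p' == _) => //=.
rewrite leeD2l //.
pose e (p : 'cV[int]_m) : 'cV[int]_m * 'cV[int]_m := (a *: p, a'%:Z *: p).
have a'Z : a'%:Z != 0 by rewrite eqz_nat -lt0n.
have ei : injective e.
  move=> p p' [_ /matrixP E]; apply/matrixP => i j; have := E i j; rewrite !mxE.
  exact: mulfI.
have supp pp : h pp != 0%E -> range e pp.
  case: pp => p p'; rewrite /h /=; have [E _|_] := eqVneq (a *: p') (a'%:Z *: p); last by rewrite mul0e eqxx.
  have Ei i : a * p' i 0 = a'%:Z * p i 0 by have /matrixP/(_ i 0) := E; rewrite !mxE.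
  have d i : (a'%:Z %| p' i 0%R)%Z.
    by rewrite -(@Gauss_dvdzr _ a) ?Ei ?dvdz_mulr // coprimez_sym.
  pose p0 : 'cV[int]_m := \col_i (p' i 0%R %/ a'%:Z)%Z.
  have p'E i : p' i 0 = a'%:Z * p0 i 0 by rewrite mxE mulrC divzK.
  exists p0 => //; rewrite /e; congr pair; apply/matrixP => i j; rewrite ord1 [LHS]mxE.
    by apply: (mulfI a'Z); rewrite mulrCA -p'E Ei.
  by rewrite -p'E.
have -> : \esum_(pp in setT) h pp = \esum_(p in setT) h (e p).
  rewrite -(esum_image setT e h); last by move=> p p' _ _ /ei.
  rewrite [RHS]esum_mkcond; apply: eq_esum => pp _; case: ifPn => // /negP ppe.
  by apply/eqP; apply: contra_notT ppe => /supp; rewrite inE.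
rewrite /ball_count -ge0_esumZl ?ler0n //; last by move=> p; exact: ball_ind_ge0.
apply: le_esum => p _; rewrite /h /= !bi -!EFinM lee_fin -!natrM ler_nat.
have -> : a'%:R *: X - int_cV R (a'%:Z *: p) = a'%:R *: (X - int_cV R p).
  by rewrite /int_cV map_mxZ scalerBr.
rewrite enormZ (gtr0_norm a'R) ler_pdivlMr // [_ * a'%:R]mulrC.
apply: leq_mul => //; case: (leqP a' D) => [_|Da']; first exact: leq_b1.
rewrite (_ : no_large_gcd _ _ _ = false) ?andbF //.
apply/negbTE/asboolPn => /(_ _ Da') /negP; apply.
by apply/andP; split; apply/forallP => i; rewrite mxE dvdz_mulr.
Qed.

Lemma integral_truncated_product_le m n D r r' (w : 'cV[int]_n) (a : int) (a' : nat) :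
  (0 < a')%N -> coprimez a a' -> 0 < r -> 0 < r' -> w != 0 ->
  (\int[mu m n]_(A in C m n) (truncated_count D r (a *: w) A * truncated_count D r' (a'%:Z *: w) A)
   <= \int[mu m 1]_(x in C m 1) transverse_count a a' r r' x +
   ((a' <= D)%N%:R * ((r' / a'%:R) ^+ m * unit_ball_volume R m))%:E)%E.
Proof.
move=> a'0 aa' r0 r'0 w0.
have a'R : 0 < a'%:R :> R by rewrite ltr0n.
have mt := @measurable_transverse_count R m a a' r r'.
have t0 := @transverse_count_ge0 R m a a' r r'.
have mX := @measurable_mulmx_cst R m n (int_cV R w).
rewrite EFinM -(@integral_ball_count R m) ?divr_gt0 //.
rewrite -(equidistribution1 mt t0 (transverse_count_periodic _ _ _ _) w0).
rewrite -(equidistribution1 (@measurable_ball_count R m _) (@ball_count_ge0 R m _) (@ball_count_periodic R m _) w0).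
rewrite -ge0_integralZl //; last 3 first.
- exact: measurable_unit_cube.
- apply: measurable_funTS; exact: (measurableT_comp (@measurable_ball_count R m _) mX).
- by move=> A _; exact: ball_count_ge0.
rewrite -ge0_integralD //; last 4 first.
- exact: measurable_unit_cube.
- apply: measurable_funTS; exact: (measurableT_comp mt mX).
- by move=> A _; rewrite mule_ge0 ?ball_count_ge0 // lee_fin ler0n.
- apply: measurable_funTS; apply: measurable_funeM; exact: (measurableT_comp (@measurable_ball_count R m _) mX).
apply: ge0_le_integral.
- exact: measurable_unit_cube.
- by move=> A _; rewrite mule_ge0 // truncated_count_ge0.
- apply: measurable_funTS; apply: emeasurable_funM; exact: measurable_truncated_count.
- apply: measurable_funTS; apply: emeasurable_funD; first exact: (measurableT_comp mt mX).
  apply: measurable_funeM; exact: (measurableT_comp (@measurable_ball_count R m _) mX).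
by move=> A _; exact: truncated_product_le.
Qed.

End truncated.

(** At a coordinate where [q'] is nonzero, reduce [q i / q' i] to lowest terms [x / y] with [y > 0].
    By proportionality the same fraction serves every coordinate, so [y] divides [q'] and
    [w = q' / y]. Comparing norms gives [|x| <= y]. *)
Lemma parallel_param k (R : realType) (q q' : 'cV[int]_k) : q != 0 -> q' != 0 ->
  (forall i j, q i 0 * q' j 0 = q j 0 * q' i 0) -> enorm (int_cV R q) <= enorm (int_cV R q') ->
  exists (w : 'cV[int]_k) (a : int) (a' : nat),
    [/\ w != 0, (0 < `|a|%N <= a')%N, coprimez a a', q = a *: w & q' = a'%:Z *: w].
Proof.
move=> q0 q'0 par qq'.
have [i q'i] := cV_neq0 q'0.
have [x [y [g [xE yE g0 xy y0]]]] : exists x y g : int,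
    [/\ q i 0 = x * g, q' i 0 = y * g, g != 0, coprimez x y & 0 < y].
  pose g := gcdz (q i 0) (q' i 0).
  have g0 : g != 0 by rewrite gcdz_eq0 negb_and q'i orbT.
  pose x := (q i 0%R %/ g)%Z; pose y := (q' i 0%R %/ g)%Z.
  have xE : q i 0 = x * g by rewrite divzK // dvdz_gcdl.
  have yE : q' i 0 = y * g by rewrite divzK // dvdz_gcdr.
  have y0 : y != 0 by apply: contraNneq q'i => y0; rewrite yE y0 mul0r.
  have xy : coprimez x y.
    have gg : gcdz x y * g = g.
      by rewrite -[X in _ * X]gez0_abs // mulz_gcdl -xE -yE.
    by apply/eqP; apply: (mulIf g0); rewrite mul1r.
  case: (ltrP 0 y) => [y1|y1]; first by exists x, y, g.
  exists (- x), (- y), (- g); split; rewrite ?mulrNN ?oppr_eq0 ?oppr_gt0 //.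
    by rewrite coprimezN coprimeNz.
  by rewrite lt_neqAle y0.
have E j : x * q' j 0 = y * q j 0.
  by apply: (mulIf g0); rewrite mulrAC -xE par yE; ring.
have y0' : y != 0 by rewrite gt_eqF.
have d j : (y %| q' j 0%R)%Z.
  by rewrite -(@Gauss_dvdzr _ x) ?E ?dvdz_mulr // coprimez_sym.
pose v : 'cV[int]_k := \col_j (q' j 0%R %/ y)%Z.
have q'E j : q' j 0 = y * v j 0 by rewrite mxE mulrC divzK.
have qE j : q j 0 = x * v j 0 by apply: (mulfI y0'); rewrite -E q'E mulrCA.
have yS : `|y|%N%:Z = y by rewrite gtz0_abs.
have eq1 : q = x *: v by apply/matrixP => j l; rewrite ord1 [RHS]mxE qE.
have eq2 : q' = `|y|%N%:Z *: v by rewrite yS; apply/matrixP => j l; rewrite ord1 [RHS]mxE q'E.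
have w0 : v != 0 by apply: contraNneq q'0 => w0; rewrite eq2 w0 scaler0.
exists v, x, `|y|%N; split => //.
apply/andP; split.
  by rewrite absz_gt0; apply: contraNneq q0 => x0; rewrite eq1 x0 scale0r.
have nw : 0 < enorm (int_cV R v) by apply: lt_le_trans (enorm_int_ge1 R w0).
move: qq'; rewrite eq1 eq2 /int_cV !map_mxZ !enormZ ler_pM2r //.
by rewrite -!intr_norm ler_int -!abszE lez_nat absz_nat.
Qed.

Section radius.
Variables (R : realType) (m n : nat) (b : R).
Hypotheses (m0 : (0 < m)%N) (n0 : (0 < n)%N) (b0 : 0 < b).
Local Notation nrm q := (enorm (int_cV R q)).

Definition radius (q : 'cV[int]_n) : R := b * nrm q `^ (- (n%:R / m%:R)).

Lemma enorm_int_gt0 (q : 'cV[int]_n) : q != 0 -> 0 < nrm q.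
Proof. by move=> q0; exact: lt_le_trans (enorm_int_ge1 R q0). Qed.

Lemma radius_gt0 q : q != 0 -> 0 < radius q.
Proof. by move=> q0; rewrite mulr_gt0 // powR_gt0 // enorm_int_gt0. Qed.

Lemma radiusX q : radius q ^+ m = b ^+ m * nrm q ^- n.
Proof.
rewrite exprMn -[X in _ * X]powR_mulrn ?powR_ge0 // -powRrM mulNr divfK; last first.
  by rewrite pnatr_eq0 -lt0n.
by rewrite powRN powR_mulrn ?enorm_ge0.
Qed.

Lemma radius_le q q' : q != 0 -> nrm q <= nrm q' -> radius q' <= radius q.
Proof.
move=> q0 qq'; have nq := enorm_int_gt0 q0.
rewrite ler_wpM2l ?(ltW b0) // !powRN lef_pV2 ?posrE ?powR_gt0 //; last exact: lt_le_trans qq'.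
by rewrite ge0_ler_powR ?nnegrE ?divr_ge0 ?enorm_ge0.
Qed.

Lemma radius_le_cst q : q != 0 -> radius q <= b.
Proof.
move=> q0; rewrite -[leRHS]mulr1 ler_wpM2l ?(ltW b0) // powRN invf_le1 ?powR_gt0 ?enorm_int_gt0 //.
have {1}<- : 1 `^ (n%:R / m%:R) = 1 :> R by rewrite powR1.
rewrite ge0_ler_powR ?nnegrE ?divr_ge0 ?enorm_ge0 //.
exact: enorm_int_ge1.
Qed.

End radius.

(** * Second moment of the truncated count *)

Section second_moment.
Variables (R : realType) (m n : nat) (b : R).
Hypotheses (m0 : (0 < m)%N) (n0 : (0 < n)%N) (b0 : 0 < b).
Local Notation RR := (measurableTypeR R).
Local Notation mu m n := (lebesgue_mx R m n).
Local Notation C m n := (@unit_cube R m n).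
Local Notation nrm q := (enorm (int_cV R q)).
Local Notation Q K := (fset_set (@punctured_ball R n K%:R)).
Local Notation B := (unit_ball_volume R m).
Local Notation rad := (radius m b).

Definition mean_factor : R := b ^+ m * B.
Local Notation beta := mean_factor.

Lemma mean_factor_gt0 : 0 < beta.
Proof. by rewrite mulr_gt0 ?exprn_gt0 // unit_ball_volume_gt0. Qed.

Lemma radiusX_ball (q : 'cV[int]_n) : rad q ^+ m * B = beta * nrm q ^- n.
Proof. by rewrite radiusX // mulrAC. Qed.

Definition cov_error_cst : R := B ^+ 2 * (m%:R ^+ 2 * (1 + 2 * m%:R) ^+ m.-1) * (b ^+ m.-1 * b ^+ m).
Definition prod_error_cst : R := B ^+ 2 * (1 + 2 * m%:R) ^+ m * (b ^+ m * b ^+ m).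

(** Three contributions: multiples of a common approximation ([beta]), the excess over the product
    of the means for [nrm w < W], and the whole transverse count for [nrm w >= W], where one factor
    [nrm w ^- n] has been replaced by [1 / W]. *)
Definition pair_error (D W : nat) (w : 'cV[int]_n) (a0 a' : nat) : R :=
  nrm w ^- n * (((a' <= D)%N%:R * beta + (nrm w < W%:R)%R%:R * cov_error_cst) * a'%:R ^- 2
    + (W%:R <= nrm w)%R%:R * (prod_error_cst / W%:R * (a0%:R^-1 * a'%:R^-1))).

Lemma cov_error_cst_ge0 : 0 <= cov_error_cst.
Proof. by rewrite /cov_error_cst !(mulr_ge0, exprn_ge0, addr_ge0) // ltW // unit_ball_volume_gt0. Qed.

Lemma prod_error_cst_ge0 : 0 <= prod_error_cst.
Proof. by rewrite /prod_error_cst !(mulr_ge0, exprn_ge0, addr_ge0) // ltW // unit_ball_volume_gt0. Qed.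

Lemma pair_error_ge0 D W w a0 a' : 0 <= pair_error D W w a0 a'.
Proof.
have beta0 := ltW mean_factor_gt0.
rewrite /pair_error; apply: mulr_ge0; first by rewrite invr_ge0 exprn_ge0 // enorm_ge0.
apply: addr_ge0.
  apply: mulr_ge0; last by rewrite invr_ge0 exprn_ge0.
  by apply: addr_ge0; apply: mulr_ge0 => //; exact: cov_error_cst_ge0.
apply: mulr_ge0 => //; apply: mulr_ge0; first by rewrite divr_ge0 // prod_error_cst_ge0.
by rewrite mulr_ge0 // invr_ge0.
Qed.

Let inv_le1 (k : nat) : (0 < k)%N -> (k%:R^-1 : R) <= 1.
Proof. by move=> k0; rewrite invf_le1 ?ltr0n // ler1n. Qed.

Let invX_le (k i : nat) : (0 < k)%N -> (0 < i)%N -> (k%:R ^- i : R) <= k%:R^-1.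
Proof.
move=> k0 i0; rewrite -exprVn -[leRHS]expr1; apply: ler_wiXn2l => //.
by rewrite inv_le1.
Qed.

Lemma integral_parallel_product_le D W (q q' w : 'cV[int]_n) (a : int) (a' : nat) :
  (0 < W)%N -> w != 0 -> (0 < `|a|%N <= a')%N -> coprimez a a' ->
  q = a *: w -> q' = a'%:Z *: w ->
  (\int[mu m n]_(A in C m n) (truncated_count D (rad q) q A * truncated_count D (rad q') q' A)
    <= ((beta * nrm q ^- n) * (beta * nrm q' ^- n) + pair_error D W w `|a|%N a')%:E)%E.
Proof.
move=> W0 w0 /andP[a0 aa'] cop qE q'E.
have a'0 : (0 < a')%N by exact: leq_trans aa'.
have a'R : 0 < a'%:R :> R by rewrite ltr0n.
have aR : 0 < `|a|%N%:R :> R by rewrite ltr0n.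
have nw1 : 1 <= nrm w by exact: enorm_int_ge1.
have nw0 : 0 < nrm w by exact: lt_le_trans nw1.
have aZ : a != 0 by rewrite -absz_gt0.
have nq : nrm q = `|a|%N%:R * nrm w.
  by rewrite qE /int_cV map_mxZ enormZ -intr_norm -abszE.
have nq' : nrm q' = a'%:R * nrm w.
  by rewrite q'E /int_cV map_mxZ enormZ ger0_norm.
have q0 : q != 0.
  by apply: contraTneq (mulr_gt0 aR nw0) => q0; rewrite -nq q0 /int_cV map_mx0 enorm0 ltxx.
have q'0 : q' != 0.
  by apply: contraTneq (mulr_gt0 a'R nw0) => q'0; rewrite -nq' q'0 /int_cV map_mx0 enorm0 ltxx.
have r0 := radius_gt0 m b0 q0.
have r'0 := radius_gt0 m b0 q'0.
have rr : rad q' <= rad q.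
  by apply: radius_le => //; rewrite nq nq' ler_wpM2r ?enorm_ge0 // ler_nat.
have rb : rad q <= b by exact: radius_le_cst.
have rr' : `|a|%:~R * rad q' <= a'%:R * rad q.
  by rewrite -abszE ler_pM ?ler0n ?(ltW r'0) // ler_nat.
have B0 : 0 < B := unit_ball_volume_gt0 R m.
have beta0 := mean_factor_gt0.
have := @integral_truncated_product_le R m n D _ _ w a a' a'0 cop r0 r'0 w0.
rewrite -qE -q'E => /le_trans; apply.
(* Since [m] and [n] are positive, [a' ^- n * a' ^- m <= a' ^- 2]. *)
have diag : (a' <= D)%N%:R * ((rad q' / a'%:R) ^+ m * B) <=
    nrm w ^- n * ((a' <= D)%N%:R * beta * a'%:R ^- 2).
  rewrite expr_div_n mulrAC radiusX_ball nq' exprMn invfM.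
  have -> : (a' <= D)%N%:R * (beta * (a'%:R ^- n / nrm w ^+ n) / a'%:R ^+ m) =
     nrm w ^- n * ((a' <= D)%N%:R * beta * (a'%:R ^- n * a'%:R ^- m)) by ring.
  rewrite ler_wpM2l ?invr_ge0 ?exprn_ge0 ?(ltW nw0) //.
  apply: ler_wpM2l; first by apply: mulr_ge0 => //; exact: ltW.
  rewrite [X in _ <= X^-1]expr2 invfM.
  apply: ler_pM; rewrite ?invr_ge0 ?exprn_ge0 //.
    exact: invX_le.
  exact: invX_le.
have covE : (rad q ^+ m * B) * (rad q' ^+ m * B) = (beta * nrm q ^- n) * (beta * nrm q' ^- n).
  by rewrite !radiusX_ball.
have cov0 : 0 <= (beta * nrm q ^- n) * (beta * nrm q' ^- n).
  have h x : 0 <= beta * nrm x ^- n.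
    by apply: mulr_ge0; [exact: ltW|rewrite invr_ge0 exprn_ge0 // enorm_ge0].
  exact: mulr_ge0.
(* Short [w]: the product of the means must appear with coefficient 1. Long [w]: a multiple of it is
   affordable. *)
have [wW|wW'] := boolP (nrm w < W%:R).
  apply: (@le_trans _ _ (((beta * nrm q ^- n) * (beta * nrm q' ^- n) +
      nrm w ^- n * (cov_error_cst * a'%:R ^- 2))%:E +
      (nrm w ^- n * ((a' <= D)%N%:R * beta * a'%:R ^- 2))%:E)%E).
    rewrite leeD ?lee_fin //.
    apply: le_trans (integral_transverse_count_le_cov a'0 cop r0 r'0 rr' m0) _.
    rewrite covE lee_fin lerD2l /cov_error_cst.
    set k1 : R := B ^+ 2 * _; have k10 : 0 <= k1.
      by rewrite /k1 !(mulr_ge0, exprn_ge0, addr_ge0) // ltW.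
    apply: (@le_trans _ _ (k1 * (b ^+ m.-1 * (b ^+ m * (a'%:R^-1 * nrm w ^- n)) / a'%:R))).
      apply: ler_wpM2l => //; apply: ler_wpM2r; first by rewrite invr_ge0.
      apply: ler_pM; rewrite ?exprn_ge0 ?(ltW r0) ?(ltW r'0) //.
        by rewrite lerXn2r ?nnegrE ?(ltW r0) ?(ltW b0).
      rewrite radiusX // ler_wpM2l ?exprn_ge0 ?(ltW b0) // nq' exprMn invfM.
      by rewrite ler_wpM2r ?invr_ge0 ?exprn_ge0 ?(ltW nw0) // invX_le.
    by rewrite le_eqVlt; apply/orP; left; apply/eqP; rewrite expr2 invfM; ring.
  rewrite -EFinD lee_fin /pair_error [W%:R <= _]leNgt wW mul0r addr0 -addrA lerD2l -mulrDr.
  by rewrite mul1r -mulrDl [cov_error_cst + _]addrC.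
have wW : W%:R <= nrm w by rewrite leNgt.
apply: (@le_trans _ _ ((nrm w ^- n * (prod_error_cst / W%:R * (`|a|%N%:R^-1 * a'%:R^-1)))%:E +
      (nrm w ^- n * ((a' <= D)%N%:R * beta * a'%:R ^- 2))%:E)%E).
  rewrite leeD ?lee_fin //.
  apply: le_trans (integral_transverse_count_le_prod m a'0 cop r0 r'0 rr') _.
  rewrite lee_fin !radiusX // nq nq' /prod_error_cst.
  set k2 : R := B ^+ 2 * _; have k20 : 0 <= k2.
    by rewrite /k2 !(mulr_ge0, exprn_ge0, addr_ge0) // ltW.
  have wn : nrm w ^- n <= W%:R^-1.
    rewrite lef_pV2 ?posrE ?exprn_gt0 ?ltr0n //; apply: (le_trans wW).
    by rewrite -[leLHS]expr1 ler_weXn2l.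
  have e1 (x : R) : (x * nrm w) ^- n = x ^- n * nrm w ^- n by rewrite exprMn invfM.
  rewrite !e1.
  apply: (@le_trans _ _ (k2 * (b ^+ m * b ^+ m) * ((`|a|%N%:R^-1 * a'%:R^-1) * (nrm w ^- n * W%:R^-1)))).
    rewrite (_ : b ^+ m * (_ * _) * _ = (b ^+ m * b ^+ m) *
      ((`|a|%N%:R ^- n * a'%:R ^- n) * (nrm w ^- n * nrm w ^- n))); last by ring.
    rewrite -[leRHS]mulrA; apply: ler_wpM2l => //; apply: ler_wpM2l; first by rewrite mulr_ge0 ?exprn_ge0 ?(ltW b0).
    have i0 (x : R) : 0 < x -> 0 <= x ^- n by move=> x0; rewrite invr_ge0 exprn_ge0 // ltW.
    apply: ler_pM; [by rewrite mulr_ge0 ?i0|by rewrite mulr_ge0 ?i0| |].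
      by apply: ler_pM; rewrite ?i0 ?invX_le.
    by apply: ler_wpM2l; rewrite ?i0.
  by rewrite le_eqVlt; apply/orP; left; apply/eqP; ring.
rewrite -EFinD lee_fin /pair_error wW (negbTE wW') mul0r addr0 mul1r.
(* For long [w] the product of the means is slack: the error term alone bounds the integral. *)
rewrite -[leLHS]add0r lerD // -mulrDr addrC.
by [].
Qed.

Section sum_matched.
Variables (U : eqType) (V : Type) (J : finType) (Qs : seq U) (ws : seq V).
Variables (X Y : V -> J -> U) (e : V -> J -> R).

Lemma sum_eq_le1 (x : U) : uniq Qs -> \sum_(q <- Qs) (q == x)%:R <= 1 :> R.
Proof.
move=> uQ; have -> : \sum_(q <- Qs) (q == x)%:R = (count_mem x Qs)%:R :> R.
  by elim: Qs {uQ} => [|h t IH]; rewrite ?big_nil // big_cons /= natrD IH.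
by rewrite count_uniq_mem // lern1 leq_b1.
Qed.

(** Each [(w, j)] matches at most one pair [(q, q')] of distinct-entry lists, so exchanging the sums
    leaves at most one copy of [e w j]. *)
Lemma sum_matched_le : uniq Qs -> (forall w j, 0 <= e w j) ->
  \sum_(q <- Qs) \sum_(q' <- Qs) \sum_(w <- ws) \sum_j
     ((q == X w j)%:R * (q' == Y w j)%:R * e w j) <= \sum_(w <- ws) \sum_j e w j.
Proof.
move=> uQ e0.
under eq_bigr do rewrite exchange_big /=.
rewrite exchange_big /=; apply: ler_sum => w _.
under eq_bigr do rewrite exchange_big /=.
rewrite exchange_big /=; apply: ler_sum => j _.
under eq_bigr do rewrite -mulr_suml -mulr_sumr.
rewrite -!mulr_suml -[leRHS]mul1r ler_wpM2r // -[leRHS]mul1r.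
by rewrite ler_pM ?sumr_ge0 // ?sum_eq_le1.
Qed.

End sum_matched.

(** The index [j] encodes [a'], then [|a|], then whether [a] is negative. *)
Definition pair_index_error D W K (w : 'cV[int]_n) (j : 'I_K * 'I_K * bool) : R :=
  (0 < j.1.2 <= j.1.1)%N%:R * pair_error D W w j.1.2 j.1.1.

(** Summing over all candidate parametrizations, instead of choosing one for each pair, allows the
    sums over [(q, q')] and over [(w, j)] to be exchanged. *)
Definition matched_error D W K (q q' : 'cV[int]_n) : R :=
  \sum_(w <- Q K) \sum_(j : 'I_K * 'I_K * bool)
    ((q == ((-1) ^+ j.2 * (j.1.2 : nat)%:Z) *: w)%:R * (q' == (j.1.1 : nat)%:Z *: w)%:R *
      pair_index_error D W w j).

Lemma pair_index_error_ge0 D W K w (j : 'I_K * 'I_K * bool) : 0 <= pair_index_error D W w j.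
Proof. by rewrite mulr_ge0 // pair_error_ge0. Qed.

Let term_ge0 D W K (q q' w : 'cV[int]_n) (j : 'I_K * 'I_K * bool) :
  0 <= (q == ((-1) ^+ j.2 * (j.1.2 : nat)%:Z) *: w)%:R * (q' == (j.1.1 : nat)%:Z *: w)%:R *
      pair_index_error D W w j.
Proof. by rewrite mulr_ge0 ?pair_index_error_ge0 // mulr_ge0. Qed.

Lemma matched_error_ge0 D W K q q' : 0 <= matched_error D W K q q'.
Proof. by apply: sumr_ge0 => w _; apply: sumr_ge0 => j _; exact: term_ge0. Qed.

Lemma matched_error_ge D W K (q q' : 'cV[int]_n) w a a' : q' \in Q K ->
  w != 0 -> (0 < `|a|%N <= a')%N -> q = a *: w -> q' = a'%:Z *: w ->
  pair_error D W w `|a|%N a' <= matched_error D W K q q'.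
Proof.
rewrite in_punctured_ball => /andP[_ q'K] w0 /andP[a0 aa'] qE q'E.
have a'0 : (0 < a')%N by exact: leq_trans aa'.
have nw1 : 1 <= nrm w by exact: enorm_int_ge1.
have nq' : nrm q' = a'%:R * nrm w by rewrite q'E /int_cV map_mxZ enormZ ger0_norm.
have wQ : w \in Q K.
  rewrite in_punctured_ball nw1 /= (le_lt_trans _ q'K) // nq' ler_peMl ?enorm_ge0 //.
  by rewrite ler1n.
have a'K : (a' < K)%N.
  by rewrite -(ltr_nat R) (le_lt_trans _ q'K) // nq' ler_peMr.
have aK : (`|a| < K)%N by exact: leq_ltn_trans a'K.
pose j := (Ordinal a'K, Ordinal aK, (a < 0)%R).
rewrite /matched_error (bigD1_seq w) //=; last exact: fset_uniq.
rewrite (bigD1 j) //= -[leLHS]addr0 -addrA lerD //.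
  rewrite -intEsign -qE -q'E !eqxx !mul1r /pair_index_error /= a0 aa' mul1r.
  exact: lexx.
apply: addr_ge0; first by apply: sumr_ge0 => i _; exact: term_ge0.
by apply: sumr_ge0 => w' _; apply: sumr_ge0 => i _; exact: term_ge0.
Qed.

(** The two error terms cover the two orders of the norms of [q] and [q']. For nonparallel vectors
    the truncated counts are bounded by the full ones, whose product has the product of the means as
    integral. *)
Lemma integral_product_le D W K (q q' : 'cV[int]_n) : (0 < W)%N -> q \in Q K -> q' \in Q K ->
  (\int[mu m n]_(A in C m n) (truncated_count D (rad q) q A * truncated_count D (rad q') q' A)
    <= ((beta * nrm q ^- n) * (beta * nrm q' ^- n) +
        (matched_error D W K q q' + matched_error D W K q' q))%:E)%E.
Proof.
move=> W0 qK q'K.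
have [q0 q'0] := (punctured_ball_neq0 qK, punctured_ball_neq0 q'K).
have [par|/existsP[i /existsP[j npar]]] := boolP [forall i, forall j, q i 0 * q' j 0 == q j 0 * q' i 0]; last first.
  rewrite EFinD -!radiusX_ball.
  rewrite -(integral_ball_count_nonparallel m (radius_gt0 m b0 q0) (radius_gt0 m b0 q'0) npar).
  rewrite -[leLHS]adde0; apply: leeD; last by rewrite lee_fin addr_ge0 ?matched_error_ge0.
  have mX x := @measurable_mulmx_cst R m n (int_cV R x).
  apply: ge0_le_integral.
  - exact: measurable_unit_cube.
  - by move=> A _; rewrite mule_ge0 // truncated_count_ge0.
  - by apply: measurable_funTS; apply: emeasurable_funM; exact: measurable_truncated_count.
  - by apply: measurable_funTS; apply: emeasurable_funM;
      exact: (measurableT_comp (@measurable_ball_count R m _) (mX _)).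
  by move=> A _; apply: lee_pmul; rewrite ?truncated_count_ge0 // truncated_count_le.
have {}par i j : q i 0 * q' j 0 = q j 0 * q' i 0.
  by move/forallP : par => /(_ i) /forallP /(_ j) /eqP.
have [qq'|q'q] := leP (nrm q) (nrm q').
  have [w [a [a' [w0 aa' cop qE q'E]]]] := parallel_param q0 q'0 par qq'.
  apply: le_trans (integral_parallel_product_le D W0 w0 aa' cop qE q'E) _.
  rewrite lee_fin lerD2l -[leLHS]addr0 lerD ?matched_error_ge0 //.
  exact: matched_error_ge qE q'E.
have par' i j : q' i 0 * q j 0 = q' j 0 * q i 0 by rewrite mulrC par mulrC.
have [w [a [a' [w0 aa' cop q'E qE]]]] := parallel_param q'0 q0 par' (ltW q'q).
under eq_integral do rewrite muleC.
apply: le_trans (integral_parallel_product_le D W0 w0 aa' cop q'E qE) _.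
rewrite lee_fin [leLHS]addrC [leRHS]addrC mulrC lerD // -[leLHS]add0r lerD ?matched_error_ge0 //.
exact: matched_error_ge q'E qE.
Qed.

End second_moment.

Section second_moment_sum.
Variables (R : realType) (m n : nat) (b : R).
Hypotheses (m0 : (0 < m)%N) (n0 : (0 < n)%N) (b0 : 0 < b).
Local Notation RR := (measurableTypeR R).
Local Notation mu m n := (lebesgue_mx R m n).
Local Notation C m n := (@unit_cube R m n).
Local Notation nrm q := (enorm (int_cV R q)).
Local Notation Q K := (fset_set (@punctured_ball R n K%:R)).
Local Notation rad := (radius m b).
Local Notation beta := (mean_factor m b).
Local Notation C1 := (cov_error_cst m b).
Local Notation C2 := (prod_error_cst m b).
Local Notation S K := (sum_inv_enorm R n K).

Lemma sum_ord_interval (K a : nat) : (\sum_(i < K) (0 < i <= a) <= a)%N.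
Proof.
suff h : (\sum_(i < K) (0 < i <= a) <= minn K.-1 a)%N by apply: leq_trans h _; exact: geq_minr.
elim: K => [|K IH]; first by rewrite big_ord0.
rewrite big_ord_recr /=; apply: (@leq_trans (minn K.-1 a + (0 < K <= a))%N); first by rewrite leq_add2r.
case: K {IH} => [|K] /=; lia.
Qed.

Lemma sum_inv_ord (K : nat) : (0 < K)%N -> \sum_(i < K) (i%:R^-1 : R) <= 1 + ln K%:R.
Proof.
move=> K0; apply: le_trans (harmonic_le R K0).
rewrite -(big_mkord xpredT (fun i => i%:R^-1)) big_ltn // invr0 add0r.
by rewrite big_nat_recr //= lerDl invr_ge0.
Qed.

(** The factor 2 counts the signs of [a]. Summing over [a0 <= a'] turns [a' ^- 2] into at most
    [1 / a']; the sum over [a'] is then at most [D] under the cutoff, and harmonic otherwise. *)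
Lemma sum_pair_index_error D W K (w : 'cV[int]_n) : (0 < K)%N ->
  \sum_(j : 'I_K * 'I_K * bool) pair_index_error m b D W w j <=
  2 * (nrm w ^- n * (beta * D%:R + (nrm w < W%:R)%R%:R * (C1 * (1 + ln K%:R)) +
         C2 / W%:R * (1 + ln K%:R) ^+ 2)).
Proof.
move=> K0; set c1 := (nrm w < W%:R)%R%:R; set H := 1 + ln K%:R.
have C10 := cov_error_cst_ge0 m b0; have C20 := prod_error_cst_ge0 m b0.
have beta0 := ltW (mean_factor_gt0 m b0).
have c10 : 0 <= c1 by exact: ler0n.
have nw : 0 <= nrm w ^- n by rewrite invr_ge0 exprn_ge0 // enorm_ge0.
pose u (a' a0 : nat) : R := (0 < a0 <= a')%N%:R * a'%:R ^- 2.
apply: (@le_trans _ _ (\sum_(j : 'I_K * 'I_K * bool) nrm w ^- n *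
   (beta * ((j.1.1 <= D)%N%:R * u j.1.1 j.1.2) + c1 * C1 * u j.1.1 j.1.2 +
     C2 / W%:R * (j.1.1%:R^-1 * j.1.2%:R^-1)))).
  apply: ler_sum => -[[a' a0] s] _ /=; rewrite /pair_index_error /pair_error /= /u -/c1.
  rewrite [leLHS]mulrCA; apply: ler_wpM2l => //.
  rewrite mulrDr; apply: lerD.
    by rewrite le_eqVlt; apply/orP; left; apply/eqP; ring.
  rewrite [a0%:R^-1 * _]mulrC [leLHS]mulrA -[leRHS]mul1r; apply: ler_wpM2r.
    by rewrite mulr_ge0 ?divr_ge0 // mulr_ge0 ?invr_ge0.
  by rewrite -natrM mulnb lern1 leq_b1.
rewrite -mulr_sumr [leRHS]mulrCA; apply: ler_wpM2l => //.
rewrite -(pair_bigA _ (fun (i : 'I_K * 'I_K) (s : bool) =>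
  (beta * ((i.1 <= D)%N%:R * u i.1 i.2) + c1 * C1 * u i.1 i.2 + C2 / W%:R * (i.1%:R^-1 * i.2%:R^-1)))) /=.
under eq_bigr do rewrite sumr_const card_bool.
rewrite sumrMnl -[leLHS]mulr_natl; apply: ler_wpM2l => //.
rewrite -(pair_bigA _ (fun (a' a0 : 'I_K) =>
  (beta * ((a' <= D)%N%:R * u a' a0) + c1 * C1 * u a' a0 + C2 / W%:R * (a'%:R^-1 * a0%:R^-1)))) /=.
have su (a' : nat) : \sum_(a0 < K) u a' a0 <= a'%:R^-1.
  rewrite -mulr_suml -natr_sum.
  have [->|a'0] := posnP a'; first by rewrite expr2 mul0r invr0 mulr0.
  have a'R : 0 < a'%:R :> R by rewrite ltr0n.
  apply: (@le_trans _ _ (a'%:R * a'%:R ^- 2)).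
    by rewrite ler_wpM2r ?invr_ge0 ?exprn_ge0 // ler_nat sum_ord_interval.
  by rewrite le_eqVlt; apply/orP; left; apply/eqP; field; rewrite gt_eqF.
have H0 : 0 <= H by rewrite addr_ge0 // ln_ge0 // ler1n.
apply: (@le_trans _ _ (\sum_(a' < K) (beta * (0 < a' <= D)%N%:R + c1 * C1 * a'%:R^-1 + C2 / W%:R * (a'%:R^-1 * H)))).
  apply: ler_sum => a' _; rewrite !big_split -!mulr_sumr /=.
  apply: lerD; first apply: lerD.
  - apply: ler_wpM2l => //; apply: le_trans (ler_wpM2l (ler0n _ _) (su a')) _.
    have [E|a'1] := posnP a'; first by rewrite [in leLHS]E invr0 mulr0.
    by rewrite /=; case: (a' <= D)%N; rewrite ?mul0r // mul1r invf_le1 ?ltr0n // ler1n.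
  - by apply: ler_wpM2l; [exact: mulr_ge0|exact: su].
  - apply: ler_wpM2l; first exact: divr_ge0.
    by apply: ler_wpM2l; [rewrite invr_ge0|exact: sum_inv_ord].
rewrite !big_split -!mulr_sumr -mulr_suml /=.
apply: lerD; first apply: lerD.
- by apply: ler_wpM2l => //; rewrite -natr_sum ler_nat sum_ord_interval.
- by rewrite mulrA; apply: ler_wpM2l; [exact: mulr_ge0|exact: sum_inv_ord].
- apply: ler_wpM2l; first exact: divr_ge0.
  by rewrite expr2 ler_wpM2r // sum_inv_ord.
Qed.

(** The factor 4 is 2 for the order of the norms times 2 for the sign of [a]. *)
Definition second_moment_error (D W K : nat) : R :=
  4 * (S K * (beta * D%:R) + S W * (C1 * (1 + ln K%:R)) + S K * (C2 / W%:R * (1 + ln K%:R) ^+ 2)).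

Lemma second_moment_le D W K : (0 < W <= K)%N ->
  (\sum_(q <- Q K) \sum_(q' <- Q K) \int[mu m n]_(A in C m n)
      (truncated_count D (rad q) q A * truncated_count D (rad q') q' A)
    <= ((beta * S K) ^+ 2 + second_moment_error D W K)%:E)%E.
Proof.
move=> /andP[W0 WK]; have K0 : (0 < K)%N by exact: leq_trans WK.
apply: (@le_trans _ _ (\sum_(q <- Q K) \sum_(q' <- Q K)
   ((beta * nrm q ^- n) * (beta * nrm q' ^- n) +
        (matched_error m b D W K q q' + matched_error m b D W K q' q))%:E)%E).
  rewrite big_seq [leRHS]big_seq; apply: lee_sum => q qQ.
  by rewrite big_seq [leRHS]big_seq; apply: lee_sum => q' q'Q; exact: integral_product_le.
under eq_bigr do rewrite sumEFin.
rewrite sumEFin lee_fin.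
under eq_bigr do rewrite big_split /= -mulr_sumr -mulr_sumr.
rewrite big_split /= -mulr_suml -mulr_sumr -expr2 lerD2l.
under eq_bigr do rewrite big_split /=.
rewrite big_split /= [X in _ + X]exchange_big /= -mulr2n -[leLHS]mulr_natl.
rewrite /second_moment_error (_ : 4 = 2 * 2 :> R); last by ring.
rewrite -[leRHS]mulrA; apply: ler_wpM2l => //.
have u := fset_uniq (Q K).
apply: le_trans (sum_matched_le (Q K)
  (fun (w : 'cV[int]_n) (j : 'I_K * 'I_K * bool) => ((-1) ^+ j.2 * (j.1.2 : nat)%:Z) *: w)
  (fun (w : 'cV[int]_n) (j : 'I_K * 'I_K * bool) => (j.1.1 : nat)%:Z *: w)
  u (@pair_index_error_ge0 R m n b b0 D W K)) _.
apply: (@le_trans _ _ (\sum_(w <- Q K) 2 * (nrm w ^- n * (beta * D%:R + (nrm w < W%:R)%R%:R * (C1 * (1 + ln K%:R)) +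
         C2 / W%:R * (1 + ln K%:R) ^+ 2)))).
  by apply: ler_sum => w _; exact: sum_pair_index_error.
rewrite -mulr_sumr; apply: ler_wpM2l => //.
have H0 : 0 <= C1 * (1 + ln K%:R).
  by rewrite mulr_ge0 ?cov_error_cst_ge0 // addr_ge0 // ln_ge0 // ler1n.
move: (1 + ln K%:R) H0 => H H0.
under eq_bigr do rewrite !mulrDr.
rewrite !big_split /= -!mulr_suml; apply: lerD => //; apply: lerD => //.
under eq_bigr do rewrite [_ ^- n * _]mulrA.
rewrite -mulr_suml; apply: ler_wpM2r => //.
under eq_bigr do rewrite mulr_natr mulrb.
rewrite -big_mkcond sum_punctured_ball_lt // ler_nat //.
Qed.

(** A discarded [p] shares with [q] a divisor [d > D], and [d < K] because [d] divides a nonzero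
    entry of [q]. Dividing by [d], the point [p / d] is counted by the term [k = d]. *)
Lemma ball_count_le_truncated D K (q : 'cV[int]_n) (A : 'M[RR]_(m, n)) : q \in Q K ->
  (ball_count (rad q) (A *m int_cV R q) <= truncated_count D (rad q) q A +
    \sum_(D.+1 <= k < K) ((dvd_cV k q)%:R%:E *
      ball_count (rad q / k%:R) (A *m (k%:R^-1 *: int_cV R q))%R))%E.
Proof.
move=> qQ; have q0 := punctured_ball_neq0 qQ.
move: qQ; rewrite in_punctured_ball => /andP[_ qK].
set y := A *m int_cV R q.
apply: (@le_trans _ _ (truncated_count D (rad q) q A +
    \sum_(D.+1 <= k < K) ((dvd_cV k q)%:R%:E *
      \esum_(p in [set: 'cV[int]_m]) ((dvd_cV k p)%:R%:E * ball_ind (rad q) (y - int_cV R p)%R)))%E); last first.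
  rewrite leeD2l //; rewrite big_nat [leRHS]big_nat; apply: lee_sum => k /andP[Dk _].
  have k0 : (0 < k)%N by exact: leq_trans Dk.
  have kR : 0 < k%:R :> R by rewrite ltr0n.
  have kZ : k%:Z != 0 by rewrite eqz_nat -lt0n.
  rewrite lee_wpmul2l // ?lee_fin ?ler0n //.
  pose e (p : 'cV[int]_m) := k%:Z *: p.
  have ei : injective e.
    move=> p p' /matrixP E; apply/matrixP => i j; have := E i j; rewrite !mxE.
    exact: mulfI.
  rewrite [leLHS](_ : _ = \esum_(p in range e) (ball_ind (rad q) (y - int_cV R p)%R)).
    rewrite esum_image; last by move=> p p' _ _ /ei.
    apply: le_esum => p _; apply: ball_ind_le => h.
    rewrite -scalemxAr -/y ler_pdivlMr // mulrC.
    have E : y - int_cV R (e p) = k%:R *: (k%:R^-1 *: y - int_cV R p).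
      by rewrite scalerBr scalerA mulfV ?gt_eqF // scale1r /int_cV map_mxZ.
    by rewrite E enormZ (gtr0_norm kR) in h.
  rewrite [RHS]esum_mkcond; apply: eq_esum => p _.
  case: (boolP (dvd_cV k p)) => [/forallP kp|kp].
    rewrite mul1e mem_set //; exists (\col_i (p i 0%R %/ k%:Z)%Z) => //.
    by apply/matrixP => i j; rewrite ord1 !mxE mulrC divzK.
  rewrite mul0e memNset //; move=> [p0 _ pE]; move/negP: kp; apply.
  by apply/forallP => i; rewrite -pE mxE dvdz_mulr.
have esumE : \sum_(D.+1 <= k < K) ((dvd_cV k q)%:R%:E *
      \esum_(p in [set: 'cV[int]_m]) ((dvd_cV k p)%:R%:E * ball_ind (rad q) (y - int_cV R p)%R))%E =
   \esum_(p in [set: 'cV[int]_m]) \sum_(D.+1 <= k < K) ((dvd_cV k q)%:R%:E *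
        ((dvd_cV k p)%:R%:E * ball_ind (rad q) (y - int_cV R p)%R))%E.
  rewrite esum_sum; last by move=> p k _ _; rewrite !mule_ge0 ?ball_ind_ge0 // lee_fin.
  apply: eq_bigr => k _; rewrite -ge0_esumZl //.
  by move=> p; rewrite mule_ge0 ?ball_ind_ge0 // lee_fin.
have t0 k p : (0 <= (dvd_cV k q)%:R%:E *
        ((dvd_cV k p)%:R%:E * ball_ind (rad q) (y - int_cV R p)%R))%E.
  by rewrite !mule_ge0 ?ball_ind_ge0 // lee_fin.
rewrite esumE -esumD; last 2 first.
- by move=> p _; rewrite mule_ge0 ?ball_ind_ge0 // lee_fin.
- by move=> p _; apply: sume_ge0 => k _; exact: t0.
apply: le_esum => p _; case: (boolP (no_large_gcd D p q)) => [_|].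
  by rewrite mul1e -[leLHS]adde0 leeD2l // sume_ge0.
move=> /asboolPn /existsNP[d /not_implyP[Dd /negP/negPn /andP[dp dq]]].
rewrite mul0e add0e.
have dK : (d < K)%N.
  have [i qi] := cV_neq0 q0.
  rewrite -(ltr_nat R); apply: le_lt_trans qK; apply: le_trans (le_entry_enorm _ i).
  rewrite mxE -intr_norm -abszE ler_nat.
  by have /forallP/(_ i) := dq; rewrite dvdzE /= => /dvdn_leq; apply; rewrite absz_gt0.
rewrite (bigD1_seq d) ?iota_uniq ?mem_index_iota ?Dd //= dp dq !mul1e.
by rewrite leeDl // sume_ge0.
Qed.

Lemma sum_dvd_inv_enorm_le k K : (0 < k)%N ->
  \sum_(q <- Q K) (dvd_cV k q)%:R * nrm q ^- n <= k%:R ^- n * S K.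
Proof.
move=> k0; have kR : 0 < k%:R :> R by rewrite ltr0n.
have kZ : k%:Z != 0 by rewrite eqz_nat -lt0n.
have nn (x : 'cV[int]_n) : 0 <= nrm x ^- n by rewrite invr_ge0 exprn_ge0 // enorm_ge0.
apply: (@le_trans _ _ (\sum_(q <- Q K) \sum_(w <- Q K) (q == k%:Z *: w)%:R * (k%:R ^- n * nrm w ^- n))).
  rewrite big_seq [leRHS]big_seq; apply: ler_sum => q qK.
  have s0 w : 0 <= (q == k%:Z *: w)%:R * (k%:R ^- n * nrm w ^- n).
    by rewrite mulr_ge0 // mulr_ge0 // invr_ge0 exprn_ge0.
  case: (boolP (dvd_cV k q)) => [/forallP kq|_]; last by rewrite mul0r sumr_ge0.
  pose w : 'cV[int]_n := \col_i (q i 0%R %/ k%:Z)%Z.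
  have qE : q = k%:Z *: w by apply/matrixP => i j; rewrite ord1 !mxE mulrC divzK.
  have nq : nrm q = k%:R * nrm w by rewrite qE /int_cV map_mxZ enormZ ger0_norm.
  move: qK; rewrite in_punctured_ball => /andP[q1 qK].
  have w0 : w != 0.
    by apply: contraTneq q1 => w0; rewrite nq w0 /int_cV map_mx0 enorm0 mulr0 -ltNge.
  have nw1 : 1 <= nrm w by exact: enorm_int_ge1.
  have wK : w \in Q K.
    rewrite in_punctured_ball nw1 /=; apply: le_lt_trans qK.
    by rewrite nq ler_peMl ?enorm_ge0 // ler1n.
  rewrite (bigD1_seq w) ?fset_uniq //= -qE eqxx !mul1r nq exprMn invfM lerDl.
  by rewrite sumr_ge0.
rewrite exchange_big /= mulr_sumr; apply: ler_sum => w _.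
rewrite -mulr_suml -[leRHS]mul1r ler_wpM2r //; last by rewrite sum_eq_le1 // fset_uniq.
by rewrite mulr_ge0 // invr_ge0 exprn_ge0.
Qed.

Lemma sum_integral_ball_count K :
  (\sum_(q <- Q K) \int[mu m n]_(A in C m n) ball_count (rad q) (A *m int_cV R q)%R =
   (beta * S K)%:E)%E.
Proof.
rewrite mulr_sumr -sumEFin big_seq [RHS]big_seq; apply: eq_bigr => q qQ.
have q0 := punctured_ball_neq0 qQ.
by rewrite integral_ball_count_mulmx ?radiusX_ball ?radius_gt0.
Qed.

(** For [k] dividing [q], the count at [q / k] with radius [rad q / k] has mean
    [beta * nrm q ^- n / k ^+ m]. Over the multiples [q] of [k] this sums to at most
    [beta * S K * k ^- (n + m)], hence at most [beta * S K * k ^- 2], and the tail of the series of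
    [k ^- 2] beyond [D] is at most [1 / D]. *)
Lemma tail_le D K : (0 < D)%N ->
  ((beta * S K)%:E <= \sum_(q <- Q K) \int[mu m n]_(A in C m n) truncated_count D (rad q) q A
    + (beta * S K / D%:R)%:E)%E.
Proof.
move=> D0; have beta0 := ltW (mean_factor_gt0 m b0).
have mC := @measurable_unit_cube R m n.
have mB r (x : 'cV[R]_n) : measurable_fun setT (fun A : 'M[RR]_(m, n) => ball_count r (A *m x)).
  exact: (measurableT_comp (@measurable_ball_count R m r) (@measurable_mulmx_cst R m n x)).
rewrite -{1}sum_integral_ball_count.
apply: (@le_trans _ _ (\sum_(q <- Q K) (\int[mu m n]_(A in C m n) truncated_count D (rad q) q A +
   (\sum_(D.+1 <= k < K) (dvd_cV k q)%:R * (beta * nrm q ^- n / k%:R ^+ m))%:E))%E).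
  rewrite big_seq [leRHS]big_seq; apply: lee_sum => q qK.
  have q0 := punctured_ball_neq0 qK.
  apply: (@le_trans _ _ (\int[mu m n]_(A in C m n) (truncated_count D (rad q) q A +
    \sum_(D.+1 <= k < K) ((dvd_cV k q)%:R%:E *
      ball_count (rad q / k%:R) (A *m (k%:R^-1 *: int_cV R q))%R)))%E).
    apply: ge0_le_integral => //.
    - by move=> A _; exact: ball_count_ge0.
    - by apply: measurable_funTS; exact: mB.
    - apply: measurable_funTS; apply: emeasurable_funD; first exact: measurable_truncated_count.
      by apply: emeasurable_sum => k; apply: measurable_funeM; exact: mB.
    - by move=> A _; exact: ball_count_le_truncated.
  rewrite ge0_integralD //; last 4 first.
  - by move=> A _; exact: truncated_count_ge0.
  - by apply: measurable_funTS; exact: measurable_truncated_count.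
  - by move=> A _; apply: sume_ge0 => k _; rewrite mule_ge0 ?ball_count_ge0 // lee_fin.
  - apply: measurable_funTS.
    by apply: emeasurable_sum => k; apply: measurable_funeM; exact: mB.
  rewrite leeD2l // ge0_integral_sum //; last 2 first.
  - by move=> k; apply: measurable_funTS; apply: measurable_funeM; exact: mB.
  - by move=> k A _; rewrite mule_ge0 ?ball_count_ge0 // lee_fin.
  rewrite -sumEFin big_nat [leRHS]big_nat; apply: lee_sum => k /andP[Dk _].
  have k0 : (0 < k)%N by exact: leq_trans Dk.
  have kR : 0 < k%:R :> R by rewrite ltr0n.
  have kZ : k%:Z != 0 by rewrite eqz_nat -lt0n.
  rewrite ge0_integralZl //; last 2 first.
  - by apply: measurable_funTS; exact: mB.
  - by move=> A _; exact: ball_count_ge0.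
  case: (boolP (dvd_cV k q)) => [/forallP kq|_]; last by rewrite !mul0e mul0r.
  rewrite !mul1e mul1r.
  pose w : 'cV[int]_n := \col_i (q i 0%R %/ k%:Z)%Z.
  have qE : q = k%:Z *: w by apply/matrixP => i j; rewrite ord1 !mxE mulrC divzK.
  have w0 : w != 0 by apply: contraNneq q0 => w0; rewrite qE w0 scaler0.
  have -> : k%:R^-1 *: int_cV R q = int_cV R w.
    by rewrite qE /int_cV map_mxZ scalerA mulVf ?gt_eqF // scale1r.
  rewrite integral_ball_count_mulmx ?divr_gt0 ?radius_gt0 // expr_div_n mulrAC.
  by rewrite radiusX_ball.
rewrite big_split /= leeD2l // sumEFin lee_fin exchange_big /=.
apply: (@le_trans _ _ (\sum_(D.+1 <= k < K) beta * S K * k%:R ^- 2)); last first.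
  rewrite -mulr_sumr; apply: ler_wpM2l; last exact: sum_inv_sqr_le.
  by apply: mulr_ge0 => //; exact: sum_inv_enorm_ge0.
rewrite big_nat [leRHS]big_nat; apply: ler_sum => k /andP[Dk _].
have k0 : (0 < k)%N by exact: leq_trans Dk.
have kR : 0 < k%:R :> R by rewrite ltr0n.
under eq_bigr do rewrite mulrA [_%:R * _]mulrCA.
rewrite -mulr_suml -mulr_sumr.
apply: (@le_trans _ _ (beta * (k%:R ^- n * S K) / k%:R ^+ m)).
  apply: ler_wpM2r; first by rewrite invr_ge0 exprn_ge0.
  by apply: ler_wpM2l => //; exact: sum_dvd_inv_enorm_le.
rewrite (_ : _ / _ = beta * S K * (k%:R ^- n * k%:R ^- m)); last by ring.
apply: ler_wpM2l; first by apply: mulr_ge0 => //; exact: sum_inv_enorm_ge0.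
have ix i : (0 < i)%N -> (k%:R ^- i : R) <= k%:R^-1.
  move=> i0; rewrite -exprVn -[leRHS]expr1; apply: ler_wiXn2l => //.
  by rewrite invf_le1 // ler1n.
rewrite [X in _ <= X^-1]expr2 invfM.
by apply: ler_pM; rewrite ?invr_ge0 ?exprn_ge0 // ix.
Qed.

End second_moment_sum.

(** * Deviation from the mean *)

Section deviation.
Variables (R : realType) (m n : nat) (b : R).
Hypotheses (m0 : (0 < m)%N) (n0 : (0 < n)%N) (b0 : 0 < b).
Local Notation RR := (measurableTypeR R).
Local Notation mu m n := (lebesgue_mx R m n).
Local Notation C m n := (@unit_cube R m n).
Local Notation nrm q := (enorm (int_cV R q)).
Local Notation Q K := (fset_set (@punctured_ball R n K%:R)).
Local Notation rad := (radius m b).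
Local Notation beta := (mean_factor m b).
Local Notation S K := (sum_inv_enorm R n K).

Lemma sum_ball_count_eq_card K (A : 'M[RR]_(m, n)) :
  (\sum_(q <- Q K) ball_count (rad q) (A *m int_cV R q)%R =
   ((count_approximations (A : 'M[R]_(m, n)) b K%:R)%:R)%:E)%E.
Proof.
rewrite /count_approximations -esum_indic_card; last exact: finite_approximations.
rewrite (reindex_esumT (e := fun qp : 'cV[int]_n * 'cV[int]_m => (qp.2, qp.1))
   (e' := fun pq => (pq.2, pq.1))); [|by case|by case].
transitivity (\esum_(q in [set: 'cV[int]_n]) \esum_(p in [set: 'cV[int]_m])
   (\1_(approximations (A : 'M[R]_(m, n)) b K%:R) (p, q))%:E : \bar R).
  rewrite -fsbig_finite /=; last exact: finite_punctured_ball.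
  rewrite -esum_fset; last 2 first.
  - exact: finite_punctured_ball.
  - by move=> q _; exact: ball_count_ge0.
  rewrite esum_mkcond; apply: eq_esum => q _; case: ifPn => [|].
    rewrite inE => qQ; apply: eq_esum => p _; rewrite ball_indE indicE; congr ((nat_of_bool _)%:R%:E).
    apply/idP/idP; first by move=> h; rewrite inE; split.
    by rewrite inE => -[].
  move=> /negP; rewrite inE => qQ; rewrite esum1 // => p _.
  by rewrite indicE memNset // => -[_ /=].
rewrite esum_esum; last by move=> q p _ _; rewrite lee_fin.
by congr (esum _ _); apply/seteqP; split => -[? ?].
Qed.

Definition full_total K (A : 'M[RR]_(m, n)) : R :=
  (count_approximations (A : 'M[R]_(m, n)) b K%:R)%:R.

Definition truncated_total D K (A : 'M[RR]_(m, n)) : R :=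
  fine (\sum_(q <- Q K) truncated_count D (rad q) q A).

Let mB (x : 'cV[R]_n) r :
  measurable_fun setT (fun A : 'M[RR]_(m, n) => ball_count r (A *m x)).
Proof. exact: (measurableT_comp (@measurable_ball_count R m r) (@measurable_mulmx_cst R m n x)). Qed.

Lemma sum_truncated_count_le D K (A : 'M[RR]_(m, n)) :
  (\sum_(q <- Q K) truncated_count D (rad q) q A <= (full_total K A)%:E)%E.
Proof.
rewrite -sum_ball_count_eq_card; apply: lee_sum => q _; exact: truncated_count_le.
Qed.

Lemma sum_truncated_count_ge0 D K (A : 'M[RR]_(m, n)) :
  (0 <= \sum_(q <- Q K) truncated_count D (rad q) q A)%E.
Proof. by apply: sume_ge0 => q _; exact: truncated_count_ge0. Qed.

Lemma truncated_totalE D K (A : 'M[RR]_(m, n)) :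
  (truncated_total D K A)%:E = (\sum_(q <- Q K) truncated_count D (rad q) q A)%E.
Proof.
rewrite fineK // ge0_fin_numE ?sum_truncated_count_ge0 //.
by rewrite (le_lt_trans (sum_truncated_count_le D K A)) // ltry.
Qed.

Lemma truncated_total_ge0 D K A : 0 <= truncated_total D K A.
Proof. by rewrite -lee_fin truncated_totalE sum_truncated_count_ge0. Qed.

Lemma truncated_total_le D K A : truncated_total D K A <= full_total K A.
Proof. by rewrite -lee_fin truncated_totalE sum_truncated_count_le. Qed.

Lemma measurable_truncated_total D K : measurable_fun setT (truncated_total D K).
Proof.
apply/measurable_EFinP.
rewrite (_ : _ \o _ = fun A => (\sum_(q <- Q K) truncated_count D (rad q) q A)%E).
  by apply: emeasurable_sum => q; exact: measurable_truncated_count.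
by apply/funext => A /=; rewrite truncated_totalE.
Qed.

Lemma measurable_full_total K : measurable_fun setT (full_total K).
Proof.
apply/measurable_EFinP.
rewrite (_ : _ \o _ = fun A => (\sum_(q <- Q K) ball_count (rad q) (A *m int_cV R q)%R)%E).
  by apply: emeasurable_sum => q; exact: mB.
by apply/funext => A /=; rewrite sum_ball_count_eq_card.
Qed.


Lemma integral_full_total K : (\int[mu m n]_(A in C m n) (full_total K A)%:E = (beta * S K)%:E)%E.
Proof.
rewrite -sum_integral_ball_count // -ge0_integral_sum.
- by apply: eq_integral => A _; rewrite sum_ball_count_eq_card.
- exact: measurable_unit_cube.
- by move=> q; apply: measurable_funTS; exact: mB.
- by move=> q A _; exact: ball_count_ge0.
Qed.

Lemma integral_truncated_total D K : (0 < D)%N ->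
  exists2 t : R, (\int[mu m n]_(A in C m n) (truncated_total D K A)%:E = t%:E)%E &
    beta * S K <= t + beta * S K / D%:R.
Proof.
move=> D0; have mC := @measurable_unit_cube R m n.
have le : (\int[mu m n]_(A in C m n) (truncated_total D K A)%:E <= (beta * S K)%:E)%E.
  rewrite -integral_full_total; apply: ge0_le_integral => //.
  - by move=> A _; rewrite lee_fin truncated_total_ge0.
  - by apply/measurable_EFinP/measurable_funTS; exact: measurable_truncated_total.
  - by apply/measurable_EFinP/measurable_funTS; exact: measurable_full_total.
  - by move=> A _; rewrite lee_fin truncated_total_le.
have ge0 : (0 <= \int[mu m n]_(A in C m n) (truncated_total D K A)%:E)%E.
  by apply: integral_ge0 => A _; rewrite lee_fin truncated_total_ge0.
have fin : (\int[mu m n]_(A in C m n) (truncated_total D K A)%:E)%E \is a fin_num.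
  by rewrite ge0_fin_numE // (le_lt_trans le) // ltry.
exists (fine (\int[mu m n]_(A in C m n) (truncated_total D K A)%:E)%E); first by rewrite fineK.
rewrite -lee_fin EFinD fineK //; apply: le_trans (tail_le m0 n0 b0 K D0) _.
rewrite leeD2r // -ge0_integral_sum //.
- by under eq_integral do rewrite -truncated_totalE.
- by move=> q; apply: measurable_funTS; exact: measurable_truncated_count.
- by move=> q A _; exact: truncated_count_ge0.
Qed.

Lemma integral_truncated_total_sqr_le D W K : (0 < W <= K)%N ->
  (\int[mu m n]_(A in C m n) (truncated_total D K A ^+ 2)%:E <=
    ((beta * S K) ^+ 2 + second_moment_error m n b D W K)%:E)%E.
Proof.
move=> WK; apply: le_trans (second_moment_le m0 n0 b0 D WK).
have mC := @measurable_unit_cube R m n.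
have mt q := @measurable_truncated_count R m n D (rad q) q.
have -> : (\sum_(q <- Q K) \sum_(q' <- Q K) \int[mu m n]_(A in C m n)
      (truncated_count D (rad q) q A * truncated_count D (rad q') q' A))%E =
  (\int[mu m n]_(A in C m n) \sum_(q <- Q K) \sum_(q' <- Q K)
      (truncated_count D (rad q) q A * truncated_count D (rad q') q' A))%E.
  rewrite ge0_integral_sum //; last 2 first.
  - move=> q; apply: measurable_funTS; apply: emeasurable_sum => q'.
    by apply: emeasurable_funM; exact: mt.
  - by move=> q A _; apply: sume_ge0 => q' _; rewrite mule_ge0 // truncated_count_ge0.
  apply: eq_bigr => q _; rewrite ge0_integral_sum //.
  - by move=> q'; apply: measurable_funTS; apply: emeasurable_funM; exact: mt.
  - by move=> q' A _; rewrite mule_ge0 // truncated_count_ge0.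
rewrite le_eqVlt; apply/orP; left; apply/eqP; apply: eq_integral => A _.
rewrite expr2 EFinM truncated_totalE ge0_sume_distrl; last by move=> q _; exact: truncated_count_ge0.
apply: eq_bigr => q _; rewrite ge0_sume_distrr // => q' _; exact: truncated_count_ge0.
Qed.

(** Expand the square around the full mean [M = beta * S K]. The truncated mean [t] may be smaller,
    but [t >= M - M / D], which costs [2 * M ^+ 2 / D]. *)
Lemma integral_deviation_le D W K : (0 < D)%N -> (0 < W <= K)%N ->
  (\int[mu m n]_(A in C m n) ((truncated_total D K A - beta * S K) ^+ 2)%:E <=
    (second_moment_error m n b D W K + 2 * (beta * S K) ^+ 2 / D%:R)%:E)%E.
Proof.
move=> D0 WK; have mC := @measurable_unit_cube R m n.
have [t tE tM] := integral_truncated_total K D0.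
have M0 : 0 <= beta * S K.
  by apply: mulr_ge0; [exact/ltW/mean_factor_gt0|exact: sum_inv_enorm_ge0].
have le2 := integral_truncated_total_sqr_le D WK.
move: (beta * S K) M0 tM le2 => M M0 tM le2.
have mt := measurable_truncated_total D K.
(* The cross term is moved to the left so that every integrand is nonnegative. *)
have h : (\int[mu m n]_(A in C m n) ((truncated_total D K A - M) ^+ 2)%:E + (2 * M * t)%:E =
   \int[mu m n]_(A in C m n) (truncated_total D K A ^+ 2)%:E + (M ^+ 2)%:E)%E.
  rewrite EFinM -tE -ge0_integralZl //; last 3 first.
  - by apply/measurable_EFinP/measurable_funTS.
  - by move=> A _; rewrite lee_fin truncated_total_ge0.
  - by rewrite lee_fin mulr_ge0.
  rewrite -[X in _ = (_ + X)%E](integral_cube_cst m n) -ge0_integralD //; last 4 first.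
  - by move=> A _; rewrite lee_fin sqr_ge0.
  - apply/measurable_EFinP/measurable_funTS; apply: measurable_funX.
    by apply: measurable_funB.
  - by move=> A _; rewrite -EFinM lee_fin !mulr_ge0 // truncated_total_ge0.
  - by apply: measurable_funTS; apply: measurable_funeM; exact/measurable_EFinP.
  rewrite -ge0_integralD //; last 3 first.
  - by move=> A _; rewrite lee_fin sqr_ge0.
  - by apply/measurable_EFinP/measurable_funTS; apply: measurable_funX.
  - by move=> A _; rewrite lee_fin sqr_ge0.
  apply: eq_integral => A _; rewrite -EFinM -!EFinD; congr EFin; ring.
rewrite -(@leeD2rE _ (2 * M * t)%:E) // h.
apply: le_trans (leeD2r _ le2) _; rewrite -!EFinD lee_fin.
have : M * M <= M * (t + M / D%:R) by rewrite ler_wpM2l.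
rewrite (_ : 2 * M ^+ 2 / D%:R = 2 * (M * (M / D%:R))); last by ring.
rewrite expr2; nra.
Qed.

Lemma integral_tail_le D K : (0 < D)%N ->
  (\int[mu m n]_(A in C m n) (full_total K A - truncated_total D K A)%:E <=
    (beta * S K / D%:R)%:E)%E.
Proof.
move=> D0; have mC := @measurable_unit_cube R m n.
have [t tE tM] := integral_truncated_total K D0.
rewrite -(@leeD2rE _ t%:E) // -EFinD; apply: (@le_trans _ _ (beta * S K)%:E); last first.
  by rewrite lee_fin addrC.
rewrite -tE -ge0_integralD //.
- rewrite -integral_full_total le_eqVlt; apply/orP; left; apply/eqP.
  by apply: eq_integral => A _; rewrite -EFinD subrK.
- by move=> A _; rewrite lee_fin subr_ge0 truncated_total_le.
- apply/measurable_EFinP/measurable_funTS; apply: measurable_funB.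
    exact: measurable_full_total.
  exact: measurable_truncated_total.
- by move=> A _; rewrite lee_fin truncated_total_ge0.
- by apply/measurable_EFinP/measurable_funTS; exact: measurable_truncated_total.
Qed.

End deviation.

(** * Deviations along the scales *)

Section almost_everywhere.
Variables (R : realType) (m n : nat) (b : R).
Hypotheses (m0 : (0 < m)%N) (n0 : (0 < n)%N) (b0 : 0 < b).
Local Notation RR := (measurableTypeR R).
Local Notation mu m n := (lebesgue_mx R m n).
Local Notation C m n := (@unit_cube R m n).
Local Notation beta := (mean_factor m b).
Local Notation S K := (sum_inv_enorm R n K).

Definition scale (j : nat) : nat := (2 ^ (j ^ 4))%N.

(** The condition on the cutoff [W = j ^ 6]: it follows from [j < 2 ^ j] and
    [6 <= 2 ^ 3 <= j ^ 3]. *)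
Lemma leq_scale j : (1 < j)%N -> (0 < j ^ 6 <= scale j)%N.
Proof.
move=> j1; have j0 : (0 < j)%N by exact: ltnW.
rewrite expn_gt0 j0 /=.
have h1 : (j ^ 6 <= 2 ^ (j * 6))%N by rewrite expnM leq_exp2r // ltnW // ltn_expl.
apply: (leq_trans h1); rewrite leq_exp2l // (expnS j 3) leq_pmul2l //.
by apply: (@leq_trans (2 ^ 3)%N) => //; rewrite leq_exp2r.
Qed.

Lemma ln_scale j : ln (scale j)%:R = j%:R ^+ 4 * ln 2 :> R.
Proof. by rewrite /scale natrX lnXn // -[LHS]mulr_natl natrX. Qed.

Lemma ln2_gt0 : 0 < ln 2 :> R.
Proof. by rewrite ln_gt0 // ltr1n. Qed.

Lemma ln2_le1 : ln 2 <= 1 :> R.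
Proof. by rewrite (_ : 2 = 1 + 1) // le_ln1Dx // ltrN10. Qed.

(** The mean has order [j ^ 4]. The first term controls the truncated count; the second, already
    nonnegative, is the normalized discarded mass and is used without squaring. *)
Definition deviation (j : nat) (A : 'M[RR]_(m, n)) : R :=
  (truncated_total b (j ^ 2) (scale j) A - beta * S (scale j)) ^+ 2 / j%:R ^+ 8 +
  (full_total b (scale j) A - truncated_total b (j ^ 2) (scale j) A) / j%:R ^+ 4.

Lemma deviation_ge0 j A : 0 <= deviation j A.
Proof.
by rewrite addr_ge0 // divr_ge0 ?sqr_ge0 ?exprn_ge0 // subr_ge0 truncated_total_le.
Qed.

Lemma measurable_deviation j : measurable_fun setT (deviation j).
Proof.
have mt := @measurable_truncated_total R m n b (j ^ 2) (scale j).
have mf := @measurable_full_total R m n b (scale j).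
apply: measurable_funD; apply: measurable_funM => //.
  by apply: measurable_funX; exact: measurable_funB.
exact: measurable_funB.
Qed.

Lemma second_moment_error_scale : exists2 c : R, 0 <= c & forall j, (1 < j)%N ->
  second_moment_error m n b (j ^ 2) (j ^ 6) (scale j) <= c * j%:R ^+ 6 /\
  beta * S (scale j) <= c * j%:R ^+ 4.
Proof.
have [c c0 Sc] := @sum_inv_enorm_le R n n0.
have beta0 := ltW (mean_factor_gt0 m b0).
have C10 := cov_error_cst_ge0 m b0; have C20 := prod_error_cst_ge0 m b0.
set C1 := cov_error_cst m b in C10; set C2 := prod_error_cst m b in C20.
have c1 := mulr_ge0 (ltW c0) beta0.
have c2 : 0 <= 12 * c * C1 by apply: mulr_ge0 => //; apply: mulr_ge0 => //; exact: ltW.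
have c3 : 0 <= 4 * c * C2 by apply: mulr_ge0 => //; apply: mulr_ge0 => //; exact: ltW.
exists (4 * (c * beta + 12 * c * C1 + 4 * c * C2)).
  by apply: mulr_ge0 => //; do 2 apply: addr_ge0 => //.
move=> j j1; have j0 : (0 < j)%N by exact: ltnW.
have jR : 1 <= j%:R :> R by rewrite ler1n.
have j0R : 0 < j%:R :> R by rewrite ltr0n.
have /andP[_ WK] := leq_scale j1.
have K1 : (1 < scale j)%N.
  by apply: leq_trans WK; rewrite -(exp1n 6) ltn_exp2r.
have W1 : (1 < j ^ 6)%N by rewrite -(exp1n 6) ltn_exp2r.
have lK : ln (scale j)%:R <= j%:R ^+ 4 :> R.
  by rewrite ln_scale -[leRHS]mulr1 ler_wpM2l ?exprn_ge0 // ln2_le1.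
have SK : S (scale j) <= c * j%:R ^+ 4.
  by apply: le_trans (Sc _ K1) _; rewrite ler_wpM2l // ltW.
(* The crude [ln j <= j] suffices: the term with [S W] ends up of order [j ^ 5]. *)
have SW : S (j ^ 6) <= 6 * c * j%:R.
  apply: le_trans (Sc _ W1) _; rewrite natrX lnXn // -[_ *+ 6]mulr_natl mulrCA mulrA.
  by rewrite ler_wpM2l ?mulr_ge0 ?(ltW c0) // ltW // ln_sublinear.
have SK0 : 0 <= S (scale j) by exact: sum_inv_enorm_ge0.
have SW0 : 0 <= S (j ^ 6) by exact: sum_inv_enorm_ge0.
have j4 : 1 <= j%:R ^+ 4 :> R by rewrite exprn_ege1.
have lK1 : 1 + ln (scale j)%:R <= 2 * j%:R ^+ 4 :> R by lra.
have lK0 : 0 <= 1 + ln (scale j)%:R :> R by rewrite addr_ge0 // ln_ge0 // ler1n ltnW.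
split; last first.
  apply: le_trans (ler_wpM2l beta0 SK) _; rewrite mulrA ler_wpM2r ?exprn_ge0 ?(ltW j0R) //.
  by rewrite [beta * c]mulrC; lra.
rewrite /second_moment_error -/C1 -/C2 -[leRHS]mulrA; apply: ler_wpM2l => //.
rewrite [leRHS]mulrDl; apply: lerD; first (rewrite [leRHS]mulrDl; apply: lerD).
- rewrite natrX; apply: (@le_trans _ _ (c * j%:R ^+ 4 * (beta * j%:R ^+ 2))).
    by apply: ler_wpM2r => //; apply: mulr_ge0 => //; rewrite exprn_ge0.
  by rewrite le_eqVlt; apply/orP; left; apply/eqP; ring.
- apply: (@le_trans _ _ (6 * c * j%:R * (C1 * (2 * j%:R ^+ 4)))).
    apply: ler_pM => //; first exact: mulr_ge0.
    exact: (ler_wpM2l C10 lK1).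
  rewrite (_ : _ * (C1 * _) = 12 * c * C1 * j%:R ^+ 5); last by ring.
  by apply: ler_wpM2l => //; rewrite ler_weXn2l.
rewrite natrX; apply: (@le_trans _ _ (c * j%:R ^+ 4 * (C2 / j%:R ^+ 6 * (2 * j%:R ^+ 4) ^+ 2))).
  apply: ler_pM => //.
    by apply: mulr_ge0; [rewrite divr_ge0 // exprn_ge0|rewrite sqr_ge0].
  apply: ler_wpM2l; first by rewrite divr_ge0 // exprn_ge0.
  by rewrite lerXn2r ?nnegrE ?(le_trans lK0).
by rewrite le_eqVlt; apply/orP; left; apply/eqP; field; rewrite gt_eqF.
Qed.

(** The first term is of order [j ^ 6] over [j ^ 8]; the second is of order [j ^ 4 / j ^ 2] over
    [j ^ 4]. *)
Lemma integral_deviation_scale : exists2 c : R, 0 <= c & forall j, (1 < j)%N ->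
  (\int[mu m n]_(A in C m n) (deviation j A)%:E <= (c * j%:R ^- 2)%:E)%E.
Proof.
have [c c0 hc] := second_moment_error_scale.
have beta0 := ltW (mean_factor_gt0 m b0).
exists (c + 2 * c ^+ 2 + c); first by rewrite !addr_ge0 // mulr_ge0 // sqr_ge0.
move=> j j1; have j0 : (0 < j)%N by exact: ltnW.
have j0R : 0 < j%:R :> R by rewrite ltr0n.
have [h1 h2] := hc j j1.
have D0 : (0 < j ^ 2)%N by rewrite expn_gt0 j0.
have mt := @measurable_truncated_total R m n b (j ^ 2) (scale j).
have mf := @measurable_full_total R m n b (scale j).
have mC := @measurable_unit_cube R m n.
have M0 : 0 <= beta * S (scale j).
  by apply: mulr_ge0 => //; exact: sum_inv_enorm_ge0.
have i1 := integral_deviation_le m0 n0 b0 D0 (leq_scale j1).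
have i2 := integral_tail_le m0 n0 b0 (scale j) D0.
have j8 : 0 <= j%:R ^- 8 :> R by rewrite invr_ge0 exprn_ge0.
have j4 : 0 <= j%:R ^- 4 :> R by rewrite invr_ge0 exprn_ge0.
apply: (@le_trans _ _ ((j%:R ^- 8)%:E * \int[mu m n]_(A in C m n)
     ((truncated_total b (j ^ 2) (scale j) A - beta * S (scale j)) ^+ 2)%:E +
   (j%:R ^- 4)%:E * \int[mu m n]_(A in C m n)
     (full_total b (scale j) A - truncated_total b (j ^ 2) (scale j) A)%:E)%E).
  rewrite -ge0_integralZl //; last 2 first.
  - by apply/measurable_EFinP/measurable_funTS; apply: measurable_funX; exact: measurable_funB.
  - by move=> A _; rewrite lee_fin sqr_ge0.
  rewrite -ge0_integralZl //; last 2 first.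
  - by apply/measurable_EFinP/measurable_funTS; exact: measurable_funB.
  - by move=> A _; rewrite lee_fin subr_ge0 truncated_total_le.
  rewrite -ge0_integralD //; last 4 first.
  - by move=> A _; rewrite -EFinM lee_fin mulr_ge0 // sqr_ge0.
  - apply: measurable_funTS; apply: measurable_funeM; apply/measurable_EFinP.
    by apply: measurable_funX; exact: measurable_funB.
  - by move=> A _; rewrite -EFinM lee_fin mulr_ge0 // subr_ge0 truncated_total_le.
  - apply: measurable_funTS; apply: measurable_funeM; apply/measurable_EFinP.
    exact: measurable_funB.
  rewrite le_eqVlt; apply/orP; left; apply/eqP; apply: eq_integral => A _.
  by rewrite -!EFinM -EFinD /deviation [_ / _ ^+ 8]mulrC [_ / _ ^+ 4]mulrC.
apply: (@le_trans _ _ ((j%:R ^- 8)%:E * (c * j%:R ^+ 6 + 2 * c ^+ 2 * j%:R ^+ 6)%:E +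
    (j%:R ^- 4)%:E * (c * j%:R ^+ 2)%:E)%E).
  apply: leeD; apply: lee_wpmul2l; rewrite ?lee_fin //.
    apply: le_trans i1 _; rewrite lee_fin; apply: lerD => //.
    apply: (@le_trans _ _ (2 * (c * j%:R ^+ 4) ^+ 2 / (j ^ 2)%:R)).
      apply: ler_wpM2r => //; apply: ler_wpM2l => //.
      have cj : 0 <= c * j%:R ^+ 4 by apply: mulr_ge0 => //; exact: exprn_ge0.
      by rewrite lerXn2r.
    by rewrite natrX le_eqVlt; apply/orP; left; apply/eqP; field; rewrite gt_eqF.
  apply: le_trans i2 _; rewrite lee_fin natrX.
  apply: (@le_trans _ _ (c * j%:R ^+ 4 / j%:R ^+ 2)).
    by apply: ler_wpM2r => //; rewrite invr_ge0 exprn_ge0.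
  by rewrite le_eqVlt; apply/orP; left; apply/eqP; field; rewrite gt_eqF.
rewrite -!EFinM -EFinD lee_fin le_eqVlt; apply/orP; left; apply/eqP.
by field; rewrite gt_eqF.
Qed.

End almost_everywhere.

(** * Almost sure summability of the deviations *)

Section ae_deviation.
Variables (R : realType) (m n : nat) (b : R).
Hypotheses (m0 : (0 < m)%N) (n0 : (0 < n)%N) (b0 : 0 < b).
Local Notation RR := (measurableTypeR R).
Local Notation mu m n := (lebesgue_mx R m n).
Local Notation C m n := (@unit_cube R m n).
Local Notation Q K := (fset_set (@punctured_ball R n K%:R)).

(** A common divisor of [q] and [p] divides [z q], so [(p, q)] and [(p + z q, q)] have the same
    common divisors. This is why truncation preserves periodicity. *)
Lemma no_large_gcd_shift D (p : 'cV[int]_m) (q : 'cV[int]_n) (z : 'M[int]_(m, n)) :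
  no_large_gcd D (p + z *m q) q = no_large_gcd D p q.
Proof.
have dvdzq d : dvd_cV d q -> dvd_cV d (z *m q).
  move=> /forallP dq; apply/forallP => i; rewrite mxE.
  by apply: rpred_sum => j _; exact: dvdz_mull.
have dvdD d (x y : 'cV[int]_m) : dvd_cV d x -> dvd_cV d y -> dvd_cV d (x + y).
  move=> /forallP dx /forallP dy; apply/forallP => i; rewrite mxE.
  exact: rpredD.
have dvdN d (x : 'cV[int]_m) : dvd_cV d x -> dvd_cV d (- x).
  by move=> /forallP dx; apply/forallP => i; rewrite mxE rpredN.
rewrite /no_large_gcd; apply: asbool_equiv_eq; split => h d Dd; apply/negP => /andP[dp dq];
  have /negP := h d Dd; apply; rewrite dq andbT.
  by apply: dvdD => //; exact: dvdzq.
by rewrite -(addrK (z *m q) p); apply: dvdD => //; apply/dvdN/dvdzq.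
Qed.

Lemma truncated_count_periodic D r (q : 'cV[int]_n) : mx_periodic (@truncated_count R m n D r q).
Proof.
move=> A z; rewrite /truncated_count.
rewrite (reindex_esumT (e := fun p => p + z *m q) (e' := fun p => p - z *m q)).
- apply: eq_esum => p _; rewrite no_large_gcd_shift; congr (_ * ball_ind _ _)%E.
  by rewrite mulmxDl /int_cV map_mxD map_mxM opprD addrACA subrr addr0.
- by move=> p; rewrite addrK.
- by move=> p; rewrite subrK.
Qed.

Lemma deviation_periodic j (A : 'M[RR]_(m, n)) (z : 'M[int]_(m, n)) :
  deviation b j (A + map_mx intr z) = deviation b j A.
Proof.
have fE : full_total b (scale j) (A + map_mx intr z) = full_total b (scale j) A.
  apply: EFin_inj; rewrite -!sum_ball_count_eq_card; apply: eq_bigr => q _.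
  exact: (periodic_mulmx q (@ball_count_periodic R m _) A z).
have tE D : truncated_total b D (scale j) (A + map_mx intr z) = truncated_total b D (scale j) A.
  by congr fine; apply: eq_bigr => q _; exact: truncated_count_periodic.
by rewrite /deviation fE !tE.
Qed.

(** The series starts at 2, where [integral_deviation_scale] begins to apply. *)
Definition total_deviation (A : 'M[RR]_(m, n)) : \bar R :=
  (\sum_(j <oo) (deviation b j.+2 A)%:E)%E.

Lemma measurable_total_deviation : measurable_fun setT total_deviation.
Proof.
apply: ge0_emeasurable_sum => [k x _ _|k _].
  by rewrite lee_fin deviation_ge0.
by apply/measurable_EFinP; exact: measurable_deviation.
Qed.

Lemma total_deviation_ge0 A : (0 <= total_deviation A)%E.
Proof. by apply: nneseries_ge0 => k _ _; rewrite lee_fin deviation_ge0. Qed.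

Lemma integral_total_deviation_lty :
  (\int[mu m n]_(A in C m n) total_deviation A < +oo)%E.
Proof.
have [c c0 hc] := @integral_deviation_scale R m n b m0 n0 b0.
have mC := @measurable_unit_cube R m n.
rewrite integral_nneseries //; last 2 first.
- by move=> k; apply/measurable_EFinP/measurable_funTS; exact: measurable_deviation.
- by move=> k A _; rewrite lee_fin deviation_ge0.
apply: (@le_lt_trans _ _ c%:E); last exact: ltry.
apply: (@le_trans _ _ (\sum_(k <oo) (c * k.+2%:R ^- 2)%:E)%E).
  apply: lee_nneseries => [k _ _|k _]; last exact: hc.
  by apply: integral_ge0 => A _; rewrite lee_fin deviation_ge0.
apply: lime_le.
  by apply: is_cvg_nneseries => k _ _; rewrite lee_fin mulr_ge0 // invr_ge0 exprn_ge0.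
apply: nearW => k; rewrite sumEFin lee_fin -mulr_sumr -[leRHS]mulr1 ler_wpM2l //.
have := @sum_inv_sqr_le R 1 (k + 2) isT; rewrite invr1; apply: le_trans.
rewrite (big_addn 0 (k + 2) 2) addnK.
by under [leRHS]eq_bigr do rewrite addn2.
Qed.

(** The divergence set meets the cube in a null set, by integrability, and is invariant under
    integral translations. *)
Lemma ae_total_deviation_lty : {ae mu m n, forall A, (total_deviation A < +oo)%E}.
Proof.
have mC := @measurable_unit_cube R m n.
have mG := measurable_total_deviation.
pose N : set 'M[RR]_(m, n) := total_deviation @^-1` [set +oo%E].
have mN : measurable N.
  by rewrite -[X in measurable X]setTI; apply: mG => //; exact: emeasurable_set1.
have iG : (mu m n).-integrable (C m n) total_deviation.
  apply/integrableP; split; first exact: measurable_funTS.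
  under eq_integral do rewrite gee0_abs ?total_deviation_ge0 //.
  exact: integral_total_deviation_lty.
have NC0 : mu m n (N `&` C m n) = 0%E.
  apply/negligibleP; first exact: measurableI.
  apply: negligibleS (integrable_ae mC iG) => A [NA CA] /= /(_ CA).
  by rewrite NA.
have Gz (A : 'M[RR]_(m, n)) (z : 'M[int]_(m, n)) :
    total_deviation (A + map_mx intr z) = total_deviation A.
  by apply: eq_eseriesr => j _; congr EFin; exact: deviation_periodic.
have NP (A : 'M[RR]_(m, n)) : (A \in N) = (total_deviation A == +oo%E).
  by apply/idP/eqP => [/set_mem|h]; [exact: id|exact: mem_set].
have Nz (A : 'M[RR]_(m, n)) (z : 'M[int]_(m, n)) : (\1_N (A + map_mx intr z) : R) = \1_N A.
  rewrite !indicE; have -> // : (A + map_mx intr z \in N) = (A \in N).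
  by rewrite !NP Gz.
have N0 : mu m n N = 0%E.
  rewrite -[LHS](_ : (\int[mu m n]_A (\1_N A)%:E)%E = _); last first.
    by rewrite integral_indic // setIT.
  (* By invariance, each term of the unfolded indicator integrates to the measure of [N] within the
     cube, which is 0. *)
  rewrite -integral_unfold //; last first.
    by apply/measurable_EFinP; exact: measurable_indic.
  under eq_integral do under eq_esum do rewrite Nz.
  rewrite ge0_integral_esum //; last first.
    by move=> _; apply/measurable_EFinP; exact: measurable_indic.
  by rewrite esum1 // => z _; rewrite integral_indic.
exists N; split => // A /= h; rewrite /N /=.
by apply: contra_notP h => /eqP; rewrite -ltey.
Qed.

End ae_deviation.

(** * Convergence *)

Section pointwise.
Variables (R : realType) (m n : nat) (b : R).
Hypotheses (m0 : (0 < m)%N) (n0 : (0 < n)%N) (b0 : 0 < b).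
Local Notation beta := (mean_factor m b).
Local Notation B := (unit_ball_volume R n).

Lemma nneseries_lty_cvg0 (x : R^nat) : (forall k, 0 <= x k) ->
  (\sum_(k <oo) (x k)%:E < +oo)%E -> x @ \oo --> 0.
Proof.
move=> x0 xoo; apply: cvg_series_cvg_0; apply: nondecreasing_is_cvgn.
  by apply: nondecreasing_series => k _ _.
exists (fine (\sum_(k <oo) (x k)%:E)%E) => _ [k _ <-].
rewrite -lee_fin fineK; last first.
  by rewrite ge0_fin_numE // nneseries_ge0 // => i _ _; rewrite lee_fin.
rewrite /series /= -sumEFin; apply: nneseries_lim_ge => i _.
by rewrite lee_fin.
Qed.

Lemma leq_scale_id j : (j <= scale j)%N.
Proof.
apply: (@leq_trans (j ^ 4)%N); last exact/ltnW/ltn_expl.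
by case: j => // j; rewrite -[leqLHS]expn1 leq_pexp2l.
Qed.

Lemma cvg_scale : scale j @[j --> \oo] --> \oo.
Proof.
apply/cvgnyPge => A; near=> j; apply: (leq_trans _ (leq_scale_id j)).
by near: j; exact: nbhs_infty_ge.
Unshelve. all: by end_near.
Qed.

Lemma mean_scale_cvg :
  beta * sum_inv_enorm R n (scale j) / j%:R ^+ 4 @[j --> \oo] --> beta * (n%:R * B) * ln 2.
Proof.
apply: (@cvg_trans _ ((fun j => beta * (sum_inv_enorm R n (scale j) / ln (scale j)%:R) * ln 2) @ \oo)).
  apply: near_eq_cvg; near=> j.
  have j0 : (0 < j)%N by near: j; exact: nbhs_infty_gt.
  have jn : j%:R != 0 :> R by rewrite pnatr_eq0 -lt0n.
  have l2 : ln 2 != 0 :> R by rewrite gt_eqF // ln2_gt0.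
  by rewrite ln_scale; field; rewrite jn l2.
apply: cvgM; last exact: cvg_cst.
apply: cvgM; first exact: cvg_cst.
exact: (cvg_comp _ _ cvg_scale (sum_inv_enorm_cvg n0)).
Unshelve. all: by end_near.
Qed.

Lemma full_total_scale_cvg (A : 'M[R]_(m, n)) : (total_deviation b A < +oo)%E ->
  full_total b (scale j) A / j%:R ^+ 4 @[j --> \oo] --> beta * (n%:R * B) * ln 2.
Proof.
move=> Aoo.
have d0 : deviation b j A @[j --> \oo] --> 0.
  have := nneseries_lty_cvg0 (fun k => deviation_ge0 b k.+2 A) Aoo.
  by rewrite (cvg_shiftS (fun k => deviation b k.+1 A)) (cvg_shiftS (fun k => deviation b k A)).
have diff0 : (full_total b (scale j) A - beta * sum_inv_enorm R n (scale j)) / j%:R ^+ 4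
   @[j --> \oo] --> 0.
  apply/cvgrPdist_le => e e0.
  (* A deviation below [e' ^+ 2] gives [e'] for the truncated part and [e' ^+ 2 <= e'] for the
     discarded mass. *)
  pose e' := Num.min 1 (e / 2).
  have e'0 : 0 < e' by rewrite lt_min ltr01 divr_gt0.
  have e'1 : e' <= 1 by rewrite ge_min lexx.
  have e'2 : e' <= e / 2 by rewrite ge_min lexx orbT.
  have e'20 : 0 < e' ^+ 2 by rewrite exprn_gt0.
  move/cvgrPdist_le: d0 => /(_ _ e'20) d0.
  near=> j.
  have j0 : (0 < j)%N by near: j; exact: nbhs_infty_gt.
  have j0R : 0 < j%:R :> R by rewrite ltr0n.
  have dj : `|0 - deviation b j A| <= e' ^+ 2 by near: j; exact: d0.
  move: dj; rewrite sub0r normrN ger0_norm ?deviation_ge0 // /deviation.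
  set t := truncated_total _ _ _ _; set f := full_total _ _ _; set M := beta * _.
  have ft : t <= f by exact: truncated_total_le.
  have j4 : 0 <= j%:R ^- 4 :> R by rewrite invr_ge0 exprn_ge0.
  have -> : (t - M) ^+ 2 / j%:R ^+ 8 = ((t - M) / j%:R ^+ 4) ^+ 2.
    by field; rewrite gt_eqF.
  move=> h.
  have x0 : 0 <= ((t - M) / j%:R ^+ 4) ^+ 2 by exact: sqr_ge0.
  have y0 : 0 <= (f - t) / j%:R ^+ 4 by rewrite mulr_ge0 // subr_ge0.
  have h1 : `|(t - M) / j%:R ^+ 4| <= e'.
    rewrite -(@ler_pXn2r _ 2) ?nnegrE ?(ltW e'0) // real_normK ?num_real //; lra.
  have h2 : (f - t) / j%:R ^+ 4 <= e'.
    apply: (@le_trans _ _ (e' ^+ 2)); first by lra.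
    by rewrite expr2 ler_piMr // ltW.
  rewrite sub0r normrN.
  have -> : (f - M) / j%:R ^+ 4 = (f - t) / j%:R ^+ 4 + (t - M) / j%:R ^+ 4 by ring.
  by apply: le_trans (ler_normD _ _) _; rewrite (ger0_norm y0); lra.
rewrite (_ : (fun j => _) = (fun j : nat =>
    (full_total b (scale j) A - beta * sum_inv_enorm R n (scale j)) / j%:R ^+ 4 +
    beta * sum_inv_enorm R n (scale j) / j%:R ^+ 4)); last first.
  by apply/funext => j; rewrite -mulrDl subrK.
by rewrite -[X in _ --> X]add0r; exact: (cvgD diff0 mean_scale_cvg).
Unshelve. all: by end_near.
Qed.

Lemma le_count_approximations (A : 'M[R]_(m, n)) (T T' : R) : T <= T' ->
  (count_approximations A b T <= count_approximations A b T')%N.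
Proof.
move=> TT'; apply: fsubset_leq_card.
rewrite -fset_set_sub; [|exact: finite_approximations|exact: finite_approximations].
by move=> pq [h /andP[q1 qT]]; split => //; rewrite q1 (lt_le_trans qT).
Qed.

Lemma between_scales (J : nat) (T : R) : (scale J)%:R <= T ->
  exists2 j, (J <= j)%N & (scale j)%:R <= T < (scale j.+1)%:R.
Proof.
move=> JT.
have [N _ HN] : \forall j \near \oo, T < (scale j)%:R.
  have /cvgnyPgt/(_ (Num.bound T)) := cvg_scale; apply: filterS => j Tj.
  have [T0|T0] := leP 0 T; last by rewrite (lt_le_trans T0).
  by rewrite (lt_trans (archi_boundP T0)) // ltr_nat.
have ex : exists k, T < (scale (J + k).+1)%:R.
  by exists N; apply: HN => /=; rewrite -addnS (leq_trans _ (leq_addl _ _)).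
have [k kT kmin] := ex_minnP ex.
exists (J + k)%N; first exact: leq_addr.
rewrite kT andbT; case: k kT kmin => [|k] kT kmin; first by rewrite addn0.
rewrite leNgt; apply/negP => h; have := kmin k; rewrite -addnS h => /(_ isT).
by rewrite ltnn.
Qed.

(** Pairs the count at one scale with the logarithm at a neighbouring one, as monotonicity in [T]
    requires; this is harmless since [(j / (j + 1)) ^+ 4] tends to 1. *)
Lemma full_total_ratio_cvg (c : R) (A : 'M[R]_(m, n)) : 0 < c ->
  full_total b (scale j) A / j%:R ^+ 4 @[j --> \oo] --> c * ln 2 ->
  (full_total b (scale j.+1) A / (c * ln (scale j)%:R) @[j --> \oo] --> (1 : R)) /\
  (full_total b (scale j) A / (c * ln (scale j.+1)%:R) @[j --> \oo] --> (1 : R)).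
Proof.
move=> c0 fc; have l0 := ln2_gt0 R.
have cl0 : c * ln 2 != 0 by rewrite gt_eqF // mulr_gt0.
have r1 : (1 - j.+1%:R^-1) ^+ 4 @[j --> \oo] --> (1 : R).
  rewrite -[X in _ --> X](expr1n R 4).
  apply: (@continuous_cvg _ _ _ _ _ _ (fun y : R => y ^+ 4)); first exact: exprn_continuous.
  rewrite -[X in _ --> X]subr0; apply: cvgB; first exact: cvg_cst.
  exact: cvg_harmonic.
have r2 : ((1 - j.+1%:R^-1) ^+ 4)^-1 @[j --> \oo] --> (1 : R).
  by rewrite -[X in _ --> X]invr1; apply: cvgV => //; exact: oner_neq0.
have fc1 : full_total b (scale j.+1) A / j.+1%:R ^+ 4 @[j --> \oo] --> c * ln 2.
  by rewrite (cvg_shiftS (fun j => full_total b (scale j) A / j%:R ^+ 4)).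
have E (j : nat) : 1 - j.+1%:R^-1 = j%:R / j.+1%:R :> R.
  by rewrite -natr1; field; rewrite natr1 pnatr_eq0.
split.
- suff : full_total b (scale j.+1) A / (c * ln (scale j)%:R) @[j --> \oo] -->
      c * ln 2 * 1 / (c * ln 2) by rewrite mulr1 divff.
  apply: (@cvg_trans _ ((fun j => full_total b (scale j.+1) A / j.+1%:R ^+ 4 *
      ((1 - j.+1%:R^-1) ^+ 4)^-1 / (c * ln 2)) @ \oo)); last first.
    by apply: cvgM; [exact: cvgM|exact: cvg_cst].
  apply: near_eq_cvg; near=> j; rewrite E ln_scale.
  have j0 : j%:R != 0 :> R by rewrite pnatr_eq0 -lt0n; near: j; exact: nbhs_infty_gt.
  have j1 : j.+1%:R != 0 :> R by rewrite pnatr_eq0.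
  have c1 : c != 0 by rewrite gt_eqF.
  have l1 : ln 2 != 0 :> R by rewrite gt_eqF.
  by move: j1; move: (j.+1%:R : R) => x j1; field; rewrite ?j0 ?j1 ?c1 ?l1.
- suff : full_total b (scale j) A / (c * ln (scale j.+1)%:R) @[j --> \oo] -->
      c * ln 2 * 1 / (c * ln 2) by rewrite mulr1 divff.
  apply: (@cvg_trans _ ((fun j => full_total b (scale j) A / j%:R ^+ 4 *
      (1 - j.+1%:R^-1) ^+ 4 / (c * ln 2)) @ \oo)); last first.
    by apply: cvgM; [exact: cvgM|exact: cvg_cst].
  apply: near_eq_cvg; near=> j; rewrite E ln_scale.
  have j0 : j%:R != 0 :> R by rewrite pnatr_eq0 -lt0n; near: j; exact: nbhs_infty_gt.
  have j1 : j.+1%:R != 0 :> R by rewrite pnatr_eq0.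
  have c1 : c != 0 by rewrite gt_eqF.
  have l1 : ln 2 != 0 :> R by rewrite gt_eqF.
  by move: j1; move: (j.+1%:R : R) => x j1; field; rewrite ?j0 ?j1 ?c1 ?l1.
Unshelve. all: by end_near.
Qed.

Lemma count_approximations_cvg (c : R) (A : 'M[R]_(m, n)) : 0 < c ->
  full_total b (scale j) A / j%:R ^+ 4 @[j --> \oo] --> c * ln 2 ->
  (count_approximations A b T)%:R / (c * ln T) @[T --> +oo] --> (1 : R).
Proof.
move=> c0 /(full_total_ratio_cvg c0)[up lo].
apply/cvgrPdist_le => e e0.
move/cvgrPdist_le: up => /(_ _ e0) [N1 _ H1].
move/cvgrPdist_le: lo => /(_ _ e0) [N2 _ H2].
near=> T.
(* The bound 1 in the maximum makes [ln (scale j)] positive. *)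
have T2 : (scale (maxn 1 (maxn N1 N2)))%:R <= T.
  by near: T; apply: nbhs_pinfty_ge; exact: num_real.
have [j Jj /andP[jT Tj]] := between_scales T2.
have j0 : (0 < j)%N by apply: leq_trans Jj; exact: leq_maxl.
have K1 : 1 < (scale j)%:R :> R.
  by rewrite ltr1n /scale -[ltnLHS](expn0 2) ltn_exp2l // expn_gt0 j0.
have T1 : 1 < T by exact: lt_le_trans jT.
have lT : 0 < ln T by exact: ln_gt0.
have l1 : 0 < ln (scale j)%:R :> R by exact: ln_gt0.
have K0 : 0 < (scale j)%:R :> R by exact: lt_trans K1.
have T0 : 0 < T by exact: lt_trans T1.
have K'0 : 0 < (scale j.+1)%:R :> R by exact: lt_trans Tj.
have l12 : ln (scale j)%:R <= ln T by rewrite ler_ln ?posrE.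
have l23 : ln T <= ln (scale j.+1)%:R by rewrite ler_ln ?posrE // ltW.
have l3 : 0 < ln (scale j.+1)%:R :> R by exact: lt_le_trans l23.
have u : (count_approximations A b T)%:R / (c * ln T) <=
    full_total b (scale j.+1) A / (c * ln (scale j)%:R).
  apply: ler_pM; rewrite ?invr_ge0 ?mulr_ge0 ?(ltW c0) ?(ltW lT) //.
    by rewrite /full_total ler_nat le_count_approximations // ltW.
  by rewrite lef_pV2 ?posrE ?mulr_gt0 // ler_wpM2l // ltW.
have v : full_total b (scale j) A / (c * ln (scale j.+1)%:R) <=
    (count_approximations A b T)%:R / (c * ln T).
  apply: ler_pM; rewrite ?invr_ge0 ?mulr_ge0 ?(ltW c0) ?(ltW l3) //.
    by rewrite /full_total ler_nat le_count_approximations.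
  by rewrite lef_pV2 ?posrE ?mulr_gt0 // ler_wpM2l // ltW.
have N1j : (N1 <= j)%N by apply: leq_trans Jj; rewrite !leq_max leqnn orbT.
have N2j : (N2 <= j)%N by apply: leq_trans Jj; rewrite !leq_max leqnn !orbT.
have := H1 j N1j; have := H2 j N2j; rewrite /= !ler_norml => /andP[_ h1] /andP[h2 _].
by apply/andP; split; lra.
Unshelve. all: by end_near.
Qed.

End pointwise.

Unset Implicit Arguments.

Theorem theorem1p3 (R : realType) (m n : nat)
    (m_gt0 : (0 < m)%N) (n_gt0 : (0 < n)%N) (b : R) (b_gt0 : 0 < b) :
  {ae lebesgue_mx R m n, forall A : 'M[R]_(m, n),
    (count_approximations A b T)%:R /
      (b ^+ m * unit_ball_volume R m * unit_sphere_area R n * ln T)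
      @[T --> +oo] --> (1 : R)}.
Proof.
apply: filterS (ae_total_deviation_lty m_gt0 n_gt0 b_gt0) => A Aoo.
(* The identity [C_n = n * B_n] matches the limit of [sum_inv_enorm K / ln K]. *)
rewrite unit_sphere_areaE //; apply: count_approximations_cvg.
  by rewrite !mulr_gt0 ?exprn_gt0 ?unit_ball_volume_gt0 // ltr0n.
exact: full_total_scale_cvg.
Qed.
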